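(* Let $(X_1,Y_1),(X_2,Y_2),\dots$ be i.i.d. random vectors with law $\mathbf P$ on $(a,b)\times(c,d)\subset\mathbb R^2$, joint distribution function $H$ and marginal distribution functions $F$ (of $X_1$) and $G$ (of $Y_1$). Let $k_n$ be positive integers with $k_n\to\infty$ and $k_n/n<c_0<\infty$ for all $n$; given $(X_1,Y_1),\dots,(X_n,Y_n)$, let $(X_1^*,Y_1^* ),\dots,(X_{k_n}^*,Y_{k_n}^* )$ be i.i.d. with law the empirical measure $\widehat{\mathbf P}_n$ of $(X_1,Y_1),\dots,(X_n,Y_n)$. Let $\widehat C_n$ and $C^*_{k_n}$ be the empirical copula functions of the sample and of the bootstrap sample. Let $a_n>0$ be a decreasing sequence with $a_n\to0$, $a_{n+1}/a_n\to1$, $k_na_n^2\to\infty$ as $n\to\infty$. Let $0<p_1<q_1<1$, $0<p_2<q_2<1$. Suppose that for some $\epsilon>0$, $F$ and $G$ are continuously differentiable on $[F^{-1}(p_1)-\epsilon,F^{-1}(q_1)+\epsilon]$ and $[G^{-1}(p_2)-\epsilon,G^{-1}(q_2)+\epsilon]$ respectively, with strictly positive densities $f$ and $g$ there, and that $\partial H/\partial x$ and $\partial H/\partial y$ exist and are continuous on the product of these two intervals. Then, for any $\Omega\subset\ell_\infty([p_1,q_1]\times[p_2,q_2])$, $$\liminf_{n\to\infty}(k_na_n^2)^{-1}\log(\widehat{\mathbf P}_n)_*\big(C^*_{k_n}-\widehat C_n\in a_n\Omega\big)\ge-I_C(\mathrm{int}(\Omega))\quad a.s._*$$ and $$\limsup_{n\to\infty}(k_na_n^2)^{-1}\log(\widehat{\mathbf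 P}_n)^*\big(C^*_{k_n}-\widehat C_n\in a_n\Omega\big)\le-I_C(\mathrm{cl}(\Omega))\quad a.s.^*,$$ where, for $\Psi\subset\ell_\infty([p_1,q_1]\times[p_2,q_2])$, $$I_C(\Psi)=\inf\Big\{\rho_0^2(\mathbf Q,\mathbf P):\ \mathbf Q\in\Lambda_{0\Theta_2},\ \mathbf Q\ll\mathbf P,\ q=\frac{d\mathbf Q}{d\mathbf P},\ \alpha(s,t)=\int_{-\infty}^s\int_{-\infty}^tq(x,y)\,H(dx,dy),\ \Phi'_H(\alpha)=\phi,\ \phi\in\Psi\Big\}$$ and, for $(u,v)\in[p_1,q_1]\times[p_2,q_2]$, $$\Phi'_H(\alpha)(u,v)=\alpha(F^{-1}(u),G^{-1}(v))-\frac{\partial H}{\partial x}(F^{-1}(u),G^{-1}(v))\frac{\alpha(F^{-1}(u),\infty)}{f(F^{-1}(u))}-\frac{\partial H}{\partial y}(F^{-1}(u),G^{-1}(v))\frac{\alpha(\infty,G^{-1}(v))}{g(G^{-1}(v))}.$$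
   Context: For a distribution function $K$ on the line, $K^{-1}(u)=\inf\{x:K(x)\ge u\}$, $u\in(0,1)$. Empirical copula functions: $\widehat C_n(u,v)=\widehat H_n(\widehat F_n^{-1}(u),\widehat G_n^{-1}(v))$, where $\widehat H_n$, $\widehat F_n$, $\widehat G_n$ are the joint and marginal empirical distribution functions of $(X_i,Y_i)_{i\le n}$; $C^*_{k_n}(u,v)=H^*_{k_n}((F^*_{k_n})^{-1}(u),(G^*_{k_n})^{-1}(v))$ is defined in the same way from $(X_i^*,Y_i^* )_{i\le k_n}$. They are regarded as functions on $[p_1,q_1]\times[p_2,q_2]$. $\ell_\infty(T)$ is the space of bounded functions on $T$ with norm $\|z\|=\sup_{s\in T}|z(s)|$; $\mathrm{int}$ and $\mathrm{cl}$ are taken in this norm. $\Theta_2$ is the set of measurable $w:\mathbb R^2\to\mathbb R$ with $\int w^2\,d\mathbf P<\infty$; $\Lambda_{0\Theta_2}$ is the set of signed measures $\mathbf Q$ of bounded variation with total mass $0$ and $\int|w|\,d|\mathbf Q|<\infty$ for all $w\in\Theta_2$. $\rho_0^2(\mathbf Q,\mathbf P)=\frac12\int\left(\frac{d\mathbf Q}{d\mathbf P}\right)^2d\mathbf P$ if $\mathbf Q\ll\mathbf P$ and $\infty$ otherwise. $\inf\emptyset=\infty$. Outer/inner probability: for a probability space $(\Upsilon,\mathcal A,\mathbf R)$ and $B\subset\Upsilon$, $(\mathbf R)^*(B)=\inf\{\mathbf R(A):B\subseteq A\in\mathcal A\}$, $(\mathbf R)_*(B)=1-(\mathbf R)^*(\Upsilon\setminus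 B)$. $(\widehat{\mathbf P}_n)^*$ and $(\widehat{\mathbf P}_n)_*$ are the outer and inner versions of the conditional probability for the bootstrap sample given $(X_1,Y_1),\dots,(X_n,Y_n)$. Almost sure relations for not necessarily measurable $Z_n$ on the probability space of the sample: ''$\liminf Z_n\ge c$ a.s.$_*$'' means there are measurable $\Delta_n\le Z_n$ with $\mathbf P(\liminf_n\Delta_n\ge c)=1$; ''$\limsup Z_n\le c$ a.s.$^*$'' means $\liminf(-Z_n)\ge-c$ a.s.$_*$; ''$\limsup Z_n=-\infty$ a.s.$^*$'' means $\liminf(-Z_n)\ge c$ a.s.$_*$ for all $c>0$ (used when the right-hand side of the upper bound is $-\infty$). *)

(* Defs.v *)
From HB Require Import structures.
From mathcomp Require Export all_boot all_order all_algebra.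
From mathcomp Require Export all_classical all_reals all_analysis.
From mathcomp Require Export measurable_realfun.
Export Order.TTheory GRing.Theory Num.Theory.
Export numFieldNormedType.Exports.

Set Implicit Arguments.
Unset Strict Implicit.
Unset Printing Implicit Defensive.

Local Open Scope classical_set_scope.
Local Open Scope ring_scope.
Local Open Scope charge_scope.

(** Distribution functions of a law [mu] on the plane. They take a plain set
    function, so that they apply both to probability measures and to
    [empirical] below. *)
Section distribution_functions.
Context {R : realType}.
Implicit Type mu : set (R * R) -> \bar R.

Definition joint_df mu (x y : R) : R :=
  fine (mu (`]-oo, x]%classic `*` `]-oo, y]%classic)).

Definition left_df mu (x : R) : R := fine (mu (`]-oo, x]%classic `*` setT)).

Definition right_df mu (y : R) : R := fine (mu (setT `*` `]-oo, y]%classic)).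

Definition quantile (K : R -> R) (u : R) : R := inf [set x | u <= K x].

Definition copula mu (uv : R * R) : R :=
  joint_df mu (quantile (left_df mu) uv.1) (quantile (right_df mu) uv.2).

(** Meant for [0 < n]; it is the null set function for [n = 0]. *)
Definition empirical (n : nat) (z : nat -> R * R) : set (R * R) -> \bar R :=
  fun A => ((n%:R^-1)%:E * \sum_(i < n) \d_(z i) A)%E.

End distribution_functions.

Section random_variables.
Context {d d' : measure_display} {T : measurableType d} {S : measurableType d'}
        {R : realType}.

Definition independent_on (Pr : probability T R) (D : set nat)
    (Z : nat -> T -> S) : Prop :=
  forall (J : seq nat) (A : nat -> set S),
    uniq J -> (forall i, i \in J -> D i /\ measurable (A i)) ->
    Pr (\bigcap_(i in [set` J]) Z i @^-1` A i) =
      (\prod_(i <- J) fine (Pr (Z i @^-1` A i)))%:E.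

Definition iid_with_law (Pr : probability T R) (D : set nat)
    (Z : nat -> T -> S) (mu : set S -> \bar R) : Prop :=
  [/\ forall i, D i -> measurable_fun setT (Z i),
      forall i, D i -> forall A, measurable A -> Pr (Z i @^-1` A) = mu A
    & independent_on Pr D Z].

End random_variables.

Section outer_inner.
Context {d : measure_display} {T : measurableType d} {R : realType}.
Variable Pr : probability T R.
Local Open Scope ereal_scope.

Definition outer_prob (B : set T) : \bar R :=
  ereal_inf [set Pr A | A in [set A | measurable A /\ B `<=` A]].

Definition inner_prob (B : set T) : \bar R := 1 - outer_prob (~` B).

(** The minorants [D n] are extended real valued since [Z n], a normalized
    logarithm of a probability, may be infinite. *)
Definition liminf_ge_as (Z : nat -> T -> \bar R) (c : \bar R) : Prop :=
  exists D : nat -> T -> \bar R,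
    [/\ forall n, measurable_fun setT (D n),
        forall n w, D n w <= Z n w
      & Pr [set w | c <= limn_einf (D ^~ w)] = 1].

Definition limsup_le_as (Z : nat -> T -> \bar R) (c : \bar R) : Prop :=
  if c == -oo then
    forall r : R, (0 < r)%R -> liminf_ge_as (fun n w => - Z n w) r%:E
  else liminf_ge_as (fun n w => - Z n w) (- c).

End outer_inner.

(** [ell_infty S] is the set of bounded functions on [S]; interior and closure
    are those of subsets of this space for the supremum norm. *)
Section ell_infty.
Context {R : realType} {S : Type}.
Implicit Types (z w : S -> R) (Om : set (S -> R)).

Definition ell_infty : set (S -> R) :=
  [set z | exists M, forall s, `|z s| <= M].

Definition sup_norm z : R := sup (range (fun s => `|z s|)).

Definition linf_interior Om : set (S -> R) :=
  [set z | ell_infty z /\ exists2 e : R, 0 < e &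
     forall w, ell_infty w -> sup_norm (fun s => w s - z s) < e -> Om w].

Definition linf_closure Om : set (S -> R) :=
  [set z | ell_infty z /\ forall e : R, 0 < e ->
     exists w, [/\ ell_infty w, Om w & sup_norm (fun s => w s - z s) < e]].

Definition scale_set (c : R) Om : set (S -> R) :=
  [set (fun s => c * z s) | z in Om].

End ell_infty.

Section rate_function.
Context {R : realType}.
Variable P : probability (R * R)%type R.
Local Notation signed_measure := ({charge set (R * R)%type -> \bar R})%R.
Implicit Type Q : signed_measure.

Definition Theta2 : set (R * R -> R) :=
  [set w : R * R -> R | measurable_fun setT w /\
           (\int[P]_z ((w z) ^+ 2)%:E < +oo)%E].

(** Charges are finite valued, hence of bounded variation. The variation
    [charge_variation] of [Q] is the same for all Hahn decompositions. *)
Definition Lambda0Theta2 : set signed_measure :=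
  [set Q : signed_measure | Q setT = 0%E /\
    forall w, Theta2 w ->
    forall (A N : set (R * R)) (QAN : hahn_decomposition Q A N),
      (\int[charge_variation QAN]_z `|w z|%:E < +oo)%E].

Definition rho02 Q : \bar R :=
  if `[< Q `<< P >] then ((2^-1)%:E * \int[P]_z ('d Q '/d P z) ^+ 2)%E
  else +oo%E.

(** The arguments may be infinite: [alpha Q s +oo] and [alpha Q +oo t]. *)
Definition alpha Q (s t : \bar R) : R :=
  fine (\int[P]_(z in [set z : R * R | (z.1%:E <= s)%E /\ (z.2%:E <= t)%E])
          'd Q '/d P z).

Definition dHdx (x y : R) : R := derive1 (fun x' => joint_df P x' y) x.

Definition dHdy (x y : R) : R := derive1 (fun y' => joint_df P x y') y.

(** The densities of the marginals are the derivatives of their distribution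
    functions. *)
Definition dPhi (al : \bar R -> \bar R -> R) (uv : R * R) : R :=
  let x := quantile (left_df P) uv.1 in
  let y := quantile (right_df P) uv.2 in
  al x%:E y%:E
  - dHdx x y * (al x%:E +oo%E / derive1 (left_df P) x)
  - dHdy x y * (al +oo%E y%:E / derive1 (right_df P) y).

Definition rect (p1 q1 p2 q2 : R) : set (R * R) :=
  `[p1, q1]%classic `*` `[p2, q2]%classic.

Definition I_C (p1 q1 p2 q2 : R) (Psi : set (rect p1 q1 p2 q2 -> R)) : \bar R :=
  ereal_inf [set rho02 Q | Q in
    [set Q : signed_measure | [/\ Lambda0Theta2 Q, Q `<< P &
       exists phi : rect p1 q1 p2 q2 -> R,
         (fun s => dPhi (alpha Q) (val s)) = phi /\ Psi phi]]].

End rate_function.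

(* Main.v *)
(** Idea. Only finitely many cells matter. On a fixed dyadic grid the bootstrap
    frequencies of the cells satisfy a Gaussian-type moderate deviation bound
    with rate [1/2 sum_c D_c^2 / P(c)], by exponential Markov inequalities for the
    upper bound and by tilting for the lower bound. Between the grid points the
    increments of (bootstrap - sample) distribution functions are controlled by
    dyadic chaining with Bernstein's inequality, down to a scale comparable with
    [a_n]; below that scale monotonicity suffices. The sample itself enters only
    through a Bernstein event at scale [a_n], which holds eventually almost surely
    by Borel-Cantelli. A deterministic delta method for the copula map turns
    closeness of the distribution functions into closeness of the copulas, and
    the rate function is matched with the cell rates by describing densities of
    half squared L2 norm at most [r] through finite partitions: this class is
    compact for pointwise convergence on measurable sets. *)

From HB Require Import structures.
Require Import Defs.
From mathcomp Require Import all_boot all_order all_algebra.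
From mathcomp Require Import all_classical all_reals all_analysis.
From mathcomp Require Import measurable_realfun.
From mathcomp Require Import ring lra.

Set Implicit Arguments.
Unset Strict Implicit.
Unset Printing Implicit Defensive.

Local Open Scope classical_set_scope.
Local Open Scope ring_scope.

(** * Moderate deviations for finitely many cells *)

(** Since [k_n * a_n ^ 2] may grow arbitrarily slowly, [a_n] need not dominate the almost sure
    distance between empirical and true distribution functions. The bootstrap copula is therefore
    linearized at the quantiles of the sample, and what is asked of the sample is consistency
    without a rate, together with increments over distances of order [a_n] that are small compared
    with [a_n]. The latter fail with probability about [a_n ^ -2 * exp (- c * n * a_n)], which is
    summable because [n * a_n] is at least of order [sqrt n]. For the bootstrap, an increment at
    dyadic level [j] has mass of order [2 ^ -j] and is allowed an error of order
    [a_n * (3 / 4) ^ j]. These errors are summable, while Bernstein's exponent is of order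
    [k_n * a_n ^ 2 * (9 / 8) ^ j]: above a high enough coarse level it beats the [4 ^ j] grid points
    and any prescribed exponential rate. Fluctuations between coarse grid points thus disappear at
    the speed of the theorem, and the rate comes from finitely many cells. *)

Section exponential_bounds.
Context {R : realType}.
Implicit Types x y : R.

(** As [(n + 3)! >= 2 ^ (n + 1)], the term of index [n + 3] is at most [|x| ^ 3 * 2 ^ -(n + 1)]; the
    factor [1 - 2 ^ -n] makes the induction telescope. *)
Lemma series_exp_coeff_bound x (n : nat) : `|x| <= 1 ->
  `|series (exp_coeff x) n.+3 - (1 + x + x ^+ 2 / 2)| <=
  `|x| ^+ 3 * (1 - 2^-1 ^+ n).
Proof.
move=> x1; rewrite /series /=; elim: n => [|n IH].
  rewrite !big_nat_recr //= big_nil /exp_coeff /= !factS fact0 !muln1.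
  rewrite !expr0 expr1 !divr1 subrr mulr0.
  rewrite [X in `|X|](_ : _ = 0) ?normr0//.
  by rewrite add0r subrr.
rewrite big_nat_recr //=.
set S := \sum_(0 <= i < n.+3) _ in IH *.
have fl : (2 ^ n.+1 <= (n.+3)`!)%N.
  elim: (n) => // m IHm; rewrite expnS factS; apply: leq_mul => //.
have h2 : `|exp_coeff x n.+3| <= `|x| ^+ 3 * 2^-1 ^+ n.+1.
  have -> : `|exp_coeff x n.+3| = `|x| ^+ 3 * (`|x| ^+ n * (n.+3)`!%:R^-1).
    rewrite /exp_coeff/= normrM normrX normfV normr_nat mulrA -exprD.
    by rewrite (addnC 3%N) addn3.
  rewrite ler_wpM2l ?exprn_ge0// -[leRHS]mul1r ler_pM ?invr_ge0 ?exprn_ge0//.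
    exact: exprn_ile1.
  rewrite exprVn lef_pV2 ?posrE ?exprn_gt0 ?ltr0n ?fact_gt0//.
  by rewrite -natrX ler_nat.
rewrite addrAC (le_trans (ler_normD _ _))//.
rewrite (le_trans (lerD IH h2))// -mulrDr ler_wpM2l ?exprn_ge0//.
rewrite exprS; lra.
Qed.

Lemma expR_taylor2 x : `|x| <= 1 ->
  `|expR x - (1 + x + x ^+ 2 / 2)| <= `|x| ^+ 3.
Proof.
move=> x1.
have cv : `|series (exp_coeff x) n - (1 + x + x ^+ 2 / 2)| @[n --> \oo] -->
    `|expR x - (1 + x + x ^+ 2 / 2)|.
  apply: cvg_norm; apply: cvgB; last exact: cvg_cst.
  exact: is_cvg_series_exp_coeff.
rewrite -(cvg_lim _ cv)//; apply: limr_le; first by apply/cvg_ex; eexists; exact: cv.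
near=> n.
have [m ->] : exists m, n = m.+3.
  exists (n - 3)%N; rewrite -addn3 subnK//; near: n; exact: nbhs_infty_ge.
rewrite (le_trans (series_exp_coeff_bound _ x1))// ler_piMr ?exprn_ge0//.
Unshelve. all: by end_near. Qed.

Lemma expR_le_quadratic x : `|x| <= 2^-1 -> expR x <= 1 + x + x ^+ 2.
Proof.
move=> x1; have x1' : `|x| <= 1 by lra.
have := expR_taylor2 x1'; rewrite ler_norml => /andP[_].
have -> : `|x| ^+ 3 = `|x| * x ^+ 2 by rewrite exprS real_normK// num_real.
have := sqr_ge0 x; nra.
Qed.

Lemma expR_le_cubic x : `|x| <= 1 -> expR x <= 1 + x + x ^+ 2 / 2 + `|x| ^+ 3.
Proof. move=> /expR_taylor2; rewrite ler_norml => /andP[_]; lra. Qed.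

(** An upper bound for [log (1 + x)] to second order, meant for densities of tilted laws. With [y]
    the exponent, [y ^ 2 >= x ^ 2 - 5 |x| ^ 3] and [|y| ^ 3 <= 8 |x| ^ 3], so the Taylor bound at
    [y] loses at most [10.5 |x| ^ 3], below the [16] granted. *)
Lemma le1D_expR x : `|x| <= 8^-1 ->
  1 + x <= expR (x - x ^+ 2 / 2 + 16 * `|x| ^+ 3).
Proof.
set t := `|x| => ht; set y := x - _ + _.
have t0 : 0 <= t by exact: normr_ge0.
have xt : x ^+ 2 = t ^+ 2 by rewrite real_normK// num_real.
have xy : `|y - x| <= (5/2) * t ^+ 2.
  rewrite /y xt ler_norml; apply/andP; split; nra.
have y2t : `|y| <= 2 * t.
  rewrite -[y](subrK x) (le_trans (ler_normD _ _))// -/t; nra.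
have y1 : `|y| <= 1 by lra.
have y3 : `|y| ^+ 3 <= 8 * t ^+ 3.
  rewrite (_ : 8 * t ^+ 3 = (2 * t) ^+ 3); last by ring.
  by rewrite lerXn2r// nnegrE ?mulr_ge0.
have y2 : t ^+ 2 - 5 * t ^+ 3 <= y ^+ 2.
  have : `|x * (y - x)| <= (5/2) * t ^+ 3.
    rewrite normrM -/t exprS mulrCA ler_wpM2l//.
  rewrite ler_norml => /andP[h _].
  have : 0 <= (y - x) ^+ 2 by exact: sqr_ge0.
  nra.
have := expR_taylor2 y1; rewrite ler_norml => /andP[h _].
have t3 : 0 <= t ^+ 3 by exact: exprn_ge0.
move: h y2 y3; set e := expR y; set u := y ^+ 2; set v := `|y| ^+ 3.
rewrite /y xt; set w := t ^+ 2; set z := t ^+ 3 in t3 *.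
lra.
Qed.

End exponential_bounds.

Section product_law.
Context {R : realType} {C : finType}.
Variables (p : C -> R) (k : nat).
Hypothesis p_ge0 : forall c, 0 <= p c.
Implicit Type x : {ffun 'I_k -> C}.

Definition prodw x : R := \prod_i p (x i).

Definition freq x (A : pred C) : R := k%:R^-1 * \sum_i (A (x i))%:R.

Lemma prodw_ge0 x : 0 <= prodw x.
Proof. exact: prodr_ge0. Qed.

Lemma sum_prodw_expR (g : C -> R) :
  \sum_x prodw x * expR (\sum_i g (x i)) = (\sum_c p c * expR (g c)) ^+ k.
Proof.
rewrite -[in RHS](card_ord k) -prodr_const bigA_distr_bigA /=.
by apply: eq_bigr => x _; rewrite expR_sum -big_split.
Qed.

Lemma prodw_markov (E : pred {ffun 'I_k -> C}) (g : C -> R) tau :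
  (forall x, E x -> tau <= \sum_i g (x i)) ->
  \sum_(x | E x) prodw x <= expR (- tau) * (\sum_c p c * expR (g c)) ^+ k.
Proof.
move=> Eg; rewrite -sum_prodw_expR mulr_sumr.
apply: (@le_trans _ _ (\sum_(x | E x) expR (- tau) * (prodw x * expR (\sum_i g (x i))))).
  apply: ler_sum => x /Eg ge; rewrite mulrCA -expRD -[leLHS]mulr1.
  rewrite ler_wpM2l ?prodw_ge0// -expR0 ler_expR; lra.
rewrite [leRHS](bigID E)/= lerDl sumr_ge0// => x _.
by rewrite !mulr_ge0 ?expR_ge0 ?prodw_ge0.
Qed.

Hypothesis p_sum1 : \sum_c p c = 1.

Lemma sum_prodw : \sum_x prodw x = 1.
Proof.
have := sum_prodw_expR (fun=> 0).
under eq_bigr do rewrite big1// expR0 mulr1.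
move=> ->; under eq_bigr do rewrite expR0 mulr1.
by rewrite p_sum1 expr1n.
Qed.

Lemma prodw_le1 (E : pred {ffun 'I_k -> C}) : \sum_(x | E x) prodw x <= 1.
Proof.
rewrite -sum_prodw [leRHS](bigID E)/= lerDl.
by rewrite sumr_ge0// => x _; exact: prodw_ge0.
Qed.

(** The quadratic bound on [expR lam] keeps the mass of [A] as variance factor; this is what makes
    the later estimates sharp for sets of small mass. *)
Lemma expR_indicator_bound (A : pred C) (lam : R) : `|lam| <= 2^-1 ->
  \sum_c p c * expR (lam * ((A c)%:R - \sum_(c | A c) p c)) <=
  expR ((\sum_(c | A c) p c) * lam ^+ 2).
Proof.
move=> hl; set pA := \sum_(c | A c) p c.
have -> : \sum_c p c * expR (lam * ((A c)%:R - pA)) =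
   expR (- (lam * pA)) * (1 + pA * (expR lam - 1)).
  have -> : 1 + pA * (expR lam - 1) = \sum_c p c * (1 + (A c)%:R * (expR lam - 1)).
    under eq_bigr do rewrite mulrDr mulr1.
    rewrite big_split/= p_sum1 /pA mulr_suml big_mkcond/=; congr (_ + _).
    by apply: eq_bigr => c _; case: (A c); rewrite ?mul1r// mul0r mulr0.
  rewrite mulr_sumr; apply: eq_bigr => c _; rewrite mulrBr expRD mulrCA mulrA mulrC.
  by case: (A c) => /=; rewrite ?mulr1 ?mulr0 ?expR0; ring.
have pA0 : 0 <= pA by apply: sumr_ge0.
have h1 := expR_le_quadratic hl.
have h2 : 1 + pA * (expR lam - 1) <= expR (pA * (lam + lam ^+ 2)).
  apply: le_trans (expR_ge1Dx _); rewrite lerD2l ler_wpM2l//; lra.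
rewrite (le_trans (ler_wpM2l (expR_ge0 _) h2))// -expRD ler_expR; lra.
Qed.

(** Exponential Markov with [|lam| = eps / (2 pb)], which minimizes the exponent
    [pb * lam ^ 2 - |lam| * eps]; the condition [eps <= pb] is what keeps [|lam| <= 1/2]. *)
Lemma prodw_bernstein_onesided (A : pred C) (pb eps : R) (s : bool) : (0 < k)%N ->
  \sum_(c | A c) p c <= pb -> 0 <= eps <= pb ->
  \sum_(x | eps <= (-1) ^+ s * (freq x A - \sum_(c | A c) p c)) prodw x <=
  expR (- (k%:R * eps ^+ 2 / (4 * pb))).
Proof.
move=> k0 hpb /andP[e0 epb]; set pA := \sum_(c | A c) p c in hpb *.
have [pb0|pb0] := eqVneq pb 0.
  have -> : eps = 0 by lra.
  by rewrite expr0n/= mulr0 mul0r oppr0 expR0 prodw_le1.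
have {}pb0 : 0 < pb by rewrite lt0r pb0 (le_trans e0).
have k0' : 0 < k%:R :> R by rewrite ltr0n.
pose lam := (-1) ^+ s * (eps / (2 * pb)).
have hl : `|lam| <= 2^-1.
  rewrite /lam normrM normrX normrN1 expr1n mul1r ger0_norm; last first.
    by rewrite divr_ge0// mulr_ge0// ltW.
  by rewrite ler_pdivrMr ?mulr_gt0//; lra.
have lam2 : lam ^+ 2 = (eps / (2 * pb)) ^+ 2.
  by rewrite /lam exprMn -exprM mulnC exprM sqrrN !expr1n mul1r.
apply: le_trans (prodw_markov (g := fun c => lam * ((A c)%:R - pA))
   (tau := k%:R * eps ^+ 2 / (2 * pb)) _) _.
  move=> x hx; rewrite -mulr_sumr sumrB.
  have -> : \sum_(i < k) (A (x i))%:R = k%:R * freq x A.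
    by rewrite /freq mulrA mulfV ?mul1r ?gt_eqF.
  rewrite sumr_const card_ord -[pA *+ k]mulr_natl -mulrBr /lam.
  have -> : (-1) ^+ s * (eps / (2 * pb)) * (k%:R * (freq x A - pA)) =
     k%:R * (eps / (2 * pb)) * ((-1) ^+ s * (freq x A - pA)) by ring.
  rewrite (_ : k%:R * eps ^+ 2 / (2 * pb) = k%:R * (eps / (2 * pb)) * eps).
    by rewrite ler_wpM2l// mulr_ge0 ?divr_ge0 ?mulr_ge0// ltW.
  by rewrite expr2; field; rewrite gt_eqF.
apply: le_trans (ler_wpM2l (expR_ge0 _) _) _.
  apply: lerXn2r (expR_indicator_bound A hl); rewrite nnegrE ?expR_ge0//.
  by apply: sumr_ge0 => c _; rewrite mulr_ge0 ?expR_ge0.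
rewrite -/pA -expRM_natl -expRD ler_expR lam2.
have -> : - (k%:R * eps ^+ 2 / (4 * pb)) =
  - (k%:R * eps ^+ 2 / (2 * pb)) + k%:R * (pb * (eps / (2 * pb)) ^+ 2).
  by field; rewrite gt_eqF.
by rewrite lerD2l ler_wpM2l ?ler_wpM2r ?sqr_ge0// ltW.
Qed.

Lemma prodw_bernstein (A : pred C) (pb eps : R) : (0 < k)%N ->
  \sum_(c | A c) p c <= pb -> 0 <= eps <= pb ->
  \sum_(x | eps <= `|freq x A - \sum_(c | A c) p c|) prodw x <=
  2 * expR (- (k%:R * eps ^+ 2 / (4 * pb))).
Proof.
move=> k0 hpb he; set pA := \sum_(c | A c) p c.
have h1 := prodw_bernstein_onesided false k0 hpb he.
have h2 := prodw_bernstein_onesided true k0 hpb he.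
rewrite -/pA in h1 h2; rewrite mulr_natl mulr2n (le_trans _ (lerD h1 h2))//.
rewrite big_mkcond [X in _ <= X + _]big_mkcond [X in _ <= _ + X]big_mkcond.
rewrite -big_split/=; apply: ler_sum => x _.
rewrite expr0 expr1 mul1r mulN1r ler_normr; have := prodw_ge0 x.
by case: (eps <= _); case: (eps <= _) => //=; rewrite ?addr0 ?add0r// lerDl.
Qed.

End product_law.

(** Used whenever several smallness conditions determine one constant: their thresholds are put into
    a list. *)
Lemma exists_lower_bound {R : realType} (s : seq R) :
  all (fun y => 0 < y) s -> exists2 kap : R, 0 < kap & all (fun y => kap <= y) s.
Proof.
elim: s => [_|y s IH /= /andP[y0 /IH[kap k0 hk]]]; first by exists 1.
exists (Num.min y kap); first by rewrite lt_min y0.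
rewrite /= ge_min lexx/=; apply/allP => z /(allP hk) kz.
by rewrite ge_min kz orbT.
Qed.

Lemma exists_positive_lower_bound {R : realType} {C : finType} (P : C -> R) :
  (forall c, 0 <= P c) -> exists2 m : R, 0 < m & forall c, P c != 0 -> m <= P c.
Proof.
move=> P0; have [|m m0 hm] := @exists_lower_bound R [seq P c | c <- enum C & P c != 0].
  by apply/allP => y /mapP[c]; rewrite mem_filter => /andP[c0 _] ->; rewrite lt0r c0 P0.
exists m => // c c0; apply: (allP hm); apply: map_f.
by rewrite mem_filter c0 mem_enum.
Qed.

Section coarse_deviations.
Context {R : realType} {C : finType}.
Implicit Types (P p lam g : C -> R) (a : R).

Lemma sum_freq k (x : {ffun 'I_k -> C}) (g : C -> R) : (0 < k)%N ->
  \sum_i g (x i) = k%:R * \sum_c freq x (pred1 c) * g c :> R.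
Proof.
move=> k0; rewrite mulr_sumr (partition_big x predT)//=; apply: eq_bigr => c _.
rewrite /freq !mulrA mulfV ?mul1r ?pnatr_eq0 -?lt0n// mulr_suml.
rewrite big_mkcond/=; apply: eq_bigr => i _ /=; case: eqP => [->|_].
  by rewrite mul1r.
by rewrite mul0r.
Qed.

Lemma sum_freq1 k (x : {ffun 'I_k -> C}) : (0 < k)%N ->
  \sum_c freq x (pred1 c) = 1 :> R.
Proof.
move=> k0; have := sum_freq x (fun=> 1 : R) k0.
rewrite sumr_const card_ord [X in _ * X](eq_bigr (fun c => freq x (pred1 c))).
  move=> h; apply: (@mulfI _ k%:R); first by rewrite pnatr_eq0 -lt0n.
  by rewrite -h mulr1.
by move=> c _; rewrite mulr1.
Qed.

(** Second-order expansion of a moment generating function: the centring by [a * lb] cancels the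
    linear term, and the cubic remainder is uniform in [p]. *)
Lemma sum_expR_le p lam a (Lam : R) (lb := \sum_c p c * lam c) :
  (forall c, 0 <= p c) -> \sum_c p c = 1 -> 0 <= a -> a * Lam <= 1 ->
  (forall c, `|lam c| <= Lam) ->
  \sum_c p c * expR (a * lam c - a * lb) <=
  expR (a ^+ 2 / 2 * (\sum_c p c * lam c ^+ 2) + a ^+ 3 * Lam ^+ 3).
Proof.
move=> p0 p1 a0 aL hL.
have hc c : `|a * lam c| <= a * Lam by rewrite normrM ger0_norm// ler_wpM2l.
have -> : \sum_c p c * expR (a * lam c - a * lb) =
    expR (- (a * lb)) * \sum_c p c * expR (a * lam c).
  by rewrite mulr_sumr; apply: eq_bigr => c _; rewrite expRD; ring.
have h : \sum_c p c * expR (a * lam c) <=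
    1 + a * lb + a ^+ 2 / 2 * (\sum_c p c * lam c ^+ 2) + a ^+ 3 * Lam ^+ 3.
  have -> : 1 + a * lb + a ^+ 2 / 2 * (\sum_c p c * lam c ^+ 2) + a ^+ 3 * Lam ^+ 3 =
      \sum_c p c * (1 + a * lam c + (a * lam c) ^+ 2 / 2 + (a * Lam) ^+ 3).
    rewrite [RHS](eq_bigr (fun c => p c + a * (p c * lam c) +
      a ^+ 2 / 2 * (p c * lam c ^+ 2) + p c * (a ^+ 3 * Lam ^+ 3))); last first.
      by move=> c _; field.
    by rewrite !big_split/= -!mulr_sumr -mulr_suml p1 mul1r.
  apply: ler_sum => c _.
  rewrite ler_wpM2l// (le_trans (expR_le_cubic _))//; first exact: le_trans (hc c) _.
  by rewrite lerD2l lerXn2r// nnegrE// (le_trans _ (hc c)).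
set Q := _ / 2 * _ in h *; set T := a ^+ 3 * _ in h *.
have h2 : \sum_c p c * expR (a * lam c) <= expR (a * lb + Q + T).
  by rewrite (le_trans h)// (le_trans _ (expR_ge1Dx _))// !addrA.
rewrite (le_trans (ler_wpM2l (expR_ge0 _) h2))// -expRD ler_expR; lra.
Qed.


(** Since [0^-1 = 0], a cell with [P c = 0] contributes nothing whatever [D c] is; that [D] vanishes
    on such cells is imposed separately where it matters. *)
Definition rate P (D : C -> R) : R := 2^-1 * \sum_c D c ^+ 2 / P c.

(** Exponential Markov with the test function [a * lam]. For increments vanishing on null cells, the
    supremum over [lam] of the functional compared with [tau] is [rate P]. The loss has two sources:
    [p] in place of [P] in the quadratic term, and the cubic Taylor remainder. *)
Lemma halfspace_deviation P p lam a k (Lam del tau : R) : (0 < k)%N ->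
  (forall c, 0 <= p c) -> \sum_c p c = 1 -> 0 < a -> a * Lam <= 1 ->
  (forall c, `|lam c| <= Lam) -> (forall c, `|p c - P c| <= del) ->
  \sum_(x : {ffun 'I_k -> C} |
      tau <= \sum_c lam c * ((freq x (pred1 c) - p c) / a)
             - 2^-1 * \sum_c P c * lam c ^+ 2) prodw p x <=
  expR (- (k%:R * a ^+ 2 *
     (tau - (2^-1 * #|C|%:R * del * Lam ^+ 2 + a * Lam ^+ 3)))).
Proof.
move=> k0 p0 p1 a0 aL hL hp; pose lb := \sum_c p c * lam c.
pose Q := 2^-1 * \sum_c P c * lam c ^+ 2.
have k0' : 0 < k%:R :> R by rewrite ltr0n.
apply: le_trans (prodw_markov p0 (g := fun c => a * lam c - a * lb)
   (tau := k%:R * a ^+ 2 * (tau + Q)) _) _.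
  move=> x; rewrite -/Q -[tau <= _](ler_pM2l (x := k%:R * a ^+ 2)); last first.
    by rewrite mulr_gt0 ?exprn_gt0.
  rewrite (sum_freq x (fun c => a * lam c - a * lb))//.
  have -> : \sum_c freq x (pred1 c) * (a * lam c - a * lb) =
     a * (\sum_c freq x (pred1 c) * lam c - lb).
    rewrite (eq_bigr (fun c => a * (freq x (pred1 c) * lam c) -
      freq x (pred1 c) * (a * lb))); last by move=> c _; ring.
    by rewrite sumrB -mulr_sumr -mulr_suml sum_freq1// mul1r mulrBr.
  have -> : \sum_c lam c * ((freq x (pred1 c) - p c) / a) =
     a^-1 * (\sum_c freq x (pred1 c) * lam c - lb).
    by rewrite /lb -sumrB mulr_sumr; apply: eq_bigr => c _; ring.
  set Y := _ - lb; have -> : k%:R * a ^+ 2 * (a^-1 * Y - Q) =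
     k%:R * (a * Y) - k%:R * a ^+ 2 * Q by field; exact: lt0r_neq0.
  by rewrite mulrDr; lra.
apply: le_trans (ler_wpM2l (expR_ge0 _) _) _.
  apply: lerXn2r (sum_expR_le p0 p1 (ltW a0) aL hL); rewrite nnegrE ?expR_ge0//.
  by apply: sumr_ge0 => c _; rewrite mulr_ge0 ?expR_ge0.
rewrite -expRM_natl -expRD ler_expR.
set S := \sum_c p c * lam c ^+ 2.
have hS : 2^-1 * S - Q <= 2^-1 * #|C|%:R * del * Lam ^+ 2.
  rewrite /Q -mulrBr -!mulrA ler_wpM2l ?invr_ge0// /S -sumrB.
  rewrite mulr_natl -sumr_const; apply: ler_sum => c _.
  rewrite -mulrBl; apply: le_trans (ler_norm _) _.
  rewrite normrM ler_pM//; rewrite normrX lerXn2r ?nnegrE//.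
  exact: le_trans (hL c).
have ka : 0 <= k%:R * a ^+ 2 by rewrite mulr_ge0 ?exprn_ge0 ?ltW.
have := ler_wpM2l ka hS; set Z := _ * del * _; move: ka; clear.
rewrite exprS; nra.
Qed.

End coarse_deviations.

Section coarse_ldp.
Context {R : realType} {C : finType}.
Implicit Types (P p : C -> R) (a : R).

Lemma expR_absorb (A z y : R) : 0 <= y -> A <= 1 + y -> A * expR (- z) <= expR (y - z).
Proof.
move=> y0 Ay; rewrite expRD ler_wpM2r ?expR_ge0// (le_trans Ay)//.
exact: expR_ge1Dx.
Qed.

(** The increments of rate above [r] do not form a half space, but their bounded part is covered by
    finitely many: each increment lies in the half space dual to a nearby point of a mesh. Large
    increments are left to Bernstein's inequality. *)
Lemma coarse_upper P (r eps : R) : (forall c, 0 <= P c) -> 0 < eps -> 0 <= r ->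
  exists2 kap : R, 0 < kap & forall p k a, (forall c, 0 <= p c) -> \sum_c p c = 1 ->
  (forall c, `|p c - P c| <= kap) -> 0 < a -> a <= kap -> (0 < k)%N ->
  kap^-1 <= k%:R * a ^+ 2 ->
  \sum_(x : {ffun 'I_k -> C} | r < rate P (fun c => (freq x (pred1 c) - p c) / a))
     prodw p x <= expR (- (k%:R * a ^+ 2 * (r - eps))).
Proof.
move=> P0 e0 r0; have [m m0 Pm] := exists_positive_lower_bound P0.
pose N : R := #|C|%:R; have N0 : 0 <= N by rewrite ler0n.
(* For increments of size [M] Bernstein's exponent [M ^ 2 / 4] is already at least [r]. *)
pose M : R := 2 * (1 + r); have M0 : 0 < M by rewrite /M; lra.
have hM : r <= M ^+ 2 / 4 by rewrite /M; nra.
(* The mesh width, chosen so that the rate of a rounding error is at most [eps / 4]. *)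
pose d := Num.min 1 (m * eps / (2 * (N + 1))).
have d0 : 0 < d.
  by rewrite lt_min ltr01/= divr_gt0 ?mulr_gt0//; lra.
have hd : 2^-1 * N * (d ^+ 2 / m) <= eps / 4.
  have d1 : d <= 1 by rewrite ge_min lexx.
  have : d <= m * eps / (2 * (N + 1)) by rewrite ge_min lexx orbT.
  rewrite ler_pdivlMr; last by lra.
  move=> h; rewrite mulrA ler_pdivrMr//.
  have h1 : N * d ^+ 2 <= N * d by rewrite ler_wpM2l// expr2 ler_piMl// ltW.
  nra.
pose K := (Num.truncn (M / d)).+1.
have hK : M <= K%:R * d.
  by rewrite -ler_pdivrMr// ltW// /K truncnS_gt.
pose V := (K + K + K)%:R * d.
have V0 : 0 <= V by rewrite mulr_ge0// ltW.
pose Lam := V / m.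
have L0 : 0 <= Lam by rewrite divr_ge0// ltW.
(* A mesh point has coordinates [d] times an integer from [-K] to [K], encoded with offset [K]. *)
pose val (y : {ffun C -> 'I_(K + K).+1}) c : R := d * ((y c)%:R - K%:R).
pose lam y c := if P c == 0 then 0 else val y c / P c.
have hlam y c : `|lam y c| <= Lam.
  rewrite /lam; case: eqVneq => [_|/Pm Pc]; first by rewrite normr0.
  have Pc0 : 0 < P c by apply: lt_le_trans Pc.
  rewrite normrM normfV [`|P c|]gtr0_norm// ler_pM ?invr_ge0//; last first.
    by rewrite lef_pV2.
  rewrite /val normrM gtr0_norm// mulrC ler_wpM2r ?(ltW d0)//.
  rewrite (le_trans (ler_normB _ _))// !normr_nat -natrD ler_nat.
  by rewrite leq_add2r -ltnS.
pose A : R := 2 * N + #|{ffun C -> 'I_(K + K).+1}|%:R.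
have A0 : 0 <= A by rewrite addr_ge0 ?mulr_ge0.
have l1 : 0 < Lam + 1 by rewrite ltr_wpDl.
have l2 : 0 < 8 * (2^-1 * N * Lam ^+ 2 + 1).
  rewrite mulr_gt0// ltr_wpDl//; apply: mulr_ge0; last exact: exprn_ge0.
  by apply: mulr_ge0 => //; rewrite invr_ge0.
have l3 : 0 < 8 * (Lam ^+ 3 + 1) by rewrite mulr_gt0// ltr_wpDl// exprn_ge0.
have l4 : 0 < 2 * (A + 1) by rewrite mulr_gt0// ltr_wpDl.
have [|kap kap0] := @exists_lower_bound R [:: 1; M^-1; (Lam + 1)^-1;
  eps / (8 * (2^-1 * N * Lam ^+ 2 + 1)); eps / (8 * (Lam ^+ 3 + 1));
  eps / (2 * (A + 1))].
  by rewrite /= ltr01 !invr_gt0 M0 l1 !divr_gt0.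
move=> /and5P[k1 kM kL k2 /and3P[k3 k4 _]].
exists kap => // p k a p0 p1 pP a0 ak k0 hk.
set ka := k%:R * a ^+ 2 in hk *.
have ka0 : 0 < ka by rewrite (lt_le_trans _ hk)// invr_gt0.
have kaA : A <= 1 + ka * (eps / 2).
  have : 2 * (A + 1) / eps <= ka.
    by rewrite (le_trans _ hk)// -[leLHS]invrK lef_pV2 ?posrE ?invr_gt0 ?divr_gt0// invf_div.
  by rewrite ler_pdivrMr//; lra.
have small : 2^-1 * N * kap * Lam ^+ 2 + a * Lam ^+ 3 <= eps / 4.
  move: k2 k3; rewrite !ler_pdivlMr//.
  have := exprn_ge0 3 L0; have := exprn_ge0 2 L0; move: (ltW kap0) N0 ak (ltW a0); clear.
  set l2 := Lam ^+ 2; set l3 := Lam ^+ 3 => ? ? ? ? ? ? ? ?.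
  have : a * l3 <= kap * l3 by rewrite ler_wpM2r.
  nra.
pose D (x : {ffun 'I_k -> C}) c := (freq x (pred1 c) - p c) / a.
pose Q y := 2^-1 * \sum_c P c * lam y c ^+ 2.
have key x : r < rate P (D x) -> (exists c, a * M <= `|freq x (pred1 c) - p c|) \/
    exists y, r - eps / 4 <= \sum_c lam y c * D x c - Q y.
  move=> hr; have [/existsP[c hc]|/existsPn hc] :=
    boolP [exists c, a * M <= `|freq x (pred1 c) - p c|]; first by left; exists c.
  right; have DM c : `|D x c| <= M.
    have := hc c; rewrite -ltNge /D normrM normfV [`|a|]gtr0_norm// => h.
    by rewrite ler_pdivrMr// mulrC ltW.
  pose t c := D x c / d + K%:R.
  have t0 c : 0 <= t c <= (K + K)%:R.
    have := le_trans (DM c) hK; rewrite ler_norml => /andP[h1 h2].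
    rewrite /t natrD lerD2r ler_pdivrMr// h2 andbT.
    have : - K%:R <= D x c / d by rewrite ler_pdivlMr// mulNr.
    lra.
  have tr c : (Num.truncn (t c) <= K + K)%N.
    have /andP[h1 h2] := t0 c; rewrite -(ler_nat R) (le_trans _ h2)//.
    by have /andP[] := truncn_itv h1.
  pose y : {ffun C -> 'I_(K + K).+1} := [ffun c => inord (Num.truncn (t c))].
  have yE c : val y c = d * ((Num.truncn (t c))%:R - K%:R).
    by rewrite /val /y ffunE inordK// ltnS.
  have yD c : `|D x c - val y c| <= d.
    have /andP[h1 _] := t0 c; have /andP[h2 h3] := truncn_itv h1.
    have -> : D x c - val y c = d * (t c - (Num.truncn (t c))%:R).
      by rewrite yE /t; field; exact: lt0r_neq0.
    rewrite normrM gtr0_norm// -[leRHS]mulr1 ler_wpM2l ?(ltW d0)//.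
    rewrite ger0_norm ?subr_ge0// lerBlDl (le_trans (ltW h3))//.
    by rewrite -natr1.
  (* Completing the square: the affine functional dual to [y] falls short of [rate] only by the rate
     of the rounding error. *)
  exists y; have -> : \sum_c lam y c * D x c - Q y =
      rate P (D x) - 2^-1 * \sum_c (if P c == 0 then 0 else (D x c - val y c) ^+ 2 / P c).
    rewrite /rate /Q -!mulrBr -sumrB !mulr_sumr -sumrB; apply: eq_bigr => c _.
    rewrite /lam; case: eqVneq => [->|Pc]; first by rewrite invr0; ring.
    by field.
  have : 2^-1 * \sum_c (if P c == 0 then 0 else (D x c - val y c) ^+ 2 / P c) <= eps / 4.
    apply: le_trans hd; rewrite -mulrA ler_wpM2l ?invr_ge0//.
    rewrite /N mulr_natl -sumr_const; apply: ler_sum => c _.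
    case: eqVneq => [_|/Pm Pc]; first by rewrite divr_ge0 ?exprn_ge0 ?ltW.
    have Pc0 : 0 < P c by apply: lt_le_trans Pc.
    rewrite ler_pM ?sqr_ge0 ?invr_ge0 ?(ltW Pc0)//; last by rewrite lef_pV2.
    by rewrite -real_normK ?num_real// lerXn2r ?nnegrE// ltW.
  lra.
apply: (@le_trans _ _ (\sum_(x : {ffun 'I_k -> C} | [exists c, a * M <= `|freq x (pred1 c) - p c|])
   prodw p x + \sum_(x : {ffun 'I_k -> C} | [exists y, r - eps / 4 <= \sum_c lam y c * D x c - Q y]) prodw p x)).
  rewrite big_mkcond [X in _ <= X + _]big_mkcond [X in _ <= _ + X]big_mkcond.
  rewrite -big_split/=; apply: ler_sum => x _; have w0 := prodw_ge0 p0 x.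
  case: ifPn => [/key[hc|hy]|_].
  - by rewrite ifT ?lerDl//; [case: ifP|apply/existsP].
  - by rewrite [X in _ + X]ifT ?lerDr//; [case: ifP|apply/existsP].
  - by rewrite addr_ge0//; case: ifP.
have un (I : finType) (E : I -> pred {ffun 'I_k -> C}) (b : R) :
    (forall i, \sum_(x | E i x) prodw p x <= b) ->
    \sum_(x | [exists i, E i x]) prodw p x <= #|I|%:R * b.
  move=> hE; rewrite mulr_natl -sumr_const.
  apply: le_trans (ler_sum _ (fun i _ => hE i)).
  under [leRHS]eq_bigr do rewrite big_mkcond.
  rewrite exchange_big/= big_mkcond; apply: ler_sum => x _; have w0 := prodw_ge0 p0 x.
  case: ifPn => [/existsP[i Ei]|_]; last by apply: sumr_ge0 => i _; case: ifP.
  by rewrite (bigD1 i)//= Ei lerDl sumr_ge0// => i0 _; case: ifP.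
have b1 : \sum_(x : {ffun 'I_k -> C} | [exists c, a * M <= `|freq x (pred1 c) - p c|])
    prodw p x <= #|C|%:R * (2 * expR (- (ka * (r - eps / 2)))).
  apply: un => c.
  have h := @prodw_bernstein R C p k p0 p1 (pred1 c) 1 (a * M) k0.
  rewrite big_pred1_eq in h.
  apply: le_trans (h _ _) _.
  - by rewrite -p1 (bigD1 c)//= lerDl sumr_ge0.
  - rewrite mulr_ge0 ?(ltW a0) ?(ltW M0)//= -(mulVf (lt0r_neq0 M0)).
    by rewrite ler_wpM2r ?(ltW M0)// (le_trans ak).
  rewrite ler_wpM2l// ler_expR lerN2.
  have -> : k%:R * (a * M) ^+ 2 / (4 * 1) = ka * (M ^+ 2 / 4) by rewrite /ka; field.
  by rewrite ler_wpM2l ?(ltW ka0)//; lra.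
have b2 : \sum_(x : {ffun 'I_k -> C} | [exists y, r - eps / 4 <= \sum_c lam y c * D x c - Q y])
    prodw p x <= #|{ffun C -> 'I_(K + K).+1}|%:R * expR (- (ka * (r - eps / 2))).
  apply: un => y.
  have aL : a * Lam <= 1.
    have : a * (Lam + 1) <= (Lam + 1)^-1 * (Lam + 1).
      by rewrite ler_wpM2r ?addr_ge0// (le_trans ak).
    rewrite mulVf ?gt_eqF ?ltr_wpDl//; lra.
  apply: le_trans (@halfspace_deviation _ _ P p (lam y) a k Lam kap (r - eps / 4) k0 p0 p1 a0 aL (hlam y) pP) _.
  rewrite ler_expR lerN2 -/ka ler_wpM2l ?(ltW ka0)//; rewrite -/N; lra.
apply: le_trans (lerD b1 b2) _.
rewrite -/N mulrA [N * 2]mulrC -mulrDl -/A.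
have -> : - (ka * (r - eps)) = ka * (eps / 2) - ka * (r - eps / 2) by field.
apply: expR_absorb => //.
by rewrite mulr_ge0 ?(ltW ka0)// divr_ge0// ltW.
Qed.

End coarse_ldp.

Section coarse_lower_bound.
Context {R : realType} {C : finType}.
Implicit Types (P p D y : C -> R) (a : R).

Lemma prodw_union_bound k p (I : finType) (E : I -> pred {ffun 'I_k -> C}) (b : R) :
  (forall c, 0 <= p c) -> (forall i, \sum_(x | E i x) prodw p x <= b) ->
  \sum_(x | [exists i, E i x]) prodw p x <= #|I|%:R * b.
Proof.
move=> p0 hE; rewrite mulr_natl -sumr_const.
apply: le_trans (ler_sum _ (fun i _ => hE i)).
under [leRHS]eq_bigr do rewrite big_mkcond.
rewrite exchange_big/= big_mkcond; apply: ler_sum => x _; have w0 := prodw_ge0 p0 x.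
case: ifPn => [/existsP[i Ei]|_]; last by apply: sumr_ge0 => i _; case: ifP.
by rewrite (bigD1 i)//= Ei lerDl sumr_ge0// => i0 _; case: ifP.
Qed.

(** Change of measure: the density of the tilted law is the product of the [1 + y (x i)], which
    [le1D_expR] bounds by [expR b] on [E]. *)
Lemma prodw_tilt k p y (E : pred {ffun 'I_k -> C}) (b : R) :
  (forall c, 0 <= p c) -> (forall c, `|y c| <= 8^-1) ->
  (forall x, E x -> \sum_i (y (x i) - y (x i) ^+ 2 / 2 + 16 * `|y (x i)| ^+ 3) <= b) ->
  expR (- b) * \sum_(x | E x) prodw (fun c => p c * (1 + y c)) x <=
  \sum_(x | E x) prodw p x.
Proof.
move=> p0 hy hE; rewrite mulr_sumr; apply: ler_sum => x Ex.
rewrite -[leRHS](mulKf (lt0r_neq0 (expR_gt0 b))) -expRN ler_wpM2l ?expR_ge0//.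
apply: (@le_trans _ _ (prodw p x * expR (\sum_i (y (x i) - y (x i) ^+ 2 / 2 + 16 * `|y (x i)| ^+ 3)))).
  rewrite expR_sum /prodw -big_split/=; apply: ler_prod => i _.
  rewrite mulr_ge0//=; last first.
    have := hy (x i); rewrite ler_norml => /andP[h _]; lra.
  by rewrite ler_wpM2l// le1D_expR.
by rewrite mulrC ler_wpM2r ?prodw_ge0// ler_expR hE.
Qed.

(** To second order, [q * (y - y ^ 2 / 2)] is [a D + a ^ 2 D ^ 2 / (2 p)], as [q] is close to
    [p + a D]. The linear part will sum to zero over the cells; the remaining terms collect the
    replacement of [p] by [P], the cubic terms and the tolerance on [q]. *)
Lemma tilt_exponent_cell (P p D a m B k0 del q : R) (y := a * D / p) :
  m <= P -> `|p - P| <= k0 -> k0 <= m / 2 -> 0 < m -> `|D| <= B ->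
  0 < a -> a * (16 * (B + 1)) <= m -> a <= k0 -> 0 <= del ->
  `|q - p - a * D| <= a * del ->
  q * (y - y ^+ 2 / 2 + 16 * `|y| ^+ 3) <=
  a * D + a ^+ 2 * (2^-1 * (D ^+ 2 / P) + (B ^+ 2 / m ^+ 2 + 132 * B ^+ 3 / m ^+ 2) * k0
     + 4 * B / m * del).
Proof.
move=> mP pP km m0 DB a0 aB ak d0 hq.
have P0 : 0 < P by apply: lt_le_trans mP.
have pm : m / 2 <= p by move: pP; rewrite ler_norml => /andP[h _]; lra.
have p0 : 0 < p by lra.
have B0 : 0 <= B by rewrite (le_trans _ DB).
have k00 : 0 <= k0 by lra.
have ip : p^-1 <= 2 / m by rewrite -[2 / m]invf_div lef_pV2 ?posrE ?divr_gt0.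
have iP : P^-1 <= m^-1 by rewrite lef_pV2.
have aD : `|a * D| <= a * B by rewrite normrM gtr0_norm// ler_wpM2l// ltW.
have yb : `|y| <= 2 * a * B / m.
  rewrite /y normrM normfV [`|p|]gtr0_norm// (_ : 2 * a * B / m = a * B * (2 / m)).
    by rewrite ler_pM// invr_ge0 ltW.
  by ring.
have y8 : `|y| <= 8^-1.
  by rewrite (le_trans yb)// ler_pdivrMr//; lra.
have [yn yp] : -8^-1 <= y /\ y <= 8^-1 by move: y8; rewrite ler_norml => /andP[].
set t := `|y| in yb y8 *; have t0 : 0 <= t by exact: normr_ge0.
have y2 : y ^+ 2 = t ^+ 2 by rewrite /t real_normK ?num_real.
set G := y - _ + _.
have hG : `|G| <= 2 * t.
  rewrite /G (le_trans (ler_normD _ _))// (le_trans (lerD (ler_normB _ _) (lexx _)))//.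
  rewrite -/t [`|y ^+ 2 / 2|]ger0_norm ?divr_ge0 ?sqr_ge0// y2.
  rewrite [`|16 * _|]ger0_norm ?mulr_ge0 ?exprn_ge0//.
  move: t0 y8; clear; rewrite exprS => t0 y8; have : t * t <= t * 8^-1 by rewrite ler_wpM2l.
  rewrite exprS => h; have : t * (t * t) <= t * (t * 8^-1) by rewrite ler_wpM2l.
  lra.
have py : p * y = a * D by rewrite /y mulrC divfK ?gt_eqF.
have pt : p * t <= a * B.
  by rewrite -[p]gtr0_norm// -normrM py.
have pt3 : p * t ^+ 3 <= 4 * a ^+ 3 * B ^+ 3 / m ^+ 2.
  rewrite exprS mulrA (_ : 4 * a ^+ 3 * B ^+ 3 / m ^+ 2 = a * B * (2 * a * B / m) ^+ 2).
    apply: ler_pM => //; rewrite ?mulr_ge0 ?exprn_ge0 ?(ltW p0)//.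
    by rewrite lerXn2r// nnegrE (le_trans t0).
  by field; exact: lt0r_neq0.
have a3 : a ^+ 3 <= a ^+ 2 * k0 by rewrite exprSr ler_wpM2l// exprn_ge0// ltW.
have pt3' : p * t ^+ 3 <= a ^+ 2 * (4 * B ^+ 3 / m ^+ 2 * k0).
  apply: (le_trans pt3); rewrite (_ : 4 * a ^+ 3 * B ^+ 3 / m ^+ 2 = a ^+ 3 * (4 * B ^+ 3 / m ^+ 2)); last by ring.
  rewrite (_ : a ^+ 2 * _ = a ^+ 2 * k0 * (4 * B ^+ 3 / m ^+ 2)); last by ring.
  by rewrite ler_wpM2r// divr_ge0 ?mulr_ge0 ?exprn_ge0// ltW.
have ydel : (q - p - a * D) * G <= a ^+ 2 * (4 * B / m * del).
  apply: le_trans (ler_norm _) _; rewrite normrM.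
  rewrite (_ : a ^+ 2 * _ = a * del * (2 * (2 * a * B / m))); last by ring.
  by rewrite ler_pM// (le_trans hG)// ler_wpM2l.
have main : (p + a * D) * G <= a * D + 2^-1 * (a ^+ 2 * D ^+ 2 / p) + 33 * (p * t ^+ 3).
  have -> : (p + a * D) * G = p * y + 2^-1 * (a * D * y) - 2^-1 * (p * (y * y ^+ 2)) + 16 * (p * (1 + y) * t ^+ 3).
    by rewrite /G -py; field.
  have -> : a ^+ 2 * D ^+ 2 / p = a * D * y by rewrite /y; ring.
  rewrite py.
  have h1 : - (p * (y * y ^+ 2)) <= p * t ^+ 3.
    rewrite -mulrN ler_wpM2l ?(ltW p0)// -mulNr y2 [t ^+ 3]exprS ler_wpM2r ?exprn_ge0//.
    by rewrite /t -normrN ler_norm.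
  have h2 : p * (1 + y) * t ^+ 3 <= 2 * (p * t ^+ 3).
    rewrite mulrA [p * _]mulrC ler_wpM2r ?exprn_ge0// ler_wpM2r ?(ltW p0)//; lra.
  have h3 : 0 <= p * t ^+ 3 by rewrite mulr_ge0 ?exprn_ge0// ltW.
  move: h1 h2 h3; clear; set u := p * (y * _); set v := p * _ * _; set w := p * _.
  lra.
have cmp : D ^+ 2 / p <= D ^+ 2 / P + 2 * B ^+ 2 / m ^+ 2 * k0.
  have -> : D ^+ 2 / p = D ^+ 2 / P + D ^+ 2 * (P - p) * (p^-1 * P^-1).
    by field; rewrite !gt_eqF.
  rewrite lerD2l (_ : 2 * B ^+ 2 / m ^+ 2 * k0 = B ^+ 2 * k0 * (2 / m * m^-1)); last first.
    by field; exact: lt0r_neq0.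
  have D2 : D ^+ 2 <= B ^+ 2 by rewrite -real_normK ?num_real// lerXn2r ?nnegrE.
  have i0 : 0 <= p^-1 * P^-1 by rewrite mulr_ge0 ?invr_ge0 ?ltW.
  apply: (@le_trans _ _ (B ^+ 2 * k0 * (p^-1 * P^-1))).
    rewrite ler_wpM2r//; apply: (@le_trans _ _ (D ^+ 2 * k0)).
      rewrite ler_wpM2l ?sqr_ge0//; move: pP; rewrite distrC; exact: le_trans (ler_norm _).
    by rewrite ler_wpM2r.
  by rewrite ler_wpM2l ?mulr_ge0 ?exprn_ge0// ler_pM ?invr_ge0 ?(ltW p0) ?(ltW P0).
have a2 : 0 <= a ^+ 2 by rewrite exprn_ge0 ?ltW.
have := ler_wpM2l a2 cmp.
have -> : q * G = (p + a * D) * G + (q - p - a * D) * G by ring.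
move: main ydel pt3'; rewrite -[a ^+ 2 * D ^+ 2 / p]mulrA; clear.
set A := a ^+ 2; set T := p * _; set U := D ^+ 2 / p; set U' := D ^+ 2 / P.
set W := (p + _) * _; set W' := (_ - _) * _; clearbody A T U U' W W'.
lra.
Qed.

End coarse_lower_bound.

Section coarse_lower_ldp.
Context {R : realType} {C : finType}.
Implicit Types (P p D : C -> R) (a : R).

(** The weights [p c + a D c] form a probability because the [D c] sum to zero. Under them the event
    has probability at least 1/2 by Bernstein's inequality, and the change of measure back to [p]
    costs the rate. *)
Lemma coarse_lower P D (eps del : R) :
  (forall c, 0 <= P c) -> \sum_c D c = 0 -> (forall c, P c = 0 -> D c = 0) ->
  0 < eps -> 0 < del ->
  exists2 kap : R, 0 < kap & forall p k a, (forall c, 0 <= p c) -> \sum_c p c = 1 ->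
  (forall c, `|p c - P c| <= kap) -> (forall c, P c = 0 -> p c = 0) ->
  0 < a -> a <= kap -> (0 < k)%N -> kap^-1 <= k%:R * a ^+ 2 ->
  expR (- (k%:R * a ^+ 2 * (rate P D + eps))) <=
  \sum_(x : {ffun 'I_k -> C} | [forall c, `|freq x (pred1 c) - p c - a * D c| <= a * del])
    prodw p x.
Proof.
move=> P0 D0 PD e0 d0; have [m m0 Pm] := exists_positive_lower_bound P0.
pose N : R := #|C|%:R; have N0 : 0 <= N by rewrite ler0n.
pose B : R := \sum_c `|D c|; have B0 : 0 <= B by apply: sumr_ge0.
have DB c : `|D c| <= B by rewrite /B (bigD1 c)//= lerDl sumr_ge0.
pose S1 : R := B ^+ 2 / m ^+ 2 + 132 * B ^+ 3 / m ^+ 2.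
have S10 : 0 <= S1.
  by rewrite addr_ge0// divr_ge0 ?mulr_ge0 ?exprn_ge0// ltW.
pose S2 : R := 4 * B / m; have S20 : 0 <= S2 by rewrite divr_ge0 ?mulr_ge0// ltW.
have q1 : 0 < 4 * (N * S1 + 1) by rewrite mulr_gt0// ltr_wpDl// mulr_ge0.
have q2 : 0 < 4 * (N * S2 + 1) by rewrite mulr_gt0// ltr_wpDl// mulr_ge0.
have q3 : 0 < 16 * (B + 1) by rewrite mulr_gt0// ltr_wpDl.
have q4 : 0 < 16 * (N + 1) by rewrite mulr_gt0// ltr_wpDl.
(* The tolerance [d] may be smaller than [del]: it makes the error [N * S2 * d] in the log density
   at most [eps / 4]. *)
have [|d d0' /and3P[dd d1 /andP[d2 _]]] :=
  @exists_lower_bound R [:: del; 1; eps / (4 * (N * S2 + 1))].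
  by rewrite /= d0 ltr01 divr_gt0.
have [|kap kap0] := @exists_lower_bound R [:: 1; m / 2; m / (16 * (B + 1));
   eps / (4 * (N * S1 + 1)); eps / 4; d ^+ 2 / (16 * (N + 1))].
  by rewrite /= ltr01 !divr_gt0 ?exprn_gt0.
move=> /and5P[k1 km kB k2 /and3P[k3 k4 _]]; exists kap => //.
move=> p k a p0 p1 pP Pp a0 ak k0 hk.
set ka := k%:R * a ^+ 2 in hk *.
have ka0 : 0 < ka by rewrite (lt_le_trans _ hk)// invr_gt0.
pose y c := a * D c / p c; pose pt c := p c * (1 + y c).
have aB : a * (16 * (B + 1)) <= m.
  by rewrite -ler_pdivlMr// (le_trans ak).
have pge c : P c != 0 -> m / 2 <= p c.
  move=> /Pm mP; have := pP c; rewrite ler_norml => /andP[h _]; lra.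
have ptE c : pt c = p c + a * D c.
  rewrite /pt /y mulrDr mulr1; congr (_ + _).
  have [Pc0|/pge pc] := eqVneq (P c) 0; first by rewrite PD// Pp// !(mulr0, mul0r).
  by rewrite mulrC divfK// gt_eqF// (lt_le_trans _ pc)// divr_gt0.
have y8 c : `|y c| <= 8^-1.
  rewrite /y; have [Pc0|/pge pc] := eqVneq (P c) 0.
    by rewrite PD// mulr0 mul0r normr0.
  have pc0 : 0 < p c by rewrite (lt_le_trans _ pc)// divr_gt0.
  rewrite normrM normfV [`|p c|]gtr0_norm// ler_pdivrMr// normrM gtr0_norm//.
  have : a * `|D c| <= a * B by rewrite ler_wpM2l// ltW.
  move: aB pc a0; clear; nra.
have pt0 c : 0 <= pt c.
  rewrite /pt mulr_ge0//; have := y8 c; rewrite ler_norml => /andP[h _].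
  by move: h; clear; lra.
have pt1 : \sum_c pt c = 1.
  by under eq_bigr do rewrite ptE; rewrite big_split/= -mulr_sumr D0 mulr0 addr0.
(* The event with tolerance [d] around the tilted weights, written as the complement of a union so
   that the union bound applies under the tilted law. *)
pose E' := [pred x : {ffun 'I_k -> C} |
  ~~ [exists c, a * d <= `|freq x (pred1 c) - pt c|]].
have hE' x : E' x -> forall c, `|freq x (pred1 c) - p c - a * D c| <= a * d.
  move=> /existsPn h c; have := h c; rewrite -ltNge ptE => /ltW.
  by rewrite opprD addrA.
apply: (@le_trans _ _ (\sum_(x | E' x) prodw p x)); last first.
  rewrite big_mkcond [leRHS]big_mkcond; apply: ler_sum => x _.
  have w0 := prodw_ge0 p0 x; case: ifPn => [/hE' h|_]; last by case: ifP.
  rewrite ifT//; apply/forallP => c; rewrite (le_trans (h c))// ler_wpM2l//.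
  exact: ltW.
have tilt := @prodw_tilt R C k p y E' (ka * (rate P D + eps / 2)) p0 y8.
apply: le_trans (tilt _).
  have h : \sum_(x | ~~ E' x) prodw pt x <= 2^-1.
    under eq_bigl do rewrite negbK.
    apply: le_trans (prodw_union_bound (b := 2 * expR (- (ka * d ^+ 2 / 4))) pt0 _) _.
      move=> c; have h := @prodw_bernstein R C pt k pt0 pt1 (pred1 c) 1 (a * d) k0.
      rewrite big_pred1_eq in h; apply: le_trans (h _ _) _.
      + by rewrite -pt1 (bigD1 c)//= lerDl sumr_ge0.
      + rewrite mulr_ge0 ?(ltW a0) ?(ltW d0')//= -[leRHS]mulr1.
        by rewrite ler_pM ?(ltW a0) ?(ltW d0')// (le_trans ak).
      + rewrite (_ : k%:R * (a * d) ^+ 2 / (4 * 1) = ka * d ^+ 2 / 4)//.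
        by rewrite /ka; field.
    have z1 : 4 * (N + 1) <= ka * d ^+ 2 / 4.
      have : (16 * (N + 1)) / d ^+ 2 <= ka.
        rewrite (le_trans _ hk)// -[leLHS]invrK lef_pV2 ?posrE ?invr_gt0 ?divr_gt0 ?exprn_gt0//.
        by rewrite invf_div.
      by rewrite ler_pdivrMr ?exprn_gt0//; set u := ka * d ^+ 2; set w := N; clearbody u w; clear; lra.
    rewrite expRN mulrA -/N ler_pdivrMr ?expR_gt0//.
    have := expR_ge1Dx (ka * d ^+ 2 / 4); move: z1 N0.
    set v := _ / 4; set u := expR v; set w := N; clearbody u v w; clear; lra.
  have h2 : 2^-1 <= \sum_(x | E' x) prodw pt x.
    have := sum_prodw k pt1; rewrite (bigID E')/=.
    by move: h; clear; set u := \sum_(_ | _) _; set v := \sum_(_ | _) _; lra.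
  apply: le_trans (ler_wpM2l (expR_ge0 _) h2).
  (* This absorbs into the exponent the factor 1/2 left by the tilted probability. *)
  have h3 : expR (- (ka * (eps / 2))) <= 2^-1.
    rewrite expRN lef_pV2 ?posrE ?expR_gt0// (le_trans _ (expR_ge1Dx _))//.
    have : 4 / eps <= ka.
      rewrite (le_trans _ hk)// -[leLHS]invrK lef_pV2 ?posrE ?invr_gt0 ?divr_gt0//.
      by rewrite invf_div.
    by rewrite ler_pdivrMr//; clear; lra.
  apply: le_trans (ler_wpM2l (expR_ge0 _) h3).
  by rewrite -expRD ler_expR; set u := rate P D; clearbody u ka; clear; lra.
move=> x Ex; rewrite (sum_freq x (fun c => y c - y c ^+ 2 / 2 + 16 * `|y c| ^+ 3))// /ka -mulrA ler_wpM2l//.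
have cell c : freq x (pred1 c) * (y c - y c ^+ 2 / 2 + 16 * `|y c| ^+ 3) <=
   a * D c + a ^+ 2 * (2^-1 * (D c ^+ 2 / P c) + S1 * kap + S2 * d).
  have [Pc0|/Pm mP] := eqVneq (P c) 0.
    rewrite /y PD// Pc0 !(mulr0,mul0r) normr0 !expr0n/= !(mulr0,mul0r,subr0,addr0,add0r).
    rewrite oppr0 mulr0; apply: mulr_ge0; first by rewrite exprn_ge0// ltW.
    by apply: addr_ge0; apply: mulr_ge0 => //; exact: ltW.
  apply: (tilt_exponent_cell mP (pP c) km m0 (DB c) a0 aB ak (ltW d0')).
  exact: hE'.
apply: (le_trans (ler_sum _ (fun c _ => cell c))).
rewrite big_split/= -mulr_sumr D0 mulr0 add0r -mulr_sumr ler_wpM2l ?exprn_ge0 ?(ltW a0)//.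
rewrite !big_split/= -mulr_sumr -/(rate P D) !sumr_const.
rewrite -[S1 * kap *+ _]mulr_natl -[S2 * d *+ _]mulr_natl -/N -addrA lerD2l.
have u0 : 0 <= N * S1 by rewrite mulr_ge0.
have v0 : 0 <= N * S2 by rewrite mulr_ge0.
move: k2 d2; rewrite !ler_pdivlMr// !mulrA.
move: (N * S1) (N * S2) u0 v0 kap0 d0'; clear; move=> u v u0 v0 h1 h2 h3 h4; lra.
Qed.

End coarse_lower_ldp.

(** * Empirical frequencies of independent samples *)

Section finite_partitions.
Context {d} {T : measurableType d} {R : realType}.

Lemma measure_finType_bigcup (mu : {measure set T -> \bar R}) (I : finType)
    (E : pred I) (F : I -> set T) :
  (forall i, measurable (F i)) -> (forall i j t, F i t -> F j t -> i = j) ->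
  mu (\bigcup_(i in [set` E]) F i) = (\sum_(i | E i) mu (F i))%E.
Proof.
move=> mF tF; rewrite measure_fin_bigcup//.
- rewrite -(@bigfs _ _ _ _ (index_enum I))//; first exact: index_enum_uniq.
  by move=> i _; rewrite mem_index_enum.
- by move=> i j _ _ [t [Fi Fj]]; exact: tF Fi Fj.
Qed.

End finite_partitions.

Section iid_product_law.
Context {d d'} {T : measurableType d} {S : measurableType d'} {R : realType}.
Variables (Pr : probability T R) (D : set nat) (Z : nat -> T -> S).
Variables (mu : set S -> \bar R) (k : nat) (C : finType) (cell : S -> C).
Hypothesis hZ : iid_with_law Pr D Z mu.
Hypothesis hk : `I_k `<=` D.
Hypothesis mcell : forall c, measurable (cell @^-1` [set c]).

Definition cell_mass (c : C) : R := fine (mu (cell @^-1` [set c])).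

Definition cells (w : T) : {ffun 'I_k -> C} := [ffun i : 'I_k => cell (Z i w)].

Lemma measurable_cells_eq (x : {ffun 'I_k -> C}) : measurable [set w | cells w = x].
Proof.
rewrite (_ : mkset _ = \bigcap_(i in setT) [set w | cell (Z (i : 'I_k) w) = x i]).
  apply: fin_bigcap_measurable => // i _.
  have mZ : measurable_fun setT (Z i) by case: hZ => mZ _ _; apply: mZ; apply: hk; exact: ltn_ord.
  have := mZ measurableT _ (mcell (x i)); rewrite setTI.
  by congr measurable.
apply/seteqP; split=> [w /= <- i _|w h]; first by rewrite /= ffunE.
by apply/ffunP => i; rewrite ffunE; exact: h.
Qed.

Lemma cells_eq_law (x : {ffun 'I_k -> C}) :
  Pr [set w | cells w = x] = (prodw cell_mass x)%:E.
Proof.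
case: hZ => mZ lZ iZ.
(* Independence speaks of sets indexed by all integers; indices from [k] on get the whole space. *)
pose A (n : nat) : set S := if insub n is Some i then cell @^-1` [set x i] else setT.
have AE (i : 'I_k) : A i = cell @^-1` [set x i] by rewrite /A valK.
have := iZ (iota 0 k) A; rewrite iota_uniq => /(_ isT) h.
have -> : [set w | cells w = x] = \bigcap_(i in [set` iota 0 k]) Z i @^-1` A i.
  apply/seteqP; split=> [w /= wx i|w h1].
    by rewrite /= mem_iota add0n => ik; rewrite /A insubT/= -wx ffunE.
  apply/ffunP => i; rewrite ffunE; have := h1 i; rewrite /= AE; apply.
  by rewrite mem_iota add0n /=.
rewrite h => [|i]; last first.
  rewrite mem_iota add0n /= => ik; split; first exact: hk.
  by rewrite (AE (Ordinal ik)).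
have -> : iota 0 k = index_iota 0 k by rewrite /index_iota subn0.
rewrite big_mkord; congr (_%:E); apply: eq_bigr => i _.
rewrite AE /cell_mass lZ//; apply: hk; exact: ltn_ord.
Qed.

Lemma iid_product_law (E : pred {ffun 'I_k -> C}) :
  measurable [set w | E (cells w)] /\
  Pr [set w | E (cells w)] = (\sum_(x | E x) prodw cell_mass x)%:E.
Proof.
have -> : [set w | E (cells w)] = \bigcup_(x in [set` E]) [set w | cells w = x].
  by apply/seteqP; split=> [w h|w [x Ex /= ->]//]; exists (cells w).
split; first by apply: fin_bigcup_measurable => // x _; exact: measurable_cells_eq.
rewrite measure_finType_bigcup; first last.
- by move=> i j w /= -> ->.
- by move=> i; exact: measurable_cells_eq.
by rewrite -sumEFin; apply: eq_bigr => x _; exact: cells_eq_law.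
Qed.

Hypothesis k0 : (0 < k)%N.

Lemma cell_mass_ge0 c : 0 <= cell_mass c.
Proof.
case: hZ => mZ lZ iZ; have D0 : D 0%N by exact: hk.
by rewrite /cell_mass -(lZ _ D0)// fine_ge0.
Qed.

Lemma sum_cell_mass : \sum_c cell_mass c = 1.
Proof.
case: hZ => mZ lZ iZ; have D0 : D 0%N by exact: hk.
have h := @measure_finType_bigcup _ _ _ Pr C xpredT (fun c => Z 0%N @^-1` (cell @^-1` [set c])).
have m c : measurable (Z 0%N @^-1` (cell @^-1` [set c])).
  by have := mZ _ D0 measurableT _ (mcell c); rewrite setTI.
have /= := h m; rewrite (_ : \bigcup_(_ in _) _ = setT); last first.
  by apply/seteqP; split=> // w _; exists (cell (Z 0%N w)).
rewrite probability_setT => {}h.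
apply: EFin_inj; rewrite -sumEFin h; last by move=> i j w /= -> ->.
apply: eq_bigr => c _; rewrite /cell_mass -(lZ _ D0)//.
by rewrite fineK// fin_num_measure.
Qed.

End iid_product_law.

(** A real-valued form of [empirical], which keeps extended arithmetic out of the deterministic
    estimates. *)
Definition emp {S : Type} {R : realType} (n : nat) (z : nat -> S) (A : set S) : R :=
  n%:R^-1 * \sum_(i < n) (z i \in A)%:R.

Section empirical_frequencies.
Context {S : Type} {R : realType}.
Implicit Types (z : nat -> S) (A B : set S).

Lemma emp_ge0 n z A : 0 <= emp n z A :> R.
Proof. by rewrite mulr_ge0 ?invr_ge0 ?ler0n// sumr_ge0. Qed.

Lemma emp_setT n z : (0 < n)%N -> emp n z setT = 1 :> R.
Proof.
move=> n0; rewrite /emp (eq_bigr (fun=> 1)); last by move=> i _; rewrite in_setT.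
by rewrite sumr_const card_ord -[1 *+ n]/(n%:R) mulVf// pnatr_eq0 -lt0n.
Qed.

Lemma emp_le n z A B : A `<=` B -> emp n z A <= emp n z B :> R.
Proof.
move=> AB; rewrite ler_wpM2l ?invr_ge0//; apply: ler_sum => i _.
rewrite ler_nat; case: (boolP (_ \in A)) => [/set_mem/AB/mem_set ->//|//].
Qed.

Lemma emp_setD n z A B : A `<=` B -> emp n z (B `\` A) = emp n z B - emp n z A :> R.
Proof.
move=> AB; rewrite /emp -mulrBr -sumrB; congr (_ * _); apply: eq_bigr => i _.
rewrite in_setD; case: (boolP (z i \in A)) => [zA|_]; last by rewrite andbT subr0.
by rewrite (mem_set (AB _ (set_mem zA)))/= subrr.
Qed.

Lemma emp_cells {C : finType} (cell : S -> C) n z (E : pred C) :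
  emp n z (cell @^-1` [set` E]) = \sum_(c | E c) emp n z (cell @^-1` [set c]) :> R.
Proof.
rewrite /emp -mulr_sumr exchange_big/=; congr (_ * _); apply: eq_bigr => i _.
rewrite (_ : (z i \in _) = E (cell (z i))); last by apply/idP/idP; rewrite inE.
rewrite big_mkcond (bigD1 (cell (z i)))//= big1 => [|c ci].
  by rewrite addr0; case: ifP => // _; rewrite mem_set.
case: ifP => // _; rewrite memNset// => /= h.
by rewrite h eqxx in ci.
Qed.

End empirical_frequencies.

Lemma empiricalE {R : realType} n (z : nat -> R * R) A :
  empirical n z A = (emp n z A)%:E.
Proof.
rewrite /empirical /emp EFinM; congr (_ * _)%E.
by rewrite -sumEFin; apply: eq_bigr => i _; rewrite diracE.
Qed.

Section iid_bernstein.
Context {d d'} {T : measurableType d} {S : measurableType d'} {R : realType}.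
Variables (Pr : probability T R) (D : set nat) (Z : nat -> T -> S).
Variables (mu : set S -> \bar R) (k : nat).
Hypothesis hZ : iid_with_law Pr D Z mu.
Hypothesis hk : `I_k `<=` D.
Hypothesis k0 : (0 < k)%N.

Lemma emp_freq {C : finType} (cell : S -> C) w (c : C) :
  emp k (Z ^~ w) (cell @^-1` [set c]) = freq (cells Z k cell w) (pred1 c) :> R.
Proof.
rewrite /emp /freq; congr (_ * _); apply: eq_bigr => i _; rewrite ffunE.
by congr (_%:R); congr nat_of_bool; apply/idP/idP; rewrite inE/= => /eqP.
Qed.

(** [prodw_bernstein] for the partition into [A] and its complement, with [bool] as the set of
    cells. *)
Lemma iid_bernstein (A : set S) (pb eps : R) : measurable A ->
  fine (mu A) <= pb -> 0 <= eps <= pb ->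
  measurable [set w | eps <= `|emp k (Z ^~ w) A - fine (mu A)|] /\
  (Pr [set w | (eps <= `|emp k (Z ^~ w) A - fine (mu A)|)%R] <=
   (2 * expR (- (k%:R * eps ^+ 2 / (4 * pb))))%:E)%E.
Proof.
move=> mA hpb he; pose cell (z : S) : bool := z \in A.
have cellA : cell @^-1` [set true] = A.
  by apply/seteqP; split=> [z /= /set_mem//|z zA]; exact/mem_set.
have mcell c : measurable (cell @^-1` [set c]).
  case: c; first by rewrite cellA.
  rewrite (_ : _ @^-1` _ = ~` A); first exact: measurableC.
  by apply/seteqP; split=> [z /= h /mem_set|z /= zA]; [rewrite -/(cell z) h|exact/memNset].
have := iid_product_law hZ hk mcell
  (fun x => eps <= `|freq x (pred1 true) - fine (mu A)|).
rewrite (_ : [set w | _] = [set w | eps <= `|emp k (Z ^~ w) A - fine (mu A)|]); last first.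
  by apply/seteqP; split=> w /=; rewrite -emp_freq cellA.
move=> [h ->]; split=> //; rewrite lee_fin.
have hb := @prodw_bernstein R _ (cell_mass mu cell) k (cell_mass_ge0 hZ hk mcell k0)
  (sum_cell_mass hZ hk mcell k0) (pred1 true) pb eps k0.
rewrite big_pred1_eq /cell_mass cellA in hb.
exact: hb.
Qed.

End iid_bernstein.

(** * Densities of bounded energy *)

(* [energy_le P r q] says that the additive set function [q] has a density
   with respect to [P] whose half squared L2 norm is at most [r], in a form that
   mentions finite partitions only and is hence stable under pointwise limits. *)
Definition energy_le {d} {S : measurableType d} {R : realType} (P : set S -> \bar R)
    (r : R) (q : set S -> R) : Prop :=
  [/\ forall A B, measurable A -> measurable B -> A `&` B = set0 ->
        q (A `|` B) = q A + q B,
      q setT = 0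
    & forall (I : finType) (cell : S -> I) (c : I -> R),
      (forall i, measurable (cell @^-1` [set i])) ->
      \sum_i c i * q (cell @^-1` [set i]) -
        2^-1 * \sum_i c i ^+ 2 * fine (P (cell @^-1` [set i])) <= r].

Section energy.
Context {d} {S : measurableType d} {R : realType} (P : probability S R).
Implicit Types (r : R) (q : set S -> R).

Lemma energy_ge0 r q : energy_le P r q -> 0 <= r.
Proof.
move=> [_ _ /(_ unit (fun=> tt) (fun=> 0))]; rewrite !big1 ?mulr0 ?subr0//; first last.
- by move=> i _; rewrite mul0r.
- by move=> i _; rewrite expr0n mul0r.
apply=> -[]; rewrite (_ : _ @^-1` _ = setT)//.
by apply/seteqP; split.
Qed.

Lemma energy_set0 r q : energy_le P r q -> q set0 = 0.
Proof.
move=> [/(_ set0 set0 measurable0 measurable0 (setI0 _)) + _ _].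
rewrite setU0 => h; apply: (@addrI _ (q set0)); by rewrite addr0 -h.
Qed.

(** Cauchy-Schwarz in variational form: the test function is [t] times the indicator of [A], with
    the optimal [t = q A / P A]. Domination, countable additivity and the moduli of continuity below
    all rest on this inequality. *)
Lemma energy_le_sqr r q A : energy_le P r q -> measurable A ->
  q A ^+ 2 <= 2 * r * fine (P A).
Proof.
move=> hq mA; have r0 := energy_ge0 hq; have q0 := energy_set0 hq.
case: hq => hadd qT /(_ bool (fun z => z \in A)) h.
have cA : (fun z => z \in A) @^-1` [set true] = A.
  by apply/seteqP; split=> [z /= /set_mem//|z zA]; exact/mem_set.
have cB : (fun z => z \in A) @^-1` [set false] = ~` A.
  by apply/seteqP; split=> [z /= h1 /mem_set|z /= zA]; [rewrite h1|exact/memNset].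
have mc i : measurable ((fun z => z \in A) @^-1` [set i]).
  by case: i; rewrite ?cA ?cB//; exact: measurableC.
have {}h t : t * q A - 2^-1 * (t ^+ 2 * fine (P A)) <= r.
  have := h (fun b => if b then t else 0) mc; rewrite !big_bool/= cA.
  by rewrite mul0r !addr0 expr0n mul0r addr0.
have PA0 : 0 <= fine (P A) by exact: fine_ge0.
have [PA|PA] := eqVneq (fine (P A)) 0.
  rewrite PA mulr0; have [->|qA] := eqVneq (q A) 0; first by rewrite expr0n.
  (* On a null set only the linear part of the test is left, and this choice of [t] would give
     [r + 1 <= r]. *)
  have := h ((r + 1) / q A); rewrite PA !mulr0 subr0 divfK//.
  by rewrite gerDl ler10.
have := h (q A / fine (P A)).
have -> : q A / fine (P A) * q A - 2^-1 * ((q A / fine (P A)) ^+ 2 * fine (P A)) =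
  q A ^+ 2 / (2 * fine (P A)) by field.
have PA1 : 0 < fine (P A) by rewrite lt0r PA.
by rewrite ler_pdivrMr ?mulr_gt0//; lra.
Qed.

Lemma energy_bigsetU r q (F : nat -> set S) n : energy_le P r q ->
  (forall i, measurable (F i)) -> trivIset setT F ->
  q (\big[setU/set0]_(i < n) F i) = \sum_(i < n) q (F i).
Proof.
move=> hq mF tF; have q0 := energy_set0 hq; case: hq => hadd _ _.
elim: n => [|n IH]; first by rewrite !big_ord0.
rewrite !big_ord_recr/= hadd ?IH//; first by apply: bigsetU_measurable.
rewrite -bigcup_mkord -subset0 => x [[/= m mn Fm] Fn].
by have := tF m n I I (ex_intro _ x (conj Fm Fn)) => mE; rewrite mE ltnn in mn.
Qed.

(** For the tails [V n] of the union, [q (V n) ^ 2 <= 2 r P (V n)], and [P (V n)] tends to 0. *)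
Lemma energy_semi_sigma_additive r q : energy_le P r q ->
  semi_sigma_additive (fun A => (q A)%:E).
Proof.
move=> hq F mF tF mU; have hq' := hq; case: hq' => hadd _ _.
under eq_fun do rewrite sumEFin.
apply: cvg_EFin; first by near=> n.
rewrite /comp/=.
pose V n := \bigcup_(i in [set k | (n <= k)%N]) F i.
have mV n : measurable (V n) by apply: bigcup_measurable.
have qV n : q (\bigcup_i F i) = \sum_(0 <= i < n) q (F i) + q (V n).
  rewrite big_mkord -(energy_bigsetU n hq mF tF) -hadd//; first last.
  - rewrite -bigcup_mkord -subset0 => x [[/= m mn Fm] [l nl Fl]].
    have := tF m l I I (ex_intro _ x (conj Fm Fl)) => mE.
    by move: mn; rewrite mE ltnNge nl.
  - exact: bigsetU_measurable.
  congr q; apply/seteqP; split=> [x [i _ Fi]|x []].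
  - have [ni|ni] := leqP n i; first by right; exists i.
    by left; rewrite -bigcup_mkord; exists i.
  - by rewrite -bigcup_mkord => -[i _ Fi]; exists i.
  - by move=> [i _ Fi]; exists i.
have PV : fine (P (V n)) @[n --> \oo] --> 0.
  have : P (V n) @[n --> \oo] --> P (\bigcap_n V n).
    apply: nonincreasing_cvg_mu => //.
    - by rewrite (le_lt_trans (probability_le1 _ _))// ltry.
    - exact: bigcapT_measurable.
    - move=> m n mn; apply/subsetPset => x [i /= ni Fi]; exists i => //=.
      exact: leq_trans ni.
  have -> : \bigcap_n V n = set0.
    rewrite -subset0 => x h; have [i _ Fi] := h 0%N I.
    have [j /= ij Fj] := h i.+1 I.
    have := tF i j I I (ex_intro _ x (conj Fi Fj)) => mE.
    by move: ij; rewrite mE ltnn.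
  by rewrite measure0 => /fine_cvg.
apply/cvgrPdist_le => e e0.
have rPV : 2 * r * fine (P (V n)) @[n --> \oo] --> 0.
  by rewrite -(mulr0 (2 * r)); apply: cvgM => //; exact: cvg_cst.
move/cvgrPdist_le : rPV => /(_ (e ^+ 2)).
rewrite exprn_gt0// => /(_ isT); apply: filterS => n.
rewrite sub0r normrN => h; rewrite (qV n) addrC addKr.
have := energy_le_sqr hq (mV n) => h2.
rewrite -(@ler_pXn2r _ 2)// ?nnegrE ?(ltW e0)// real_normK ?num_real//.
by rewrite (le_trans h2)// (le_trans _ h)// ler_norm.
Unshelve. all: by end_near. Qed.

End energy.

Section energy_simple_functions.
Context {d} {S : measurableType d} {R : realType} (P : probability S R).
Variables (r : R) (q : set S -> R).
Hypothesis hq : energy_le P r q.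

(** The level sets of [h] are split further by [N] and tested with the coefficient [phi] outside [N]
    and its opposite inside. When [N] is a negative set of [q] with positive complement, the left
    side is the integral of [phi (h)] against the total variation of [q]. *)
Lemma energy_simple_sum (h : S -> R) (N : set S) (phi : R -> R) :
  finite_set (range h) -> (forall y, measurable (h @^-1` [set y])) -> measurable N ->
  \sum_(y \in range h) phi y *
      (q (h @^-1` [set y] `\` N) - q (h @^-1` [set y] `&` N)) <=
  r + 2^-1 * \sum_(y \in range h) phi y ^+ 2 * fine (P (h @^-1` [set y])).
Proof.
move=> fX mh mN; have hq' := hq; case: hq' => hadd _ hI.
have [s us rs] : exists2 s : seq R, uniq s & range h = [set` s].
  case/finite_seqP : fX => s rs; exists (undup s); first exact: undup_uniq.
  by rewrite rs; apply/seteqP; split=> y; rewrite /= mem_undup.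
have hX z : (index (h z) s < size s)%N.
  by rewrite index_mem; have : range h (h z) by []; rewrite rs.
pose v (y : 'I_(size s)) := nth 0 s y.
pose cell z : 'I_(size s) * bool := (Ordinal (hX z), z \in N).
have cellv z y : (Ordinal (hX z) == y) = (h z == v y).
  apply/eqP/eqP => [<-|hy]; first by rewrite /v/= nth_index// -index_mem.
  by apply: val_inj => /=; rewrite hy index_uniq.
have cE y b : cell @^-1` [set (y, b)] =
    if b then h @^-1` [set v y] `&` N else h @^-1` [set v y] `\` N.
  case: b; apply/seteqP; split=> z /=.
  - by case=> /eqP; rewrite cellv => /eqP -> /set_mem.
  - by move=> [/eqP hy /mem_set zN]; rewrite /cell zN; congr pair; apply/eqP; rewrite cellv.
  - case=> /eqP; rewrite cellv => /eqP -> zN; split=> // /mem_set; by rewrite zN.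
  - by move=> [/eqP hy zN]; rewrite /cell memNset//; congr pair; apply/eqP; rewrite cellv.
have mc i : measurable (cell @^-1` [set i]).
  by case: i => y b; rewrite cE; case: b; [exact: measurableI|exact: measurableD].
have := hI _ cell (fun i : 'I_(size s) * bool => (-1) ^+ i.2 * phi (v i.1)) mc.
rewrite lerBlDr => /le_trans le.
have sumE (F : R -> R) : \sum_(y \in range h) F y = \sum_(i < size s) F (v i).
  by rewrite rs -fsbig_seq// (big_nth 0) big_mkord.
rewrite !sumE.
have -> : \sum_(y < size s) phi (v y) *
   (q (h @^-1` [set v y] `\` N) - q (h @^-1` [set v y] `&` N)) =
   \sum_(i : 'I_(size s) * bool) (-1) ^+ i.2 * phi (v i.1) * q (cell @^-1` [set i]).
  transitivity (\sum_(y < size s) \sum_(b : bool)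
      (-1) ^+ b * phi (v y) * q (cell @^-1` [set (y, b)])); last first.
    by rewrite pair_bigA/=; apply: eq_bigr => -[].
  apply: eq_bigr => y _; rewrite big_bool/= !cE expr1 expr0; ring.
apply: le; rewrite lerD2l ler_wpM2l ?invr_ge0//.
rewrite (eq_bigr (fun i : 'I_(size s) * bool =>
   ((-1) ^+ i.2 * phi (v i.1)) ^+ 2 * fine (P (cell @^-1` [set (i.1, i.2)])))); last by case.
rewrite -(pair_bigA _ (fun (y : 'I_(size s)) (b : bool) =>
   ((-1) ^+ b * phi (v y)) ^+ 2 * fine (P (cell @^-1` [set (y, b)]))))/=.
apply: ler_sum => y _; rewrite big_bool/= !cE expr1 expr0 mulN1r sqrrN mul1r.
rewrite -mulrDr ler_wpM2l ?sqr_ge0//.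
rewrite -fineD ?fin_num_measure//; first last.
- exact: measurableD.
- exact: measurableI.
rewrite -measureU//; first last.
- by apply/seteqP; split=> // z [[_ zN] [_ /(_ zN)]].
- exact: measurableD.
- exact: measurableI.
by rewrite setUIDK.
Qed.

End energy_simple_functions.

Section simple_sum.
Context {d} {S : measurableType d} {R : realType} (P : probability S R).

Lemma simple_sum_le_integral (h : S -> R) (phi : R -> R) (f : S -> \bar R) :
  finite_set (range h) -> (forall y, measurable (h @^-1` [set y])) ->
  measurable_fun setT f -> (forall z, (0 <= f z)%E) ->
  (forall z, ((phi (h z))%:E <= f z)%E) -> (forall z, 0 <= phi (h z)) ->
  ((\sum_(y \in range h) phi y * fine (P (h @^-1` [set y])))%:E <= \int[P]_z f z)%E.
Proof.
move=> fX mh mf f0 phif phi0.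
have [s us rs] : exists2 s : seq R, uniq s & range h = [set` s].
  case/finite_seqP : fX => s rs; exists (undup s); first exact: undup_uniq.
  by rewrite rs; apply/seteqP; split=> y; rewrite /= mem_undup.
have sT : setT = \big[setU/set0]_(y <- s) (h @^-1` [set y]).
  rewrite -bigcup_seq; apply/seteqP; split=> // z _; exists (h z) => //.
  by have : range h (h z) by []; rewrite rs.
have tr : trivIset [set` s] (fun y => h @^-1` [set y]).
  by move=> i j _ _ [z [/= <- <-]].
have mf' : measurable_fun (\big[setU/set0]_(y <- s) (h @^-1` [set y])) f by rewrite -sT.
rewrite rs -fsbig_seq// sT (ge0_integral_bigsetU P (F := fun y => h @^-1` [set y]) mh us tr mf' (fun z _ => f0 z)).
rewrite -sumEFin big_seq [leRHS]big_seq; apply: lee_sum => y ys.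
have [z _ hz] : range h y by rewrite rs.
rewrite EFinM fineK ?fin_num_measure// -integral_cst//.
apply: ge0_le_integral => //.
- by move=> x _; rewrite /= lee_fin -hz.
- exact: measurable_funS mf.
- by move=> x /= <-.
Qed.

Import HBNNSimple.

(** Puts the definition of the integral by simple functions into terms of plain functions with
    finitely many values, the form in which [energy_simple_sum] applies. *)
Lemma nnintegral_le (mu : {measure set S -> \bar R}) (f : S -> \bar R) (b : \bar R) :
  (forall z, (0 <= f z)%E) ->
  (forall h : S -> R, finite_set (range h) -> (forall y, measurable (h @^-1` [set y])) ->
     (forall z, 0 <= h z) -> (forall z, ((h z)%:E <= f z)%E) ->
     (\sum_(y \in range h) y%:E * mu (h @^-1` [set y]) <= b)%E) ->
  (\int[mu]_z f z <= b)%E.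
Proof.
move=> f0 hb; rewrite ge0_integralTE//; apply: ge_ereal_sup => _ [h /= hw <-].
rewrite sintegralE; apply: hb => //.
Qed.

End simple_sum.

(** The proof of [energy_le] is an argument so that the charge structure attached below can depend
    on it. *)
Definition energy_charge {d} {S : measurableType d} {R : realType}
    (P : probability S R) r (q : set S -> R) of energy_le P r q :
  set S -> \bar R := fun A => (q A)%:E.

Section energy_charge.
Context {d} {S : measurableType d} {R : realType} (P : probability S R).
Variables (r : R) (q : set S -> R).
Hypothesis hq : energy_le P r q.
Local Notation Q := (energy_charge hq).

Let charge0 : Q set0 = 0%E. Proof. by rewrite /energy_charge (energy_set0 hq). Qed.
Let charge_fin A : measurable A -> Q A \is a fin_num. Proof. by []. Qed.
Let charge_sigma : semi_sigma_additive Q. Proof. exact: energy_semi_sigma_additive hq. Qed.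
HB.instance Definition _ := isCharge.Build _ _ _ Q charge0 charge_fin charge_sigma.

Lemma energy_charge_dominates : (Q : {charge set S -> \bar R}) `<< P.
Proof.
apply/null_content_dominatesP => A mA PA0; rewrite /energy_charge.
have := energy_le_sqr hq mA; rewrite PA0 mulr0 => h.
by congr (_%:E); apply/eqP; rewrite -sqrf_eq0 eq_le h sqr_ge0.
Qed.

Lemma energy_charge_variation A N (QAN : hahn_decomposition (Q : {charge set S -> \bar R}) A N) E :
  measurable E -> charge_variation QAN E = (q (E `\` N) - q (E `&` N))%:E.
Proof.
move=> mE; rewrite /charge_variation jordan_posE jordan_negE cjordan_posE cjordan_negE.
have [[mA _] [mN _] AN A0] := QAN.
have -> : E `\` N = E `&` A.
  apply/seteqP; split=> z [Ez]; last first.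
    by move=> Az; split=> // Nz; have : (A `&` N) z by []; rewrite A0.
  by move=> Nz; split=> //; have : (A `|` N) z by [rewrite AN]; case.
by rewrite /crestr0 mem_set.
Qed.

(** Young's inequality, tested on simple functions below [|w|], bounds the integral by [r] plus half
    the integral of [w ^ 2]. This is the integrability demanded by [Lambda0Theta2]. *)
Lemma energy_charge_integral_lty A N
    (QAN : hahn_decomposition (Q : {charge set S -> \bar R}) A N) (w : S -> R) :
  measurable_fun setT w -> (\int[P]_z ((w z) ^+ 2)%:E < +oo)%E ->
  (\int[charge_variation QAN]_z `|w z|%:E < +oo)%E.
Proof.
move=> mw w2.
have [[mA _] [mN _] AN A0] := QAN.
have ge0 : (0 <= \int[P]_z ((w z) ^+ 2)%:E)%E.
  by apply: integral_ge0 => z _; rewrite lee_fin sqr_ge0.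
apply: (@le_lt_trans _ _ (r%:E + 2^-1%:E * \int[P]_z ((w z) ^+ 2)%:E)%E); last first.
  by rewrite lte_add_pinfty ?ltry// lte_mul_pinfty.
apply: nnintegral_le => [z|h fX mh h0 hw]; first by rewrite lee_fin.
have fE y : (y%:E * charge_variation QAN (h @^-1` [set y]) =
   (y * (q (h @^-1` [set y] `\` N) - q (h @^-1` [set y] `&` N)))%:E)%E.
  by rewrite EFinM energy_charge_variation.
under eq_fsbigr do rewrite fE.
rewrite fsumEFin//.
apply: (@le_trans _ _ (r + 2^-1 * \sum_(y \in range h) y ^+ 2 * fine (P (h @^-1` [set y])))%:E).
  by rewrite lee_fin; exact: (energy_simple_sum hq).
rewrite EFinD EFinM leeD2l// lee_wpmul2l//.
apply: (@simple_sum_le_integral _ _ _ P h (fun y => y ^+ 2)) => //.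
- by apply/measurable_EFinP; exact: measurable_funX.
- by move=> z; rewrite lee_fin sqr_ge0.
- move=> z; rewrite lee_fin -(real_normK (num_real (w z))) lerXn2r ?nnegrE//.
  by have := hw z; rewrite lee_fin.
- by move=> z; rewrite sqr_ge0.
Qed.

(** For a simple [h] below the squared density, the test function is [sqrt h] times the sign of the
    density. The outcome, that the integral of [h] is at most [r] plus half of itself, can be solved
    because that integral is finite; then the supremum over [h] is taken. *)
Lemma energy_charge_density_sqr :
  ((2^-1)%:E * \int[P]_z (Radon_Nikodym (Q : {charge set S -> \bar R}) P z) ^+ 2 <= r%:E)%E.
Proof.
set f := Radon_Nikodym _ P.
have fint : P.-integrable setT f by exact: Radon_Nikodym_integrable energy_charge_dominates.
have ffin z : f z \is a fin_num by apply: Radon_Nikodym_fin_num; exact: energy_charge_dominates.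
have fE A : measurable A -> (q A)%:E = (\int[P]_(z in A) f z)%E.
  by move=> mA; exact: (Radon_Nikodym_integral energy_charge_dominates mA).
have mf : measurable_fun setT f by exact: measurable_int fint.
suff : (\int[P]_z f z ^+ 2 <= (2 * r)%:E)%E.
  move=> h; apply: (@le_trans _ _ (2^-1%:E * (2 * r)%:E)%E); first by rewrite lee_wpmul2l.
  by rewrite -EFinM lee_fin mulKf.
apply: nnintegral_le => [z|h fX mh h0 hw]; first by rewrite sqre_ge0.
pose N := [set z | (f z < 0)%E].
have mN : measurable N.
  by have := emeasurable_fun_infty_o measurableT mf 0%E; rewrite setTI.
have := @energy_simple_sum _ _ _ P r q hq h N Num.sqrt fX mh mN.
have sq y : range h y -> Num.sqrt y ^+ 2 = y by case=> z _ <-; rewrite sqr_sqrtr.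
rewrite [X in _ <= r + 2^-1 * X](eq_fsbigr (fun y => y * fine (P (h @^-1` [set y])))); last first.
  by move=> y /set_mem ry; rewrite sq.
have fib y : range h y -> y * fine (P (h @^-1` [set y])) <=
    Num.sqrt y * (q (h @^-1` [set y] `\` N) - q (h @^-1` [set y] `&` N)).
  move=> ry; set E := h @^-1` [set y]; have mE : measurable E by exact: mh.
  have mEN : measurable (E `\` N) by exact: measurableD.
  have mEI : measurable (E `&` N) by exact: measurableI.
  have s0 : 0 <= Num.sqrt y by exact: sqrtr_ge0.
  have sf z : E z -> Num.sqrt y <= `|fine (f z)|.
    move=> Ez; rewrite -sqrtr_sqr ler_wsqrtr// -Ez.
    by have := hw z; rewrite -[in X in (_ <= X ^+ 2)%E -> _](fineK (ffin z)) -EFin_expe lee_fin.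
  have up : Num.sqrt y * fine (P (E `\` N)) <= q (E `\` N).
    rewrite -lee_fin EFinM fineK ?fin_num_measure// fE// -integral_cst//.
    have f0 z : (E `\` N) z -> (0 <= f z)%E.
      by move=> [_ /negP]; rewrite -leNgt.
    apply: ge0_le_integral => //.
    + exact: measurable_funS mf.
    + move=> z ENz; have [Ez _] := ENz; rewrite -(fineK (ffin z)) lee_fin.
      by rewrite -(ger0_norm (fine_ge0 (f0 z ENz))) sf.
  have down : Num.sqrt y * fine (P (E `&` N)) <= - q (E `&` N).
    rewrite -lee_fin EFinN EFinM fineK ?fin_num_measure// fE// -integral_cst//.
    have f0 z : (E `&` N) z -> (0 <= - f z)%E by move=> [_ /ltW]; rewrite oppe_ge0.
    have -> : (- (\int[P]_(z in E `&` N) f z) = \int[P]_(z in E `&` N) (- f z))%E.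
      rewrite -[RHS]oppeK -(integral_ge0N P f0); congr (- _)%E.
      by apply: eq_integral => z _; rewrite oppeK.
    apply: ge0_le_integral => //.
    + by apply: measurableT_comp => //; exact: measurable_funS mf.
    + move=> z ENz; have [Ez _] := ENz; rewrite -(fineK (ffin z)) -EFinN lee_fin.
      have := f0 z ENz; rewrite -(fineK (ffin z)) -EFinN lee_fin => h1.
      by rewrite -(ger0_norm h1) normrN sf.
  have -> : fine (P E) = fine (P (E `&` N)) + fine (P (E `\` N)).
    rewrite -fineD ?fin_num_measure// -measureU ?setUIDK//.
    by apply/seteqP; split=> // z [[_ zN] [_ /(_ zN)]].
  rewrite -{1}(sq _ ry) expr2; nra.
move=> le1.
have : \sum_(y \in range h) y * fine (P (h @^-1` [set y])) <=
   r + 2^-1 * \sum_(y \in range h) y * fine (P (h @^-1` [set y])).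
  apply: le_trans le1; rewrite -lee_fin -!fsumEFin//; exact: lee_fsum.
rewrite (@eq_fsbigr _ _ _ _ (fun y => y%:E * P (h @^-1` [set y]))%E
  (fun y => (y * fine (P (h @^-1` [set y])))%:E)); last first.
  by move=> y _; rewrite EFinM fineK ?fin_num_measure.
rewrite fsumEFin// lee_fin; lra.
Qed.

End energy_charge.

Section energy_limits.
Context {d} {S : measurableType d} {R : realType} (P : probability S R).

Lemma cvg_finsum (U : set_system nat) (FU : ProperFilter U) (I : finType)
    (f : I -> nat -> R) (l : I -> R) :
  (forall i, f i n @[n --> U] --> l i) -> (\sum_i f i n) @[n --> U] --> \sum_i l i.
Proof.
move=> fl; elim: (index_enum I) => [|i s IH].
  by under eq_fun do rewrite big_nil; rewrite big_nil; exact: cvg_cst.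
by under eq_fun do rewrite big_cons; rewrite big_cons; exact: cvgD.
Qed.

(* The limit is taken along an ultrafilter, simultaneously on all measurable sets. *)
Lemma energy_sequential_compactness r (q_ : nat -> set S -> R) :
  (forall n, energy_le P r (q_ n)) ->
  exists2 q : set S -> R, energy_le P r q &
    forall (I : finType) (A : I -> set S) (e : R) (N : nat), 0 < e ->
      (forall i, measurable (A i)) ->
      exists2 n, (N <= n)%N & forall i, `|q_ n (A i) - q (A i)| <= e.
Proof.
move=> hq; have [U [UU subU]] := ultraFilterLemma (eventually_filter).
have FU : ProperFilter U by exact: ultra_proper.
have lim A : exists l : R, measurable A -> q_ n A @[n --> U] --> l.
  have [mA|nmA] := pselect (measurable A); last by exists 0.
  have bnd n : `[- (2 * r + 1), 2 * r + 1]%classic (q_ n A).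
    rewrite /= in_itv/= -ler_norml.
    have := energy_le_sqr (hq n) mA; have r0 := energy_ge0 (hq n).
    have P1 : fine (P A) <= 1.
      by rewrite -lee_fin fineK ?fin_num_measure// probability_le1.
    have P0 : 0 <= fine (P A) by exact: fine_ge0.
    rewrite -(real_normK (num_real (q_ n A))) => h.
    have h2 : 2 * r * fine (P A) <= 2 * r by rewrite ler_piMr// mulr_ge0.
    have := normr_ge0 (q_ n A); move: (`|q_ n A|) h => x h x0; nra.
  have /(_ _ _)[|l [_ cl]] := @segment_compact R (- (2 * r + 1)) (2 * r + 1) (q_ n A @[n --> U]).
    by rewrite /nbhs/= ; apply: (@filterE _ U _ (fun n => `[- (2 * r + 1), 2 * r + 1]%classic (q_ n A))) => n; exact: bnd.
  exists l => _; apply/cvgrPdist_lt => e e0.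
  (* A cluster point along an ultrafilter is a limit: otherwise the complement of the ball would
     belong to the filter and hence meet the ball. *)
  have [//|hc] := in_ultra_setVsetC [set n | `|l - q_ n A| < e] UU.
  have [|x [h1 h2]] := cl [set x | ~ `|l - x| < e] (ball l e) _ (nbhsx_ballx _ _ e0).
    exact: hc.
  by [].
have [q qE] := choice lim.
exists q; last first.
  move=> I A e N e0 mA.
  have : \forall n \near U, (N <= n)%N /\ forall i, `|q_ n (A i) - q (A i)| <= e.
    apply: filterI; first by apply: subU; exact: nbhs_infty_ge.
    apply: filter_forall => i.
    have /cvgrPdist_le/(_ _ e0) := qE _ (mA i).
    by apply: filterS => n; rewrite distrC.
  by move=> /filter_ex[n [Nn h]]; exists n.
split.
- move=> A B mA mB AB.
  have h1 := qE _ (measurableU _ _ mA mB).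
  have h2 : q_ n (A `|` B) @[n --> U] --> q A + q B.
    have -> : (fun n => q_ n (A `|` B)) = (fun n => q_ n A + q_ n B).
      by apply/funext => n; have [hadd _ _] := hq n; exact: hadd.
    by apply: cvgD; exact: qE.
  exact: (cvg_unique _ h1 h2).
- have h1 := qE _ measurableT.
  have h2 : q_ n setT @[n --> U] --> (0 : R).
    have -> : (fun n => q_ n setT) = (fun=> 0); last exact: cvg_cst.
    by apply/funext => n; have [_ hT _] := hq n.
  exact: (cvg_unique _ h1 h2).
- move=> I cell c mc; rewrite lerBlDr; set K := 2^-1 * _.
  have h : (\sum_i c i * q_ n (cell @^-1` [set i])) @[n --> U] -->
      \sum_i c i * q (cell @^-1` [set i]).
    by apply: cvg_finsum => i; apply: cvgM; [exact: cvg_cst|exact: qE].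
  apply: (ler_cvg_to h (cvg_cst (r + K))).
  by apply: filterE => n; rewrite -lerBlDr; have [_ _] := hq n; apply.
Qed.

End energy_limits.

Section energy_examples.
Context {d} {S : measurableType d} {R : realType} (P : probability S R).
Implicit Types (q : set S -> R).

Lemma energy_cells r q {C : finType} (cell : S -> C) (E : pred C) :
  energy_le P r q -> (forall c, measurable (cell @^-1` [set c])) ->
  q (cell @^-1` [set` E]) = \sum_(c | E c) q (cell @^-1` [set c]).
Proof.
move=> hq mc; have q0 := energy_set0 hq; case: hq => hadd _ _.
have gen (s : seq C) : uniq s -> measurable (cell @^-1` [set c | c \in s /\ E c]) /\
    q (cell @^-1` [set c | c \in s /\ E c]) = \sum_(c <- s | E c) q (cell @^-1` [set c]).
  elim: s => [_|c s IH /= /andP[cs us]].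
    rewrite big_nil (_ : _ @^-1` _ = set0)//.
    by rewrite -subset0 => z [].
  have [ms qs] := IH us.
  have [Ec|nEc] := boolP (E c); last first.
    rewrite big_cons (negbTE nEc) (_ : _ @^-1` _ = cell @^-1` [set c | c \in s /\ E c])//.
    apply/seteqP; split=> z /= [].
      by rewrite inE => /orP[/eqP ->|//] h; rewrite h in nEc.
    by move=> zs Ez; rewrite inE zs orbT.
  have -> : cell @^-1` [set x | x \in c :: s /\ E x] =
     cell @^-1` [set c] `|` cell @^-1` [set x | x \in s /\ E x].
    apply/seteqP; split=> z /=.
      by rewrite inE => -[/orP[/eqP ->|zs] h]; [left|right].
    by rewrite inE => -[->|[-> ->]]; rewrite ?eqxx ?Ec ?orbT.
  split; first exact: measurableU.
  rewrite big_cons Ec hadd ?qs//.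
  rewrite -subset0 => z [/= ->] [zs _]; by rewrite zs in cs.
have [_] := gen _ (index_enum_uniq C); rewrite (_ : _ @^-1` _ = cell @^-1` [set` E])//.
by apply/seteqP; split=> z /=; rewrite mem_index_enum => // -[].
Qed.

(** The density is [D c / P c] on cell [c]. Against any other partition,
    [t * s <= (t ^ 2 + s ^ 2) / 2] with [s = D c / P c] is used on the common refinement, where the
    terms in [s ^ 2] sum to the rate. *)
Lemma coarse_density {C : finType} (cell : S -> C) (D : C -> R) :
  (forall c, measurable (cell @^-1` [set c])) -> \sum_c D c = 0 ->
  (forall c, cell_mass P cell c = 0 -> D c = 0) ->
  exists2 q, energy_le P (rate (cell_mass P cell) D) q &
    forall c, q (cell @^-1` [set c]) = D c.
Proof.
move=> mc D0 PD; pose p := cell_mass P cell.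
have mI A c : measurable A -> measurable (A `&` cell @^-1` [set c]).
  by move=> mA; exact: measurableI.
pose q A := \sum_c D c / p c * fine (P (A `&` cell @^-1` [set c])).
exists q; last first.
  move=> c; rewrite /q (bigD1 c)//= big1 ?addr0 => [|c' cc'].
    rewrite setIid -/(cell_mass P cell c) -/p.
    by have [/PD ->|pc] := eqVneq (p c) 0; [rewrite !mul0r|rewrite divfK].
  rewrite (_ : _ `&` _ = set0) ?measure0 ?mulr0//.
  by rewrite -subset0 => z [/= zc zc']; rewrite -zc -zc' eqxx in cc'.
split.
- move=> A B mA mB AB; rewrite /q -big_split/=; apply: eq_bigr => c _.
  rewrite -mulrDr -fineD ?fin_num_measure//; try exact: mI.
  rewrite -measureU ?setIUl//; try exact: mI.
  by rewrite setIACA AB set0I.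
- rewrite /q -[RHS]D0; apply: eq_bigr => c _; rewrite setTI -/(cell_mass P cell c) -/p.
  by have [/PD ->|pc] := eqVneq (p c) 0; [rewrite !mul0r|rewrite divfK].
move=> I cell' t mc'.
pose Pic i c := fine (P (cell' @^-1` [set i] `&` cell @^-1` [set c])).
have mic i c : measurable (cell' @^-1` [set i] `&` cell @^-1` [set c]) by exact: mI.
have split1 (A : set S) : measurable A ->
    fine (P A) = \sum_c fine (P (A `&` cell @^-1` [set c])).
  move=> mA; apply: EFin_inj; rewrite fineK ?fin_num_measure// -sumEFin.
  rewrite (eq_bigr (fun c => P (A `&` cell @^-1` [set c]))); last first.
    by move=> c _; rewrite fineK// fin_num_measure//; exact: mI.
  rewrite -(@measure_finType_bigcup _ _ _ P C xpredT (fun c => A `&` cell @^-1` [set c])).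
  - by congr (P _); apply/seteqP; split=> [z Az|z [c _ []//]]; exists (cell z).
  - by move=> c; exact: mI.
  - by move=> c c' z [_ /= <-] [_ /= <-].
have split2 (A : set S) : measurable A ->
    fine (P A) = \sum_i fine (P (cell' @^-1` [set i] `&` A)).
  move=> mA; apply: EFin_inj; rewrite fineK ?fin_num_measure// -sumEFin.
  rewrite (eq_bigr (fun i => P (cell' @^-1` [set i] `&` A))); last first.
    by move=> c _; rewrite fineK// fin_num_measure//; exact: measurableI.
  rewrite -(@measure_finType_bigcup _ _ _ P I xpredT (fun i => cell' @^-1` [set i] `&` A)).
  - by congr (P _); apply/seteqP; split=> [z Az|z [c _ []//]]; exists (cell' z).
  - by move=> c; exact: measurableI.
  - by move=> c c' z [/= <- _] [/= <- _].
rewrite /q (eq_bigr (fun i => \sum_c t i * (D c / p c * Pic i c))); last first.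
  by move=> i _; rewrite mulr_sumr.
rewrite [X in _ - _ * X](eq_bigr (fun i => \sum_c t i ^+ 2 * Pic i c)); last first.
  by move=> i _; rewrite split1// mulr_sumr.
have -> : rate (cell_mass P cell) D = 2^-1 * \sum_i \sum_c (D c / p c) ^+ 2 * Pic i c.
  rewrite exchange_big/= /rate -/p; congr (_ * _); apply: eq_bigr => c _.
  rewrite -mulr_sumr -split2// -/(cell_mass P cell c) -/p.
  by have [/PD ->|pc] := eqVneq (p c) 0; [rewrite expr0n !mul0r expr0n mul0r|field].
rewrite lerBlDr -mulrDr -big_split mulr_sumr/=; apply: ler_sum => i _.
rewrite -big_split mulr_sumr/=; apply: ler_sum => c _.
have Pic0 : 0 <= Pic i c by exact: fine_ge0.
rewrite -mulrDl [t i * _]mulrA [2^-1 * _]mulrA ler_wpM2r//.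
have := sqr_ge0 (t i - D c / p c); rewrite sqrrB.
move: (t i) (D c / p c); clear => x y; rewrite !expr2; lra.
Qed.

(** Converse to [energy_charge_density_sqr]: the pointwise inequality [c f <= (c ^ 2 + f ^ 2) / 2]
    is integrated over each cell. *)
Lemma charge_energy_le r (Q : {charge set S -> \bar R}) :
  Q `<< P -> Q setT = 0%E ->
  ((2^-1)%:E * \int[P]_z (Radon_Nikodym Q P z) ^+ 2 <= r%:E)%E ->
  energy_le P r (fun A => fine (Q A)).
Proof.
move=> QP QT hr; set f := Radon_Nikodym Q P in hr.
have fint : P.-integrable setT f by exact: Radon_Nikodym_integrable.
have ffin z : f z \is a fin_num by exact: Radon_Nikodym_fin_num.
have fE A : measurable A -> Q A = (\int[P]_(z in A) f z)%E.
  by move=> mA; exact: Radon_Nikodym_integral.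
have mf : measurable_fun setT f by exact: measurable_int fint.
have Qfin A : measurable A -> Q A \is a fin_num by move=> mA; exact: fin_num_measure.
have mf2 : measurable_fun setT (fun z => f z ^+ 2)%E.
  rewrite (_ : (fun z => _) = EFin \o (fun z => fine (f z) ^+ 2)); last first.
    by apply/funext => z /=; rewrite EFin_expe fineK.
  apply/measurable_EFinP; apply: measurable_funX.
  exact: measurableT_comp.
have f20 z : (0 <= f z ^+ 2)%E by rewrite sqre_ge0.
have f2lty : (\int[P]_z f z ^+ 2 < +oo)%E.
  rewrite ltNge leye_eq; apply/negP => /eqP h; move: hr; rewrite h.
  by rewrite gt0_muley ?lte_fin ?invr_gt0.
have f2int : P.-integrable setT (fun z => f z ^+ 2)%E.
  apply/integrableP; split=> //.
  by under eq_integral do rewrite gee0_abs//.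
split.
- move=> A B mA mB AB; rewrite chargeU// fineD//; exact: Qfin.
- by rewrite QT.
move=> I cell c mc; rewrite lerBlDr.
pose u i := fine (\int[P]_(z in cell @^-1` [set i]) f z ^+ 2)%E.
have uE i : (\int[P]_(z in cell @^-1` [set i]) f z ^+ 2 = (u i)%:E)%E.
  rewrite fineK// integrable_fin_num//; exact: integrableS f2int.
have usum : \sum_i u i <= 2 * r.
  rewrite -lee_fin -sumEFin.
  have sT : setT = \big[setU/set0]_(i <- index_enum I) (cell @^-1` [set i]).
    rewrite -bigcup_seq; apply/seteqP; split=> // z _; exists (cell z) => //.
    by rewrite /= mem_index_enum.
  have tr : trivIset [set` index_enum I] (fun i => cell @^-1` [set i]).
    by move=> i j _ _ [z [/= <- <-]].
  have mf' : measurable_fun (\big[setU/set0]_(i <- index_enum I) (cell @^-1` [set i])) (fun z => f z ^+ 2)%E.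
    by rewrite -sT.
  rewrite -(eq_bigr _ (fun i _ => uE i)).
  rewrite -(ge0_integral_bigsetU P (F := fun i => cell @^-1` [set i]) mc (index_enum_uniq _) tr mf' (fun z _ => f20 z)).
  rewrite -sT; have JE : (\int[P]_z f z ^+ 2 = (fine (\int[P]_z f z ^+ 2))%:E)%E.
    by rewrite fineK// integrable_fin_num.
  by move: hr; rewrite JE -EFinM !lee_fin; lra.
have cell_le i : c i * fine (Q (cell @^-1` [set i])) <=
   2^-1 * u i + 2^-1 * (c i ^+ 2 * fine (P (cell @^-1` [set i]))).
  set A := cell @^-1` [set i]; have mA : measurable A by exact: mc.
  have fA : P.-integrable A f by exact: integrableS fint.
  have f2A : P.-integrable A (fun z => f z ^+ 2)%E by exact: integrableS f2int.
  have cA : P.-integrable A (cst (2^-1 * c i ^+ 2)%:E).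
    by apply: finite_measure_integrable_cst.
  rewrite -lee_fin EFinM fineK ?Qfin// fE// -integralZl//.
  rewrite EFinD EFinM -uE -integralZl// mulrA [X in (_ + X)%E]EFinM fineK ?fin_num_measure//.
  rewrite -integral_cst// -integralD//; last exact: integrableZl.
  apply: le_integral => //.
  - exact: integrableZl.
  - by apply: integrableD => //; exact: integrableZl.
  - move=> z _; have f2 : (f z ^+ 2 = (fine (f z) ^+ 2)%:E)%E by rewrite EFin_expe fineK.
    rewrite /cst f2 -{1}(fineK (ffin z)) -!EFinM -EFinD lee_fin.
    have := sqr_ge0 (c i - fine (f z)); rewrite sqrrB.
    move: (c i) (fine (f z)); clear => x y; rewrite !expr2; lra.
apply: (le_trans (ler_sum _ (fun i _ => cell_le i))).
rewrite big_split/= -!mulr_sumr lerD2r; lra.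
Qed.

End energy_examples.

(** * The delta method for quantiles and copulas *)

Section quantile_perturbation.
Context {R : realType}.
Implicit Types (K F beta : R -> R) (u x : R).

(** [inf] takes a default value on sets that are empty or unbounded below; the points [l] and [r]
    exclude these cases, here and in the lemmas that follow. *)
Lemma quantile_bounds K u l r : {homo K : x y / x <= y} -> K l < u -> u <= K r ->
  l <= quantile K u <= r.
Proof.
move=> hK Kl Kr.
have lbl : lbound [set x | u <= K x] l.
  by move=> z /= uz; rewrite leNgt; apply/negP => zl; have := hK _ _ (ltW zl); lra.
have ne : [set x | u <= K x] !=set0 by exists r.
apply/andP; split; first exact: lb_le_inf.
by apply: ge_inf => //; exists l.
Qed.

Lemma quantile_gt K u l r x : {homo K : x y / x <= y} -> K l < u -> u <= K r ->
  quantile K u < x -> u <= K x.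
Proof.
move=> hK Kl Kr qx.
have lbl : lbound [set x | u <= K x] l.
  by move=> z /= uz; rewrite leNgt; apply/negP => zl; have := hK _ _ (ltW zl); lra.
have hinf : has_inf [set x | u <= K x] by split; [exists r|exists l].
have e0 : 0 < x - quantile K u by rewrite subr_gt0.
have [z /= uz zx] := inf_adherent e0 hinf.
apply: (le_trans uz); apply: hK; move: zx; rewrite /quantile; lra.
Qed.

Lemma quantile_lt K u l x : {homo K : x y / x <= y} -> K l < u ->
  x < quantile K u -> K x < u.
Proof.
move=> hK Kl qx; rewrite ltNge; apply/negP => uK.
have lbl : lbound [set x | u <= K x] l.
  by move=> z /= uz; rewrite leNgt; apply/negP => zl; have := hK _ _ (ltW zl); lra.
have : inf [set x | u <= K x] <= x by apply: ge_inf => //; exists l.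
by rewrite leNgt -/(quantile K u) qx.
Qed.

(** At the two trial points at distance [3 e a / f] from [x0 - a b / f], the linear part has changed
    by [3 e a], which two errors of size [e a] cannot outweigh. So [K'] is below [u] at the left
    point and above it at the right one. *)
Lemma quantile_linearization K K' u (a f b e M : R) (x0 := quantile K u) :
  {homo K' : x y / x <= y} -> 0 < a -> 0 < f -> 0 < e -> `|b| / f + 3 * e / f <= M ->
  (forall t, `|t| <= M -> `|K (x0 + a * t) - u - a * f * t| <= e * a) ->
  (forall t, `|t| <= M -> `|K' (x0 + a * t) - K (x0 + a * t) - a * b| <= e * a) ->
  `|quantile K' u - x0 + a * b / f| <= 3 * e * a / f.
Proof.
move=> hK' a0 f0 e0 hM h h'.
have bM s : `|s| <= 1 -> `|- b / f + s * (3 * e / f)| <= M.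
  move=> s1; apply: le_trans hM; rewrite (le_trans (ler_normD _ _))// lerD//.
    by rewrite normrM normrN normfV (gtr0_norm f0).
  rewrite normrM [`|3 * e / f|]ger0_norm ?divr_ge0 ?mulr_ge0 ?(ltW e0) ?(ltW f0)//.
  by rewrite ler_piMl// divr_ge0 ?mulr_ge0 ?(ltW e0) ?(ltW f0).
have val s : `|s| <= 1 -> K' (x0 + a * (- b / f + s * (3 * e / f))) - u <= a * e * (3 * s + 2) /\
    a * e * (3 * s - 2) <= K' (x0 + a * (- b / f + s * (3 * e / f))) - u.
  move=> /bM tM; have := h _ tM; have := h' _ tM; set t := - b / f + _.
  have -> : a * f * t = a * (- b + 3 * s * e) by rewrite /t; field; exact: lt0r_neq0.
  rewrite !ler_norml => /andP[h1 h2] /andP[h3 h4]; split; lra.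
have ae : 0 < a * e by rewrite mulr_gt0.
have lo : K' (x0 + a * (- b / f + (- 1) * (3 * e / f))) < u.
  by have [|] := val (-1); [rewrite normrN normr1|lra].
have up : u <= K' (x0 + a * (- b / f + 1 * (3 * e / f))).
  by have [|] := val 1; [rewrite normr1|lra].
have /andP[l1 l2] := quantile_bounds hK' lo up.
have -> : 3 * e * a / f = a * (3 * e / f) by ring.
have -> : a * b / f = - (a * (- b / f)) by ring.
rewrite ler_norml; apply/andP; split; lra.
Qed.

(* One coordinate of the delta method, uniformly in the data: the constant [del]
   depends on [F] only through the Lipschitz bounds and the modulus [rho]. *)
Lemma quantile_delta (F f : R -> R) (A1 B1 m L rho0 : R) :
  0 < m -> m <= 1 -> 0 < L -> 0 < rho0 ->
  (forall s s', A1 <= s -> s <= s' -> s' <= B1 ->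
     m * (s' - s) <= F s' - F s <= L * (s' - s)) ->
  (forall x, A1 <= x <= B1 -> m <= f x) ->
  (forall eta : R, 0 < eta -> exists2 rho : R, 0 < rho & forall x s s',
     A1 <= x <= B1 -> A1 <= s <= B1 -> A1 <= s' <= B1 ->
     `|s - x| <= rho -> `|s' - x| <= rho ->
     `|F s' - F s - f x * (s' - s)| <= eta * `|s' - s|) ->
  forall e B : R, 0 < e -> 0 <= B -> let M := (B + 3) / m in
  exists2 del : R, 0 < del & forall (a : R) (K K' beta : R -> R) (u x : R), 0 < a -> a <= del ->
    {homo K : s s' / s <= s'} -> {homo K' : s s' / s <= s'} ->
    A1 <= x - rho0 -> x + rho0 <= B1 -> F x = u ->
    (forall s, A1 <= s <= B1 -> `|K s - F s| <= del) ->
    (forall s s', A1 <= s <= B1 -> A1 <= s' <= B1 -> `|s - s'| <= M * a ->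
       `|(K s' - F s') - (K s - F s)| <= del * a) ->
    (forall s, A1 <= s <= B1 -> `|K' s - K s - a * beta s| <= del * a) ->
    `|beta x| <= B -> (forall s, A1 <= s <= B1 -> (beta s - beta x) ^+ 2 <= B * `|s - x|) ->
    [/\ `|quantile K u - x| <= e, `|quantile K' u - x| <= e,
        (A1 <= quantile K u <= B1) /\ (A1 <= quantile K' u <= B1),
        `|quantile K' u - quantile K u| <= M * a
      & `|quantile K' u - quantile K u + a * beta x / f x| <= e * a].
Proof.
move=> m0 m1 L0 rho00 hF fm hd e B e0 B0 M.
pose e' := Num.min 1 e; have e'0 : 0 < e' by rewrite lt_min ltr01.
have e'1 : e' <= 1 by rewrite ge_min lexx.
have e'e : e' <= e by rewrite ge_min lexx orbT.
have [e1 e10 e1E] : exists2 e1 : R, 0 < e1 & 3 * e1 = e' * m.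
  by exists (e' * m / 3); [rewrite !mulr_gt0 ?invr_gt0|field].
have ME : M = B / m + 3 / m by rewrite /M mulrDl.
have Bm : 0 <= B / m by rewrite divr_ge0// ltW.
have m3 : 3 <= 3 / m by rewrite ler_pdivlMr//; lra.
clearbody M e'.
have M0 : 0 < M by lra.
have M1 : 1 <= M by lra.
have eta0 : 0 < e1 / (2 * M) by rewrite divr_gt0// mulr_gt0.
have [rho rho_gt0 hrho] := hd _ eta0.
(* [del * c0] dominates [2 del / m + del * M], the distance from [x] within which all points
   considered below lie. *)
pose c0 := 2 / m + M + 1.
have c00 : 0 < c0 by rewrite /c0 addr_gt0// addr_gt0// divr_gt0.
have [|del del0 /and5P[d1 d2 d3 d4 /andP[d5 _]]] := @exists_lower_bound R
  [:: e1 / 6; rho / c0; rho0 / c0; e1 ^+ 2 / (4 * (B + 1) * c0); e / c0].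
  rewrite /= !divr_gt0 ?exprn_gt0 ?mulr_gt0//; lra.
exists del => // a K K' beta u x a0 ad hK hK' Ax xB Fx kF osc hk' bx bmod.
have xI : A1 <= x <= B1.
  by rewrite (le_trans Ax) ?(le_trans _ xB)// ?lerDl ?lerBlDr ?lerDl ltW.
(* Over the distance [D = 2 del / m] the function [F] moves by at least [2 del], more than its
   distance to [K]; hence the quantile of [K] is within [D] of [x]. *)
have [D D0 [mD dr dr0 dB de]] : exists2 D : R, 0 < D & [/\ m * D = 2 * del,
    D + del * M <= rho, D + del * M <= rho0, (D + del * M) * (B + 1) <= (e1 / 2) ^+ 2
    & D + del * M <= e].
  have le1 : 2 * del / m + del * M <= del * c0.
    by rewrite (_ : del * c0 = 2 * del / m + del * M + del) ?lerDl ?ltW// /c0; ring.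
  exists (2 * del / m); first by rewrite divr_gt0 ?mulr_gt0.
  have B1' : 0 < B + 1 by rewrite ltr_wpDl.
  split; first by field; exact: lt0r_neq0.
  - by rewrite (le_trans le1)// -ler_pdivlMr.
  - by rewrite (le_trans le1)// -ler_pdivlMr.
  - rewrite (le_trans (ler_wpM2r (ltW B1') le1))//.
    move: d4; rewrite ler_pdivlMr ?mulr_gt0// => h; rewrite expr_div_n; move: h.
    by clear; lra.
  - by rewrite (le_trans le1)// -ler_pdivlMr.
clear d2 d3 d4 d5 c0 c00 m3.
have [E E0 EE] : exists2 E : R, 0 < E & E = del * M by exists (del * M) => //; rewrite mulr_gt0.
rewrite -EE in dr dr0 dB de.
have aM : a * M <= E by rewrite EE ler_wpM2r// ltW.
clear EE.
have near s : `|s - x| <= D + E -> A1 <= s <= B1.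
  rewrite ler_norml => /andP[h1 h2]; move: Ax xB dr0 h1 h2; clear => *; apply/andP; split; lra.
have lo1 : K (x - D) < u.
  have sI : A1 <= x - D <= B1.
    by apply: near; rewrite addrAC subrr add0r normrN gtr0_norm// lerDl ltW.
  have := kF _ sI; rewrite ler_norml => /andP[_ h1].
  have /andP[A1s sB1] := sI; have /andP[Ax' xB'] := xI.
  have le1 : x - D <= x by rewrite lerBlDr lerDl ltW.
  have /andP[+ _] := hF _ _ A1s le1 xB'.
  rewrite opprB addrCA subrr addr0 mD; move: h1 Fx del0; clear; lra.
have up1 : u <= K (x + D).
  have sI : A1 <= x + D <= B1.
    by apply: near; rewrite addrAC subrr add0r gtr0_norm// lerDl ltW.
  have := kF _ sI; rewrite ler_norml => /andP[h1 _].
  have /andP[A1s sB1] := sI; have /andP[Ax' xB'] := xI.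
  have le1 : x <= x + D by rewrite lerDl ltW.
  have /andP[+ _] := hF _ _ Ax' le1 sB1.
  rewrite addrAC subrr add0r mD; move: h1 Fx del0; clear; lra.
have /andP[q1 q2] := quantile_bounds hK lo1 up1.
set xm := quantile K u in q1 q2 *.
have xmx : `|xm - x| <= D by rewrite ler_distl q1 q2.
have xmI : A1 <= xm <= B1 by apply: near; rewrite (le_trans xmx)// lerDl ltW.
have nearM t : `|t| <= M -> `|xm + a * t - x| <= D + E.
  move=> tM; rewrite addrAC (le_trans (ler_normD _ _))// lerD//.
  by rewrite normrM gtr0_norm// (le_trans _ aM)// ler_wpM2l// ltW.
have nearI t : `|t| <= M -> A1 <= xm + a * t <= B1.
  by move=> /nearM h; apply: near.
(* [K] may jump at its quantile. Its values at [xm - eta] and [xm + eta] bracket [u], and the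
   oscillation of [K - F] bounds the overshoot by [2 del a]. *)
have Kxm : `|K xm - u| <= 2 * del * a.
  pose eta := a * Num.min 1 (del / L).
  have et0 : 0 < eta by rewrite mulr_gt0// lt_min ltr01 divr_gt0.
  have etM : eta <= M * a.
    rewrite /eta mulrC ler_wpM2r ?(ltW a0)//; apply: le_trans M1.
    by rewrite ge_min lexx.
  have etL : L * eta <= del * a.
    rewrite /eta mulrCA mulrC ler_wpM2r ?(ltW a0)// -ler_pdivlMl//.
    by rewrite ge_min mulrC lexx orbT.
  have etad : eta <= E by move: etM aM; clear; lra.
  have pI : A1 <= xm + eta <= B1.
    by apply: near; rewrite addrAC (le_trans (ler_normD _ _))// (gtr0_norm et0); move: xmx etad; clear; lra.
  have nI : A1 <= xm - eta <= B1.
    by apply: near; rewrite addrAC (le_trans (ler_normB _ _))// (gtr0_norm et0); move: xmx etad; clear; lra.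
  have h1 : u <= K (xm + eta) by apply: (quantile_gt hK lo1 up1); rewrite -/xm ?ltrDl ?ltrBlDr ?ltrDl.
  have h2 : K (xm - eta) < u by apply: (quantile_lt hK lo1); rewrite -/xm ?ltrDl ?ltrBlDr ?ltrDl.
  have o1 := osc _ _ xmI pI; have o2 := osc _ _ nI xmI.
  have /andP[xm1 xm2] := xmI; have /andP[p1 p2] := pI; have /andP[n1 n2] := nI.
  have le1 : xm <= xm + eta by rewrite lerDl ltW.
  have le2 : xm - eta <= xm by rewrite lerBlDr lerDl ltW.
  have /andP[_ f1] := hF _ _ xm1 le1 p2.
  have /andP[_ f2] := hF _ _ n1 le2 xm2.
  have d1' : `|xm - (xm + eta)| <= M * a.
    by rewrite opprD addrA subrr add0r normrN gtr0_norm.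
  have d2' : `|xm - eta - xm| <= M * a.
    by rewrite addrAC subrr add0r normrN gtr0_norm.
  move: (o1 d1') (o2 d2'); rewrite !ler_norml => /andP[r11 r12] /andP[r21 r22].
  move: f1 f2; rewrite (_ : xm + eta - xm = eta); last by ring.
  rewrite (_ : xm - (xm - eta) = eta); last by ring.
  move=> f1 f2; clear -f1 f2 r11 r12 r21 r22 h1 h2 etL; apply/andP; split; lra.
have fx0 : 0 < f x by apply: (lt_le_trans m0); exact: fm.
(* [K] is expanded around its own quantile [xm] with the slope [f x] of the true one, so [K - F]
   enters through its oscillation over distances [M a]. *)
have hlin t : `|t| <= M -> `|K (xm + a * t) - u - a * f x * t| <= e1 * a.
  move=> tM; have sI := nearI _ tM; have sx := nearM _ tM.
  have atM : `|a * t| <= M * a by rewrite normrM gtr0_norm// mulrC ler_wpM2r// ltW.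
  have o1 : `|(K (xm + a * t) - F (xm + a * t)) - (K xm - F xm)| <= del * a.
    by apply: osc => //; rewrite opprD addrA subrr add0r normrN.
  have r1 : `|xm - x| <= rho by rewrite (le_trans xmx)// (le_trans _ dr)// lerDl ltW.
  have r2 : `|xm + a * t - x| <= rho by exact: le_trans sx dr.
  have := hrho _ _ _ xI xmI sI r1 r2; rewrite (_ : xm + a * t - xm = a * t); last by ring.
  move=> h2; have h3 : e1 / (2 * M) * `|a * t| <= e1 / 2 * a.
    rewrite (_ : e1 / 2 * a = e1 / (2 * M) * (M * a)); last by field; exact: lt0r_neq0.
    by rewrite ler_wpM2l// ltW.
  have -> : K (xm + a * t) - u - a * f x * t =
    ((K (xm + a * t) - F (xm + a * t)) - (K xm - F xm)) +
    (F (xm + a * t) - F xm - f x * (a * t)) + (K xm - u) by ring.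
  rewrite (le_trans (ler_normD _ _))// (le_trans (lerD (ler_normD _ _) (lexx _)))//.
  have : del * a <= e1 / 6 * a by rewrite ler_wpM2r// ltW.
  move: h2 h3 o1 Kxm; clear; lra.
(* The square-root modulus of [beta] allows [beta s] to be replaced by [beta x]. *)
have hboot t : `|t| <= M -> `|K' (xm + a * t) - K (xm + a * t) - a * beta x| <= e1 * a.
  move=> tM; have sI := nearI _ tM; have sx := nearM _ tM; set s := xm + a * t in sI sx *.
  have bs : `|beta s - beta x| <= e1 / 2.
    rewrite -(@ler_pXn2r _ 2)// ?nnegrE ?divr_ge0 ?(ltW e10)// real_normK ?num_real//.
    rewrite (le_trans (bmod _ sI))// (le_trans _ dB)// mulrC ler_pM//; by rewrite lerDl ler01.
  have -> : K' s - K s - a * beta x = (K' s - K s - a * beta s) + a * (beta s - beta x) by ring.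
  rewrite (le_trans (ler_normD _ _))// (le_trans (lerD (hk' _ sI) (lexx _)))//.
  rewrite normrM (gtr0_norm a0).
  have : del * a <= e1 / 6 * a by rewrite ler_wpM2r// ltW.
  have : a * `|beta s - beta x| <= a * (e1 / 2) by rewrite ler_wpM2l// ltW.
  have : 0 < a * e1 by rewrite mulr_gt0.
  clear; lra.
have bf : `|beta x| / f x <= B / m.
  by rewrite ler_pM ?invr_ge0 ?(ltW fx0)// lef_pV2//; exact: fm.
have ef : 3 * e1 / f x <= e'.
  rewrite e1E -mulrA.
  by rewrite ler_piMr ?(ltW e'0)// ler_pdivrMr// mul1r; exact: fm.
have m3 : 3 <= 3 / m by rewrite ler_pdivlMr//; move: m1; clear; lra.
have hM : `|beta x| / f x + 3 * e1 / f x <= M by move: bf ef ME e'1 m3; clear; lra.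
have main := quantile_linearization hK' a0 fx0 e10 hM hlin hboot.
have main' : `|quantile K' u - xm + a * beta x / f x| <= e' * a.
  rewrite (le_trans main)// (_ : 3 * e1 * a / f x = 3 * e1 / f x * a); last by ring.
  by rewrite ler_wpM2r// ltW.
have e'a : e' * a <= a by rewrite ler_piMl// ltW.
have abf : `|a * beta x / f x| <= a * (B / m).
  by rewrite -mulrA normrM gtr0_norm// normrM normfV (gtr0_norm fx0) ler_wpM2l// ltW.
have xx' : `|quantile K' u - xm| <= M * a.
  rewrite -[X in `|X|](addrK (a * beta x / f x)) (le_trans (ler_normB _ _))//.
  rewrite (le_trans (lerD main' abf))// ME.
  have : 3 * a <= 3 / m * a by rewrite ler_wpM2r// ltW.
  move: e'a a0; clear; lra.
have xx : `|quantile K' u - x| <= D + E.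
  rewrite (_ : quantile K' u - x = (xm - x) + (quantile K' u - xm)); last by ring.
  rewrite (le_trans (ler_normD _ _))// lerD//.
  by rewrite (le_trans xx')// mulrC.
split=> //.
- by rewrite (le_trans xmx)// (le_trans _ de)// lerDl ltW.
- exact: le_trans xx de.
- by split=> //; exact: near.
- by rewrite (le_trans main')// ler_wpM2r// ltW.
Qed.

End quantile_perturbation.

Section copula_delta.
Context {R : realType}.

(** The last clause is strict differentiability, uniform on the segment: neither [s] nor [s'] is the
    base point [x], because the sample quantile and the bootstrap quantile both move. *)
Definition smooth_df (F f : R -> R) (A1 B1 m L : R) : Prop :=
  [/\ forall s s', A1 <= s -> s <= s' -> s' <= B1 ->
        m * (s' - s) <= F s' - F s <= L * (s' - s),
      forall x, A1 <= x <= B1 -> m <= f x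
    & forall eta : R, 0 < eta -> exists2 rho : R, 0 < rho & forall x s s',
        A1 <= x <= B1 -> A1 <= s <= B1 -> A1 <= s' <= B1 ->
        `|s - x| <= rho -> `|s' - x| <= rho ->
        `|F s' - F s - f x * (s' - s)| <= eta * `|s' - s|].

Definition smooth_df2 (H Hx Hy : R -> R -> R) (A1 B1 A2 B2 L : R) : Prop :=
  [/\ forall x y, A1 <= x <= B1 -> A2 <= y <= B2 -> `|Hx x y| <= L,
      forall x y, A1 <= x <= B1 -> A2 <= y <= B2 -> `|Hy x y| <= L
    & forall eta : R, 0 < eta -> exists2 rho : R, 0 < rho & forall x y s s' t t',
        A1 <= x <= B1 -> A1 <= s <= B1 -> A1 <= s' <= B1 ->
        A2 <= y <= B2 -> A2 <= t <= B2 -> A2 <= t' <= B2 ->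
        `|s - x| <= rho -> `|s' - x| <= rho -> `|t - y| <= rho -> `|t' - y| <= rho ->
        `|H s' t' - H s t - Hx x y * (s' - s) - Hy x y * (t' - t)| <=
          eta * (`|s' - s| + `|t' - t|)].

(** The difference is split into the bootstrap increment at the new quantiles, the shift of its
    argument to [(x, y)], the oscillation of [K - H], the linearization of [H], and the two marginal
    quantile errors multiplied by the partial derivatives of [H]. *)
Lemma copula_delta (F f G g : R -> R) (H Hx Hy : R -> R -> R) (A1 B1 A2 B2 m L rho0 : R) :
  0 < m -> m <= 1 -> 0 < L -> 0 < rho0 ->
  smooth_df F f A1 B1 m L -> smooth_df G g A2 B2 m L ->
  smooth_df2 H Hx Hy A1 B1 A2 B2 L ->
  forall e B : R, 0 < e -> 0 <= B -> let M := (B + 3) / m in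
  exists2 del : R, 0 < del &
  forall (a : R) (K K' : R -> R -> R) (K1 K1' K2 K2' : R -> R)
    (beta : R -> R -> R) (beta1 beta2 : R -> R) (u v x y : R), 0 < a -> a <= del ->
    {homo K1 : s s' / s <= s'} -> {homo K1' : s s' / s <= s'} ->
    {homo K2 : s s' / s <= s'} -> {homo K2' : s s' / s <= s'} ->
    A1 <= x - rho0 -> x + rho0 <= B1 -> F x = u ->
    A2 <= y - rho0 -> y + rho0 <= B2 -> G y = v ->
    (forall s, A1 <= s <= B1 -> `|K1 s - F s| <= del) ->
    (forall s, A2 <= s <= B2 -> `|K2 s - G s| <= del) ->
    (forall s s', A1 <= s <= B1 -> A1 <= s' <= B1 -> `|s - s'| <= M * a ->
       `|(K1 s' - F s') - (K1 s - F s)| <= del * a) ->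
    (forall s s', A2 <= s <= B2 -> A2 <= s' <= B2 -> `|s - s'| <= M * a ->
       `|(K2 s' - G s') - (K2 s - G s)| <= del * a) ->
    (forall s s' t t', A1 <= s <= B1 -> A1 <= s' <= B1 -> A2 <= t <= B2 -> A2 <= t' <= B2 ->
       `|s - s'| <= M * a -> `|t - t'| <= M * a ->
       `|(K s' t' - H s' t') - (K s t - H s t)| <= del * a) ->
    (forall s, A1 <= s <= B1 -> `|K1' s - K1 s - a * beta1 s| <= del * a) ->
    (forall s, A2 <= s <= B2 -> `|K2' s - K2 s - a * beta2 s| <= del * a) ->
    (forall s t, A1 <= s <= B1 -> A2 <= t <= B2 ->
       `|K' s t - K s t - a * beta s t| <= del * a) ->
    `|beta1 x| <= B -> `|beta2 y| <= B ->
    (forall s, A1 <= s <= B1 -> (beta1 s - beta1 x) ^+ 2 <= B * `|s - x|) ->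
    (forall s, A2 <= s <= B2 -> (beta2 s - beta2 y) ^+ 2 <= B * `|s - y|) ->
    (forall s t, A1 <= s <= B1 -> A2 <= t <= B2 ->
       (beta s t - beta x y) ^+ 2 <= B * (`|s - x| + `|t - y|)) ->
    `|K' (quantile K1' u) (quantile K2' v) - K (quantile K1 u) (quantile K2 v) -
       a * (beta x y - Hx x y * (beta1 x / f x) - Hy x y * (beta2 y / g y))| <= e * a.
Proof.
move=> m0 m1 L0 rho00 [F1 F2 F3] [G1 G2 G3] [Hx1 Hy1 H3] e B e0 B0 M.
have M0 : 0 < M by rewrite /M divr_gt0//; lra.
have eta0 : 0 < e / (16 * M) by rewrite divr_gt0// mulr_gt0.
have [rho rho_gt0 hrho] := H3 _ eta0.
have [|e1 e10 /and4P[er eL eB _]] := @exists_lower_bound R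
  [:: rho; e / (16 * L); (e / 4) ^+ 2 / (2 * (B + 1))].
  by rewrite /= rho_gt0 !divr_gt0 ?exprn_gt0 ?mulr_gt0 ?divr_gt0// ltr_wpDl.
have [d1 d10 h1] := quantile_delta m0 m1 L0 rho00 F1 F2 F3 e10 B0.
have [d2 d20 h2] := quantile_delta m0 m1 L0 rho00 G1 G2 G3 e10 B0.
have [|del del0 /and4P[dd1 dd2 de _]] := @exists_lower_bound R [:: d1; d2; e / 8].
  by rewrite /= d10 d20 divr_gt0.
exists del => // a K K' K1 K1' K2 K2' beta beta1 beta2 u v x y a0 ad hK1 hK1' hK2 hK2'.
move=> Ax xB Fx Ay yB Gy c1 c2 osc1 osc2 osc b1 b2 b bx b_y bm1 bm2 bm.
have w1 : del * a <= d1 * a by rewrite ler_wpM2r// ltW.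
have w2 : del * a <= d2 * a by rewrite ler_wpM2r// ltW.
have {h1} := h1 a K1 K1' beta1 u x a0 (le_trans ad dd1) hK1 hK1' Ax xB Fx
  (fun s h => le_trans (c1 s h) dd1)
  (fun s s' h h' h'' => le_trans (osc1 s s' h h' h'') w1)
  (fun s h => le_trans (b1 s h) w1) bx bm1.
have {h2} := h2 a K2 K2' beta2 v y a0 (le_trans ad dd2) hK2 hK2' Ay yB Gy
  (fun s h => le_trans (c2 s h) dd2)
  (fun s s' h h' h'' => le_trans (osc2 s s' h h' h'') w2)
  (fun s h => le_trans (b2 s h) w2) b_y bm2.
set ym := quantile K2 v; set yn := quantile K2' v.
set xm := quantile K1 u; set xn := quantile K1' u.
move=> [y1 y2 [y3 y4] y5 y6] [x1 x2 [x3 x4] x5 x6].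
have xI : A1 <= x <= B1.
  by rewrite (le_trans Ax) ?(le_trans _ xB)// ?lerDl ?lerBlDr ?lerDl ltW.
have yI : A2 <= y <= B2.
  by rewrite (le_trans Ay) ?(le_trans _ yB)// ?lerDl ?lerBlDr ?lerDl ltW.
have p1 := b _ _ x4 y4.
have p2 : `|a * (beta xn yn - beta x y)| <= e / 4 * a.
  rewrite normrM gtr0_norm// mulrC ler_wpM2r ?(ltW a0)//.
  have e4 : 0 < e / 4 by rewrite divr_gt0.
  rewrite -(@ler_pXn2r _ 2)// ?nnegrE ?(ltW e4)// real_normK ?num_real//.
  rewrite (le_trans (bm _ _ x4 y4))//.
  move: eB; rewrite ler_pdivlMr ?mulr_gt0 ?ltr_wpDl// => /(le_trans _); apply.
  rewrite (_ : e1 * _ = (B + 1) * (2 * e1)); last by ring.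
  apply: ler_pM => //.
  - by rewrite lerDl.
  - by move: x2 y2; clear; lra.
have p3 : `|(K xn yn - H xn yn) - (K xm ym - H xm ym)| <= del * a.
  by apply: osc => //; rewrite distrC.
have p4 : `|H xn yn - H xm ym - Hx x y * (xn - xm) - Hy x y * (yn - ym)| <= e / 8 * a.
  apply: le_trans (hrho _ _ _ _ _ _ xI x3 x4 yI y3 y4 _ _ _ _) _.
  - exact: le_trans x1 er.
  - exact: le_trans x2 er.
  - exact: le_trans y1 er.
  - exact: le_trans y2 er.
  rewrite (_ : e / 8 * a = e / (16 * M) * (M * a + M * a)); last by field; exact: lt0r_neq0.
  by rewrite ler_wpM2l ?(ltW eta0)// lerD.
have p5 : `|Hx x y * (xn - xm + a * beta1 x / f x)| <= e / 16 * a.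
  rewrite normrM (_ : e / 16 * a = L * (e / (16 * L) * a)); last by field; exact: lt0r_neq0.
  by rewrite ler_pM ?Hx1// (le_trans x6)// ler_wpM2r ?(ltW a0).
have p6 : `|Hy x y * (yn - ym + a * beta2 y / g y)| <= e / 16 * a.
  rewrite normrM (_ : e / 16 * a = L * (e / (16 * L) * a)); last by field; exact: lt0r_neq0.
  by rewrite ler_pM ?Hy1// (le_trans y6)// ler_wpM2r ?(ltW a0).
have -> : K' xn yn - K xm ym - a * (beta x y - Hx x y * (beta1 x / f x) - Hy x y * (beta2 y / g y)) =
  (K' xn yn - K xn yn - a * beta xn yn) + (a * (beta xn yn - beta x y)) +
  ((K xn yn - H xn yn) - (K xm ym - H xm ym)) +
  (H xn yn - H xm ym - Hx x y * (xn - xm) - Hy x y * (yn - ym)) +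
  (Hx x y * (xn - xm + a * beta1 x / f x)) + (Hy x y * (yn - ym + a * beta2 y / g y)) by ring.
have w3 : del * a <= e / 8 * a by rewrite ler_wpM2r// ltW.
have ea : 0 < e * a by rewrite mulr_gt0.
move: p1 p2 p3 p4 p5 p6 w3 ea.
set t1 := K' xn yn - _ - _; set t2 := a * (_ - _); set t3 := _ - (K _ _ - _).
set t4 := _ - _ - Hx x y * _ - _; set t5 := Hx x y * _; set t6 := Hy x y * _.
clearbody t1 t2 t3 t4 t5 t6; clear.
rewrite !ler_norml => /andP[? ?] /andP[? ?] /andP[? ?] /andP[? ?] /andP[? ?] /andP[? ?] ? ?.
apply/andP; split; lra.
Qed.

End copula_delta.

(** * Dyadic grids and chaining *)

Section dyadic_chaining.
Context {R : realType}.

Definition grid (lo len : R) (j i : nat) : R := lo + len * (i%:R / 2 ^+ j).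

Lemma grid_double lo len j i : grid lo len j.+1 i.*2 = grid lo len j i.
Proof.
rewrite /grid -muln2 natrM exprS; congr (_ + _ * _).
by rewrite invfM -mulrA [2 * _]mulrA mulfV ?mul1r// pnatr_eq0.
Qed.

Lemma grid_le lo len j i i' : 0 <= len -> (i <= i')%N ->
  grid lo len j i <= grid lo len j i'.
Proof.
by move=> l0 ii'; rewrite lerD2l ler_wpM2l// ler_wpM2r ?invr_ge0 ?exprn_ge0// ler_nat.
Qed.

Lemma grid0 lo len j : grid lo len j 0 = lo.
Proof. by rewrite /grid mul0r mulr0 addr0. Qed.

Lemma grid_last lo len j : grid lo len j (2 ^ j) = lo + len.
Proof. by rewrite /grid natrX mulfV ?mulr1// expf_neq0. Qed.

Lemma gridB lo len j i i' :
  grid lo len j i' - grid lo len j i = len / 2 ^+ j * (i'%:R - i%:R).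
Proof. by rewrite /grid; ring. Qed.

Lemma grid_locate lo len j s : 0 < len -> lo <= s <= lo + len ->
  exists2 i, (i < 2 ^ j)%N & grid lo len j i <= s <= grid lo len j i.+1.
Proof.
move=> l0 /andP[s1 s2].
have [->|sne] := eqVneq s (lo + len).
  exists (2 ^ j).-1; first by rewrite prednK// expn_gt0.
  rewrite prednK ?expn_gt0// -(grid_last lo len j) lexx andbT.
  by apply: grid_le; [exact: ltW|exact: leq_pred].
have {sne}s2 : s < lo + len by rewrite lt_neqAle sne.
pose x := (s - lo) / len * 2 ^+ j.
have x0 : 0 <= x by rewrite mulr_ge0 ?exprn_ge0// divr_ge0 ?subr_ge0// ltW.
have p2 : 0 < 2 ^+ j :> R by rewrite exprn_gt0.
have sE : s = lo + len * (x / 2 ^+ j).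
  by rewrite /x; field; rewrite !gt_eqF.
have /andP[x1 x2] := truncn_itv x0.
exists (Num.truncn x).
  rewrite truncn_lt_nat// natrX /x -[ltRHS]mul1r ltr_pM2r// ltr_pdivrMr// mul1r.
  by rewrite ltrBlDl.
clearbody x; rewrite sE /grid !lerD2l !ler_pM2l// !ler_pM2r ?invr_gt0//.
by rewrite x1 ltW.
Qed.

(** Passing from level [j + 1] to level [j] halves both indices. An odd index is first moved to its
    even neighbour, at the price of one step in that coordinate, hence the factor 2. *)
Lemma dyadic_chain (hh : nat -> nat -> nat -> R) (dl : nat -> R) (J0 n : nat) :
  (forall j i l, hh j.+1 i.*2 l.*2 = hh j i l) ->
  (forall j i l, (J0 < j <= J0 + n)%N -> (i < 2 ^ j)%N -> (l <= 2 ^ j)%N ->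
     `|hh j i.+1 l - hh j i l| <= dl j) ->
  (forall j i l, (J0 < j <= J0 + n)%N -> (i <= 2 ^ j)%N -> (l < 2 ^ j)%N ->
     `|hh j i l.+1 - hh j i l| <= dl j) ->
  forall i l, (i <= 2 ^ (J0 + n))%N -> (l <= 2 ^ (J0 + n))%N ->
  `|hh (J0 + n)%N i l - hh J0 (i %/ 2 ^ n)%N (l %/ 2 ^ n)%N| <=
  2 * \sum_(k < n) dl (J0 + k).+1.
Proof.
move=> dbl; elim: n => [|n IH] st1 st2 i l hi hl.
  by rewrite addn0 !divn1 subrr normr0 big_ord0 mulr0.
have hi2 : (i./2 <= 2 ^ (J0 + n))%N.
  by rewrite leq_half_double (leq_trans hi)// addnS expnS mul2n.
have hl2 : (l./2 <= 2 ^ (J0 + n))%N.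
  by rewrite leq_half_double (leq_trans hl)// addnS expnS mul2n.
have J1 : (J0 < (J0 + n).+1 <= J0 + n.+1)%N by rewrite addnS leqnn ltnS leq_addr.
have step : `|hh (J0 + n).+1 i l - hh (J0 + n)%N i./2 l./2| <= 2 * dl (J0 + n).+1.
  have a1 : `|hh (J0 + n).+1 i l - hh (J0 + n).+1 i./2.*2 l| <= dl (J0 + n).+1.
    have d0 : 0 <= dl (J0 + n).+1.
      have := st1 (J0 + n).+1 0%N 0%N J1; rewrite expn_gt0 => /(_ isT isT).
      exact: le_trans.
    have := odd_double_half i; case: (odd i) => iE; last first.
      by rewrite -{1}iE add0n subrr normr0.
    rewrite -{1}iE add1n; apply: st1 => //; last by rewrite -addnS.
    by move: hi; rewrite -{1}iE add1n addnS.
  have a2 : `|hh (J0 + n).+1 i./2.*2 l - hh (J0 + n).+1 i./2.*2 l./2.*2| <= dl (J0 + n).+1.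
    have hi' : (i./2.*2 <= 2 ^ (J0 + n).+1)%N by rewrite expnS mul2n leq_double.
    have d0 : 0 <= dl (J0 + n).+1.
      have := st1 (J0 + n).+1 0%N 0%N J1; rewrite expn_gt0 => /(_ isT isT).
      exact: le_trans.
    have := odd_double_half l; case: (odd l) => lE; last first.
      by rewrite -{1}lE add0n subrr normr0.
    rewrite -{1}lE add1n; apply: st2 => //.
    by move: hl; rewrite -{1}lE add1n addnS.
  rewrite -(dbl (J0 + n)%N) -[X in `|X|](subrKA (hh (J0 + n).+1 i./2.*2 l)).
  rewrite (le_trans (ler_normD _ _))//; move: a1 a2; clear; lra.
have {}IH : `|hh (J0 + n)%N i./2 l./2 - hh J0 (i./2 %/ 2 ^ n)%N (l./2 %/ 2 ^ n)%N| <=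
    2 * \sum_(k < n) dl (J0 + k).+1.
  apply: IH => // j i' l' /andP[j1 j2]; [apply: st1|apply: st2];
    by rewrite j1 addnS (leq_trans j2).
rewrite addnS !expnS !divnMA !divn2 big_ord_recr/=.
rewrite -[X in `|X|](subrKA (hh (J0 + n)%N i./2 l./2)) (le_trans (ler_normD _ _))//.
by rewrite mulrDr addrC lerD.
Qed.

(** Both functions are squeezed between their corner values; what is lost is the diagonal increment
    of the difference plus that of [K]. *)
Lemma monotone_residual (K K' : R -> R -> R) (p p' q q' s t : R) :
  (forall s s' t t', s <= s' -> t <= t' -> K s t <= K s' t') ->
  (forall s s' t t', s <= s' -> t <= t' -> K' s t <= K' s' t') ->
  p <= s <= p' -> q <= t <= q' ->
  `|(K' s t - K s t) - (K' p q - K p q)| <=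
  `|(K' p' q' - K p' q') - (K' p q - K p q)| + (K p' q' - K p q).
Proof.
move=> hK hK' /andP[s1 s2] /andP[t1 t2].
have := hK _ _ _ _ s1 t1; have := hK _ _ _ _ s2 t2.
have := hK' _ _ _ _ s1 t1; have := hK' _ _ _ _ s2 t2.
have := ler_norm ((K' p' q' - K p' q') - (K' p q - K p q)).
set N := `|_ - (K' p q - _)|; have : 0 <= N by exact: normr_ge0.
by move=> *; rewrite ler_norml; apply/andP; split; lra.
Qed.

End dyadic_chaining.

Section dyadic_control.
Context {R : realType}.
Variables (lo1 len1 lo2 len2 : R).
Hypotheses (len1_gt0 : 0 < len1) (len2_gt0 : 0 < len2).
Local Notation p := (grid lo1 len1).
Local Notation q := (grid lo2 len2).

Definition in_box (s t : R) : Prop := lo1 <= s <= lo1 + len1 /\ lo2 <= t <= lo2 + len2.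

Definition monotone2 (K : R -> R -> R) : Prop :=
  forall s s' t t', s <= s' -> t <= t' -> K s t <= K s' t'.

Definition grid_steps_le (h : R -> R -> R) (j : nat) (del : R) : Prop :=
  (forall i l, (i < 2 ^ j)%N -> (l <= 2 ^ j)%N ->
     `|h (p j i.+1) (q j l) - h (p j i) (q j l)| <= del) /\
  (forall i l, (i <= 2 ^ j)%N -> (l < 2 ^ j)%N ->
     `|h (p j i) (q j l.+1) - h (p j i) (q j l)| <= del).

Lemma step_sum (f : nat -> R) (th : R) (N : nat) :
  (forall i, (i < N)%N -> `|f i.+1 - f i| <= th) ->
  forall i i', (i <= i')%N -> (i' <= N)%N -> `|f i' - f i| <= (i'%:R - i%:R) * th.
Proof.
move=> st i i'; elim: i' => [|i' IH].
  by rewrite leqn0 => /eqP -> _; rewrite !subrr normr0 mul0r.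
rewrite leq_eqVlt => /orP[/eqP <- _|]; first by rewrite !subrr normr0 mul0r.
rewrite ltnS => ii' iN.
rewrite -[X in `|X|](subrKA (f i')) (le_trans (ler_normD _ _))//.
rewrite -natr1 (_ : (i'%:R + 1 - i%:R) * th = th + (i'%:R - i%:R) * th); last by ring.
by rewrite lerD ?st ?IH// ltnW.
Qed.

Lemma grid_coarsen lo len (J0 n m : nat) :
  grid lo len (J0 + n) (m * 2 ^ n) = grid lo len J0 m :> R.
Proof.
elim: n m => [|n IH] m; first by rewrite addn0 muln1.
by rewrite addnS expnS mulnCA mul2n grid_double IH.
Qed.

(** Inside a mesh of the finest level monotonicity costs [w + 2 * dl (J0 + n)]; from there
    [dyadic_chain] leads to the coarse level [J0]. *)
Lemma grid_uniform_control (K K' : R -> R -> R) (dl : nat -> R) (w : R) (J0 n : nat) :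
  monotone2 K -> monotone2 K' -> (0 < n)%N ->
  (forall j, (J0 < j <= J0 + n)%N -> grid_steps_le (fun s t => K' s t - K s t) j (dl j)) ->
  (forall i l, (i < 2 ^ (J0 + n))%N -> (l < 2 ^ (J0 + n))%N ->
     K (p (J0 + n) i.+1) (q (J0 + n) l.+1) - K (p (J0 + n) i) (q (J0 + n) l) <= w) ->
  forall s t, in_box s t -> exists i l, [/\ (i < 2 ^ J0)%N, (l < 2 ^ J0)%N,
     p J0 i <= s <= p J0 i.+1, q J0 l <= t <= q J0 l.+1 &
     `|(K' s t - K s t) - (K' (p J0 i) (q J0 l) - K (p J0 i) (q J0 l))| <=
       w + 2 * dl (J0 + n)%N + 2 * \sum_(k < n) dl (J0 + k).+1].
Proof.
move=> hK hK' n0 st hw s t [hs ht].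
have [i iJ si] := grid_locate (J0 + n) len1_gt0 hs.
have [l lJ tl] := grid_locate (J0 + n) len2_gt0 ht.
have coarse lo len (x : R) (k : nat) : 0 < len ->
    grid lo len (J0 + n) k <= x <= grid lo len (J0 + n) k.+1 ->
    grid lo len J0 (k %/ 2 ^ n) <= x <= grid lo len J0 (k %/ 2 ^ n).+1.
  move=> len0 /andP[x1 x2]; rewrite -!(grid_coarsen _ _ J0 n); apply/andP; split.
    by rewrite (le_trans _ x1)// grid_le ?(ltW len0)// leq_trunc_div.
  by rewrite (le_trans x2)// grid_le ?(ltW len0)// ltn_ceil// expn_gt0.
exists (i %/ 2 ^ n)%N, (l %/ 2 ^ n)%N; split.
- by rewrite ltn_divLR ?expn_gt0// -expnD.
- by rewrite ltn_divLR ?expn_gt0// -expnD.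
- exact: coarse.
- exact: coarse.
pose h s t := K' s t - K s t.
have hdbl j i0 l0 : h (p j.+1 i0.*2) (q j.+1 l0.*2) = h (p j i0) (q j l0).
  by rewrite !grid_double.
have ch := @dyadic_chain R (fun j i l => h (p j i) (q j l)) dl J0 n
  hdbl
  (fun j i l hj => (st j hj).1 i l) (fun j i l hj => (st j hj).2 i l) i l (ltnW iJ) (ltnW lJ).
have JJ : (J0 < J0 + n <= J0 + n)%N by rewrite leqnn andbT -[X in (X < _)%N]addn0 ltn_add2l.
have [st1 st2] := st _ JJ.
have res := monotone_residual hK hK' si tl.
have := st1 i l iJ (ltnW lJ); have := st2 i.+1 l iJ lJ; have := hw i l iJ lJ.
move: res ch; rewrite -!/(h _ _).
set a1 := h s t; set a2 := h (p _ i) _; set a3 := h (p _ i.+1) (q _ l.+1).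
set a4 := h (p _ i.+1) (q _ l); set a5 := h _ _; set S := \sum_(_ < _) _.
set kk := _ - K _ _; set D := dl (J0 + n)%N.
clearbody a1 a2 a3 a4 a5 S kk D; clear => r c hkk s2 s1.
have h1 : `|a3 - a2| <= `|a3 - a4| + `|a4 - a2|.
  by rewrite -[X in `|X|](subrKA a4) ler_normD.
rewrite -[X in `|X|](subrKA a2) (le_trans (ler_normD _ _))//; lra.
Qed.

(** Points within [N] mesh widths of each other lie in cells at most [N + 1] indices apart. Besides
    the two residuals inside the cells, their discrepancies differ by that many steps in each
    coordinate. *)
Lemma grid_oscillation (K K' : R -> R -> R) (C th N : R) (J : nat) :
  monotone2 K -> monotone2 K' ->
  (forall i l, (i < 2 ^ J)%N -> (l < 2 ^ J)%N ->
     K (p J i.+1) (q J l.+1) - K (p J i) (q J l) <= C / 2 ^+ J) ->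
  grid_steps_le (fun s t => K' s t - K s t) J th ->
  forall s s' t t', in_box s t -> in_box s' t' ->
    `|s - s'| <= N * (len1 / 2 ^+ J) -> `|t - t'| <= N * (len2 / 2 ^+ J) ->
  `|(K' s' t' - K s' t') - (K' s t - K s t)| <=
    2 * (2 * th + C / 2 ^+ J) + 2 * (N + 1) * th.
Proof.
move=> hK hK' hC [st1 st2] s s' t t' [bs bt] [bs' bt'] ss' tt'.
pose h s t := K' s t - K s t.
have loc x y : lo1 <= x <= lo1 + len1 -> lo2 <= y <= lo2 + len2 ->
   exists i l, [/\ (i < 2 ^ J)%N, (l < 2 ^ J)%N, p J i <= x <= p J i.+1,
     q J l <= y <= q J l.+1 & `|h x y - h (p J i) (q J l)| <= 2 * th + C / 2 ^+ J].
  move=> hx hy; have [i iJ xi] := grid_locate J len1_gt0 hx.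
  have [l lJ yl] := grid_locate J len2_gt0 hy; exists i, l; split=> //.
  have := monotone_residual hK hK' xi yl; rewrite -!/(h _ _).
  have := st1 i l iJ (ltnW lJ); have := st2 i.+1 l iJ lJ; rewrite -!/(h _ _).
  have := hC i l iJ lJ.
  set a1 := h x y; set a2 := h (p _ i) _; set a3 := h (p _ i.+1) (q _ l.+1).
  set a4 := h (p _ i.+1) (q _ l); set kk := _ - K _ _; set CC := C / _.
  clearbody a1 a2 a3 a4 kk CC; clear => hkk s2 s1 r.
  have h1 : `|a3 - a2| <= `|a3 - a4| + `|a4 - a2|.
    by rewrite -[X in `|X|](subrKA a4) ler_normD.
  lra.
have [i [l [iJ lJ si tl r1]]] := loc s t bs bt.
have [i' [l' [iJ' lJ' si' tl' r2]]] := loc s' t' bs' bt'.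
have th0 : 0 <= th by apply: le_trans (st1 i l iJ (ltnW lJ)).
have idx lo len (x x' : R) (k k' : nat) : 0 < len -> `|x - x'| <= N * (len / 2 ^+ J) ->
   grid lo len J k <= x <= grid lo len J k.+1 ->
   grid lo len J k' <= x' <= grid lo len J k'.+1 -> k'%:R - k%:R <= N + 1.
  move=> len0 xx /andP[x1 x2] /andP[x3 x4].
  have m0 : 0 < len / 2 ^+ J by rewrite divr_gt0// exprn_gt0.
  have := gridB lo len J k.+1 k'; rewrite -natr1.
  have : x' - x <= N * (len / 2 ^+ J).
    by rewrite (le_trans (ler_norm _))// distrC.
  move=> h1 h2; rewrite -(ler_pM2l m0).
  move: h1 h2 x2 x3; set P1 := grid _ _ _ _; set P2 := grid _ _ _ _.
  move: (len / _) m0 => mm mm0; clear; nra.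
have idx1 := idx _ _ _ _ _ _ len1_gt0 ss' si si'.
have idx2 := idx _ _ _ _ _ _ len2_gt0 tt' tl tl'.
have idx1' := idx _ _ _ _ _ _ len1_gt0 (eq_ind _ (fun z => z <= _) ss' _ (distrC _ _)) si' si.
have idx2' := idx _ _ _ _ _ _ len2_gt0 (eq_ind _ (fun z => z <= _) tt' _ (distrC _ _)) tl' tl.
have c1 : `|h (p J i') (q J l) - h (p J i) (q J l)| <= (N + 1) * th.
  have ss := step_sum (f := fun i => h (p J i) (q J l)) (th := th) (N := 2 ^ J)%N
    (fun k hk => st1 k l hk (ltnW lJ)).
  have [ii'|/ltnW ii'] := leqP i i'.
    by apply: le_trans (ss _ _ ii' (ltnW iJ')) _; rewrite ler_wpM2r.
  by rewrite distrC; apply: le_trans (ss _ _ ii' (ltnW iJ)) _; rewrite ler_wpM2r.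
have c2 : `|h (p J i') (q J l') - h (p J i') (q J l)| <= (N + 1) * th.
  have ss := step_sum (f := fun l => h (p J i') (q J l)) (th := th) (N := 2 ^ J)%N
    (fun k hk => st2 i' k (ltnW iJ') hk).
  have [ii'|/ltnW ii'] := leqP l l'.
    by apply: le_trans (ss _ _ ii' (ltnW lJ')) _; rewrite ler_wpM2r.
  by rewrite distrC; apply: le_trans (ss _ _ ii' (ltnW lJ)) _; rewrite ler_wpM2r.
move: r1 r2 c1 c2; rewrite -!/(h _ _).
set a1 := h s t; set a2 := h s' t'; set a3 := h (p _ i) _; set a4 := h (p _ i') (q _ l').
set a5 := h (p _ i') (q _ l); set CC := C / _; set NN := (N + 1) * th.
have -> : 2 * (N + 1) * th = 2 * NN by rewrite /NN mulrA.
clearbody a1 a2 a3 a4 a5 CC NN; clear.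
rewrite !ler_norml => /andP[? ?] /andP[? ?] /andP[? ?] /andP[? ?].
by apply/andP; split; lra.
Qed.

End dyadic_control.

(* [quad] gives the sets on which H, F and G are read off: quadrants, and half
   planes as quadrants with one infinite corner coordinate. *)
Definition quad {R : realType} (md : option bool) (s t : R) : set (R * R) :=
  match md with
  | None => `]-oo, s]%classic `*` `]-oo, t]%classic
  | Some true => `]-oo, s]%classic `*` setT
  | Some false => setT `*` `]-oo, t]%classic
  end.

Section quadrants.
Context {R : realType}.

Lemma measurable_quad md (s t : R) : measurable (quad md s t).
Proof. by case: md => [[]|]; apply: measurableX. Qed.

Lemma quad_sub md (s s' t t' : R) : s <= s' -> t <= t' -> quad md s t `<=` quad md s' t'.
Proof.
move=> ss tt; case: md => [[]|] [x y] /=; rewrite !in_itv/=.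
- by move=> [h _]; split=> //; exact: le_trans ss.
- by move=> [_ h]; split=> //; exact: le_trans tt.
- by move=> [h1 h2]; split; [exact: le_trans ss|exact: le_trans tt].
Qed.

(** An increment of any [quad] in the first coordinate lies in a vertical strip, so the first
    marginal controls it in all three cases. *)
Lemma quad_stripl md (s s' t : R) : s <= s' ->
  quad md s' t `\` quad md s t `<=` quad (Some true) s' t `\` quad (Some true) s t.
Proof.
move=> ss; case: md => [[]|] [x y] /=; rewrite ?in_itv/=.
- by [].
- by move=> [] [_ h] [].
- by move=> [[h1 h2] h3]; split=> // -[h4 _]; apply: h3.
Qed.

Lemma quad_stripr md (s t t' : R) : t <= t' ->
  quad md s t' `\` quad md s t `<=` quad (Some false) s t' `\` quad (Some false) s t.
Proof.
move=> ss; case: md => [[]|] [x y] /=; rewrite ?in_itv/=.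
- by move=> [] [h _] [].
- by [].
- by move=> [[h1 h2] h3]; split=> // -[_ h4]; apply: h3.
Qed.

Lemma emp_monotone2 n (z : nat -> R * R) md :
  monotone2 (fun s t => emp n z (quad md s t) : R).
Proof. by move=> s s' t t' ss tt; apply: emp_le; exact: quad_sub. Qed.

End quadrants.

(** * Probability bounds for increments over dyadic grids *)

Section finite_union_bound.
Context {d} {T : measurableType d} {R : realType}.

Lemma measure_finType_bigcup_le (mu : {measure set T -> \bar R}) (I : finType) (F : I -> set T) :
  (forall i, measurable (F i)) ->
  (mu (\bigcup_i F i) <= \sum_i mu (F i))%E.
Proof.
move=> mF; have h := @content_sub_fsum _ _ _ mu I setT (\bigcup_i F i) F.
apply: le_trans (h _ _ _ _) _ => //.
- exact: finite_finset.
- by apply: fin_bigcup_measurable; [exact: finite_finset|].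
- rewrite [leRHS](@bigfs _ _ _ _ (index_enum I) xpredT)//; first last.
  - by move=> i _; rewrite mem_index_enum.
  - exact: index_enum_uniq.
  by rewrite (_ : [set` xpredT] = setT)//; apply/seteqP; split.
Qed.

End finite_union_bound.

Section step_events.
Context {d} {T : measurableType d} {R : realType}.
Variables (Pr : probability T R) (Dm : set nat) (Z : nat -> T -> R * R).
Variables (mu : set (R * R) -> \bar R) (k : nat).
Hypothesis hZ : iid_with_law Pr Dm Z mu.
Hypothesis hk : `I_k `<=` Dm.
Hypothesis k0 : (0 < k)%N.
Hypothesis mu_setD : forall A B, measurable A -> measurable B -> A `<=` B ->
  fine (mu (B `\` A)) = fine (mu B) - fine (mu A).
Variables (lo1 len1 lo2 len2 : R).
Hypotheses (len1_ge0 : 0 <= len1) (len2_ge0 : 0 <= len2).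
Local Notation p := (grid lo1 len1).
Local Notation q := (grid lo2 len2).
Local Notation m md s t := (fine (mu (quad md s t))).

Definition discrepancy (w : T) md (s t : R) : R := emp k (Z ^~ w) (quad md s t) - m md s t.

(** [mu] is a plain set function so that the bound serves the sample, with law [P], and the
    bootstrap sample, with law [empirical]. In [48 * 4 ^+ j] there are 3 kinds of sets, 2
    directions, at most [4 * 4 ^+ j] pairs of indices, and the factor 2 of the two-sided Bernstein
    bound. *)
Lemma level_event j (pb eps : R) : 0 <= eps <= pb ->
  (forall md i l, (i < 2 ^ j)%N -> (l <= 2 ^ j)%N -> m md (p j i.+1) (q j l) - m md (p j i) (q j l) <= pb) ->
  (forall md i l, (i <= 2 ^ j)%N -> (l < 2 ^ j)%N -> m md (p j i) (q j l.+1) - m md (p j i) (q j l) <= pb) ->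
  exists bad : set T, [/\ measurable bad,
    (Pr bad <= (48 * 4 ^+ j * expR (- (k%:R * eps ^+ 2 / (4 * pb))))%:E)%E
    & forall w, ~ bad w -> forall md, grid_steps_le lo1 len1 lo2 len2 (discrepancy w md) j eps].
Proof.
move=> he m1 m2.
have basic A B : measurable A -> measurable B -> A `<=` B -> fine (mu B) - fine (mu A) <= pb ->
    exists bad : set T, [/\ measurable bad,
      (Pr bad <= (2 * expR (- (k%:R * eps ^+ 2 / (4 * pb))))%:E)%E
      & forall w, ~ bad w ->
        `|(emp k (Z ^~ w) B - fine (mu B)) - (emp k (Z ^~ w) A - fine (mu A))| <= eps].
  move=> mA mB AB hpb.
  have mD : measurable (B `\` A) by exact: measurableD.
  have [|h1 h2] := iid_bernstein hZ hk k0 mD _ he; first by rewrite mu_setD.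
  exists [set w | eps <= `|emp k (Z ^~ w) (B `\` A) - fine (mu (B `\` A))|]; split=> // w.
  move=> /= /negP; rewrite -ltNge => /ltW; rewrite mu_setD// emp_setD//.
  by congr (`|_| <= _); ring.
pose I : finType := (option bool * bool * 'I_(2 ^ j).+1 * 'I_(2 ^ j).+1)%type.
have ev (x : I) : exists bad : set T, [/\ measurable bad,
      (Pr bad <= (2 * expR (- (k%:R * eps ^+ 2 / (4 * pb))))%:E)%E
      & forall w, ~ bad w -> let: (md, b, i, l) := x in
       if b then (i < 2 ^ j)%N -> `|discrepancy w md (p j i.+1) (q j l) - discrepancy w md (p j i) (q j l)| <= eps
       else (l < 2 ^ j)%N -> `|discrepancy w md (p j i) (q j l.+1) - discrepancy w md (p j i) (q j l)| <= eps].
  case: x => [[[md b] i] l].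
  have e0 : (Pr set0 <= (2 * expR (- (k%:R * eps ^+ 2 / (4 * pb))))%:E)%E.
    by rewrite measure0 lee_fin mulr_ge0 ?expR_ge0.
  case: b.
    have [iJ|iJ] := boolP (i < 2 ^ j)%N; last by exists set0; split.
    have [] := basic (quad md (p j i) (q j l)) (quad md (p j i.+1) (q j l)).
    - exact: measurable_quad.
    - exact: measurable_quad.
    - by apply: quad_sub => //; exact: grid_le.
    - by apply: m1 => //; rewrite -ltnS.
    by move=> bad [b1 b2 b3]; exists bad; split=> // w nb _; exact: b3.
  have [lJ|lJ] := boolP (l < 2 ^ j)%N; last by exists set0; split.
  have [] := basic (quad md (p j i) (q j l)) (quad md (p j i) (q j l.+1)).
  - exact: measurable_quad.
  - exact: measurable_quad.
  - by apply: quad_sub => //; exact: grid_le.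
  - by apply: m2 => //; rewrite -ltnS.
  by move=> bad [b1 b2 b3]; exists bad; split=> // w nb _; exact: b3.
have [bad hbad] := choice ev.
exists (\bigcup_x bad x); split.
- by apply: fin_bigcup_measurable => // x _; have [] := hbad x.
- apply: le_trans (measure_finType_bigcup_le _ _) _; first by move=> x; have [] := hbad x.
  apply: (@le_trans _ _ (\sum_(x : I) (2 * expR (- (k%:R * eps ^+ 2 / (4 * pb))))%:E)%E).
    by apply: lee_sum => x _; have [] := hbad x.
  have : 0 <= expR (- (k%:R * eps ^+ 2 / (4 * pb))) by exact: expR_ge0.
  set W := expR _ => W0; rewrite sumEFin lee_fin sumr_const.
  rewrite -[_ *+ #|_|]mulr_natl mulrA ler_wpM2r//.
  rewrite !card_prod !card_ord card_option card_bool !natrM.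
  have : ((2 ^ j).+1 <= 2 * 2 ^ j)%N by rewrite mul2n -addnn -add1n leq_add2r expn_gt0.
  rewrite -(ler_nat R) natrM => h.
  have -> : 4 ^+ j = (2 ^ j)%:R * (2 ^ j)%:R :> R by rewrite !natrX -exprMn -natrM.
  have h0 : 0 <= (2 ^ j).+1%:R :> R by [].
  have := ler_pM h0 h0 h h; move: ((2 ^ j).+1%:R) ((2 ^ j)%:R) => x y; lra.
- move=> w hw md; split=> i l hi hl.
  + have [_ _ /(_ w _)] := hbad (md, true, inord i, inord l).
    rewrite !inordK ?ltnS ?(ltnW hi)//; apply => // hb; apply: hw.
    by exists (md, true, inord i, inord l).
  + have [_ _ /(_ w _)] := hbad (md, false, inord i, inord l).
    rewrite !inordK ?ltnS ?(ltnW hl)//; apply => // hb; apply: hw.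
    by exists (md, false, inord i, inord l).
Qed.

End step_events.

Section chaining_event.
Context {d} {T : measurableType d} {R : realType}.

(** Bernoulli's inequality for [18 / 17], whose square is at most [9 / 8], gives
    [(9 / 8) ^ j >= (j / 17) ^ 2]; here [289 = 17 ^ 2]. *)
Lemma geometric_beats_linear (A L : R) : 0 < A ->
  exists J0 : nat, forall j, (J0 <= j)%N -> L + 1 + j%:R <= A * (9 / 8) ^+ j.
Proof.
move=> A0; pose x := Num.max 1 (289 * (`|L| + 2) / A).
exists (Num.truncn x).+1 => j hj.
have xj : x <= j%:R by rewrite (le_trans (ltW (truncnS_gt x)))// ler_nat.
have j1 : 1 <= j%:R :> R by rewrite (le_trans _ xj)// le_max lexx.
have jA : 289 * (`|L| + 2) <= j%:R * A.
  by rewrite -ler_pdivrMr// (le_trans _ xj)// le_max lexx orbT.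
have bern (m : nat) : 1 + m%:R / 17 <= (18 / 17) ^+ m :> R.
  elim: m => [|m IH]; first by rewrite mul0r addr0.
  rewrite exprS -natr1; move: IH (ler0n R m); set y := _ ^+ m; set z := m%:R.
  clearbody y z; clear; lra.
have b2 : (j%:R / 17) ^+ 2 <= (9 / 8) ^+ j :> R.
  apply: (@le_trans _ _ ((18 / 17) ^+ j * (18 / 17) ^+ j)).
    rewrite expr2 ler_pM ?divr_ge0//; have := bern j; lra.
  rewrite -exprMn lerXn2r ?nnegrE//; lra.
have L1 := ler_norm L.
apply: (@le_trans _ _ (A * (j%:R / 17) ^+ 2)); last by rewrite ler_wpM2l// ltW.
rewrite (_ : A * (j%:R / 17) ^+ 2 = (j%:R * A) * j%:R / 289); last by field.
have h289 : 0 < 289 :> R by rewrite ltr0n.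
rewrite ler_pdivlMr; last exact: h289.
have := normr_ge0 L; move: jA j1 L1; move: (j%:R) (`|L|) => y z; clear; nra.
Qed.

Variables (Pr : probability T R) (Dm : set nat) (Z : nat -> T -> R * R).
Variables (mu : set (R * R) -> \bar R) (k : nat).
Hypothesis hZ : iid_with_law Pr Dm Z mu.
Hypothesis hk : `I_k `<=` Dm.
Hypothesis k0 : (0 < k)%N.
Hypothesis mu_setD : forall A B, measurable A -> measurable B -> A `<=` B ->
  fine (mu (B `\` A)) = fine (mu B) - fine (mu A).
Variables (lo1 len1 lo2 len2 : R).
Hypotheses (len1_ge0 : 0 <= len1) (len2_ge0 : 0 <= len2).
Local Notation p := (grid lo1 len1).
Local Notation q := (grid lo2 len2).
Local Notation m md s t := (fine (mu (quad md s t))).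

(** Since [(3 / 4) ^ 2 * 2 = 9 / 8], Bernstein's exponent at level [j] is [x = k a ^ 2] times
    [d0 ^ 2 / (8 C) * (9 / 8) ^ j], hence at least [x * (L + 1 + j)]. The part with [j] outweighs
    the [4 ^ j] grid points; the extra unit absorbs the factor 48, because [x >= 47] gives
    [expR x >= 48]. *)
Lemma chaining_event (a d0 C L : R) (J0 n : nat) : 0 < a -> 0 < d0 -> 0 < C ->
  (forall j, (J0 < j <= J0 + n)%N ->
    (forall md i l, (i < 2 ^ j)%N -> (l <= 2 ^ j)%N ->
       m md (p j i.+1) (q j l) - m md (p j i) (q j l) <= 2 * C / 2 ^+ j) /\
    (forall md i l, (i <= 2 ^ j)%N -> (l < 2 ^ j)%N ->
       m md (p j i) (q j l.+1) - m md (p j i) (q j l) <= 2 * C / 2 ^+ j)) ->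
  (forall j, (J0 < j <= J0 + n)%N -> a * d0 * (3 / 4) ^+ j <= 2 * C / 2 ^+ j) ->
  (forall j, (J0 <= j)%N -> L + 1 + j%:R <= d0 ^+ 2 / (8 * C) * (9 / 8) ^+ j) ->
  47 <= k%:R * a ^+ 2 ->
  exists bad : set T, [/\ measurable bad,
    (Pr bad <= (expR (- (k%:R * a ^+ 2 * L)))%:E)%E
    & forall w, ~ bad w -> forall md j, (J0 < j <= J0 + n)%N ->
        grid_steps_le lo1 len1 lo2 len2 (discrepancy Z mu k w md) j (a * d0 * (3 / 4) ^+ j)].
Proof.
move=> a0 d00 C0 hm hpb hA hka; set x := k%:R * a ^+ 2 in hka *.
have ev (i : 'I_n) : exists bad : set T, [/\ measurable bad,
    (Pr bad <= (48 * expR (- (x * (L + 1))) * 2^-1 ^+ i.+1)%:E)%E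
    & forall w, ~ bad w -> forall md, grid_steps_le lo1 len1 lo2 len2 (discrepancy Z mu k w md)
       (J0 + i).+1 (a * d0 * (3 / 4) ^+ (J0 + i).+1)].
  set j := (J0 + i).+1.
  have hj : (J0 < j <= J0 + n)%N by rewrite /j ltnS leq_addr -addnS leq_add2l ltn_ord.
  have [m1 m2] := hm _ hj.
  have he : 0 <= a * d0 * (3 / 4) ^+ j <= 2 * C / 2 ^+ j.
    by rewrite hpb// andbT !mulr_ge0 ?exprn_ge0 ?(ltW a0) ?(ltW d00)// divr_ge0.
  have [bad [b1 b2 b3]] := level_event hZ hk k0 mu_setD len1_ge0 len2_ge0 he m1 m2.
  exists bad; split=> //; apply: (le_trans b2); rewrite lee_fin.
  have -> : k%:R * (a * d0 * (3 / 4) ^+ j) ^+ 2 / (4 * (2 * C / 2 ^+ j)) =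
      x * (d0 ^+ 2 / (8 * C) * (9 / 8) ^+ j).
    have -> : (9 / 8 : R) ^+ j = (3 / 4) ^+ j * (3 / 4) ^+ j * 2 ^+ j.
      by rewrite -!exprMn; congr (_ ^+ j); field.
    by rewrite /x; field; rewrite expf_neq0//= gt_eqF.
  have x0 : 0 <= x by lra.
  have h1 : expR (- (x * (d0 ^+ 2 / (8 * C) * (9 / 8) ^+ j))) <=
      expR (- (x * (L + 1))) * 8^-1 ^+ j.
    apply: (@le_trans _ _ (expR (- (x * (L + 1))) * expR (- x) ^+ j)).
      rewrite -expRM_natl -expRD ler_expR.
      have := ler_wpM2l x0 (hA j (ltnW (andP hj).1)); lra.
    rewrite ler_wpM2l ?expR_ge0// lerXn2r ?nnegrE ?expR_ge0 ?invr_ge0//.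
    rewrite expRN lef_pV2 ?posrE ?expR_gt0//.
    by have := expR_ge1Dx x; lra.
  apply: le_trans (ler_wpM2l _ h1) _; first by rewrite mulr_ge0 ?exprn_ge0.
  set U := expR _; have U0 : 0 <= U by exact: expR_ge0.
  rewrite (_ : 48 * 4 ^+ j * (U * 8^-1 ^+ j) = 48 * U * (4 ^+ j * 8^-1 ^+ j)); last by ring.
  rewrite ler_wpM2l ?mulr_ge0// -exprMn (_ : 4 * 8^-1 = 2^-1 :> R); last by field.
  have i2 : 2^-1 <= 1 :> R by lra.
  by apply: ler_wiXn2l => //; rewrite /j ltnS leq_addl.
have [bad hbad] := choice ev.
exists (\bigcup_i bad i); split.
- by apply: fin_bigcup_measurable; [exact: finite_finset|move=> i _; have [] := hbad i].
- apply: le_trans (measure_finType_bigcup_le _ _) _; first by move=> i; have [] := hbad i.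
  apply: (@le_trans _ _ (\sum_(i < n) (48 * expR (- (x * (L + 1))) * 2^-1 ^+ i.+1)%:E)%E).
    by apply: lee_sum => i _; have [] := hbad i.
  rewrite sumEFin lee_fin -mulr_sumr.
  have s1 : \sum_(i < n) 2^-1 ^+ i.+1 <= 1 :> R.
    suff : \sum_(i < n) 2^-1 ^+ i.+1 = 1 - 2^-1 ^+ n :> R.
      by move=> ->; rewrite lerBlDr lerDl exprn_ge0 ?invr_ge0.
    elim: n {hm hpb ev bad hbad} => [|n' IH]; first by rewrite big_ord0 subrr.
    rewrite big_ord_recr/= IH exprS; set y := _ ^+ n'; clearbody y; lra.
  apply: (@le_trans _ _ (48 * expR (- (x * (L + 1))))).
    by rewrite ler_piMr// mulr_ge0 ?expR_ge0.
  have -> : - (x * (L + 1)) = - x + - (x * L) by ring.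
  rewrite expRD mulrA ler_piMl ?expR_ge0// expRN ler_pdivrMr ?expR_gt0// mul1r.
  by have := expR_ge1Dx x; lra.
- move=> w hw md j /andP[j1 j2].
  have hjn : (j - J0.+1 < n)%N by rewrite ltn_subLR// addSn ltnS.
  have jE : j = (J0 + Ordinal hjn).+1 by rewrite /= -addSn subnKC.
  have [_ _ /(_ w _ md)] := hbad (Ordinal hjn); rewrite -jE; apply.
  by move=> hb; apply: hw; exists (Ordinal hjn).
Qed.

End chaining_event.

(** * Almost sure lower limits *)

Section almost_sure_liminf.
Context {d} {T : measurableType d} {R : realType} (Pr : probability T R).
Local Open Scope ereal_scope.

Definition eventually_as (E : nat -> set T) : Prop :=
  exists2 A : set T, measurable A /\ Pr A = 0 &
    forall w, ~ A w -> exists N, forall n, (N <= n)%N -> E n w.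

(** The bound [2 K (1 - 1 / (m + 1))] on the partial sums of [K / i ^ 2] telescopes; the term of
    index 0, for which nothing is assumed, is at most 1. *)
Lemma borel_cantelli (F : nat -> set T) (K : R) : (forall n, measurable (F n)) ->
  (forall n, (0 < n)%N -> Pr (F n) <= (K / n%:R ^+ 2)%:E) ->
  eventually_as (fun n => ~` F n).
Proof.
move=> mF hF.
have K0 : (0 <= K)%R.
  by have := hF 1%N isT; rewrite expr1n divr1 => /(le_trans (measure_ge0 _ _)); rewrite lee_fin.
exists (lim_sup_set F); last first.
  move=> w hw; apply: contrapT => h; apply: hw => n _ /=.
  apply: contrapT => h2; apply: h; exists n => j nj Fj; apply: h2.
  by exists j.
split; first by apply: bigcapT_measurable => n; apply: bigcup_measurable => j _.
apply: lim_sup_set_cvg0 => //.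
apply: (@le_lt_trans _ _ (1 + 2 * K)%:E); last by rewrite ltry.
apply: lime_le; first by apply: is_cvg_nneseries => n _ _; exact: measure_ge0.
near=> n.
have n0 : (0 < n)%N by near: n; exists 1%N.
rewrite -(prednK n0) big_mkord big_ord_recl.
have h m : \sum_(i < m) Pr (F (bump 0 i)) <= (2 * K * (1 - m.+1%:R^-1))%:E.
  elim: m => [|m IH]; first by rewrite big_ord0 invr1 subrr mulr0.
  rewrite big_ord_recr/= /bump/= add1n.
  apply: le_trans (leeD IH (hF m.+1 isT)) _.
  rewrite -EFinD lee_fin -subr_ge0.
  have m0 : (0 < m.+1%:R :> R)%R by rewrite ltr0n.
  rewrite -[in X in (_ - X^-1)%R]natr1; move: m0; set x := _%:R => x0.
  have -> : (2 * K * (1 - (x + 1)^-1) - (2 * K * (1 - x^-1) + K / x ^+ 2) =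
    K * ((x - 1) / (x ^+ 2 * (x + 1))))%R by field; rewrite !gt_eqF//; lra.
  rewrite mulr_ge0// divr_ge0 ?mulr_ge0//; first by rewrite subr_ge0 /x ler1n.
  by rewrite addr_ge0// ltW.
rewrite EFinD; apply: leeD; first exact: probability_le1.
apply: le_trans (h _) _; rewrite lee_fin prednK// ler_piMr ?mulr_ge0//.
Unshelve. all: by end_near.
Qed.

Lemma liminf_ge_asNy (Z : nat -> T -> \bar R) : liminf_ge_as Pr Z (-oo).
Proof.
exists (fun _ _ => -oo); split=> [n|n w|]; [exact: measurable_cst|exact: leNye|].
rewrite (_ : mkset _ = setT) ?probability_setT//.
by apply/seteqP; split=> w _ //=; exact: leNye.
Qed.

(** The minorant is the supremum, over the levels [c - 1 / (m + 1)] whose event has occurred, of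
    these levels. The exceptional null sets of the countably many levels have a null union. *)
Lemma liminf_ge_as_events (Z : nat -> T -> \bar R) (c : R) :
  (forall r : R, (r < c)%R -> exists E : nat -> set T, [/\ forall n, measurable (E n),
     eventually_as E & exists N, forall n w, (N <= n)%N -> E n w -> r%:E <= Z n w]) ->
  liminf_ge_as Pr Z c%:E.
Proof.
move=> h; pose r (m : nat) : R := (c - m.+1%:R^-1)%R.
have rc m : (r m < c)%R by rewrite ltrBlDr ltrDl invr_gt0.
have [E hE] := choice (fun m => h _ (rc m)).
have {}hE : forall m, exists N, [/\ forall n, measurable (E m n), eventually_as (E m)
   & forall n w, (N <= n)%N -> E m n w -> (r m)%:E <= Z n w].
  by move=> m; have [? ? [N ?]] := hE m; exists N.
have [N {}hE] := choice hE.
pose D m n w : \bar R := if (N m <= n)%N && (w \in E m n) then (r m)%:E else -oo.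
have mDsup n : measurable_fun setT (fun w => ereal_sup [set D m n w | m in setT]).
  rewrite (_ : (fun w => _) = (fun w => esups (fun m => D m n w) 0%N)); last first.
    by apply/funext => w; rewrite /esups/= /sdrop; congr (ereal_sup _);
       congr (_ @` _); apply/seteqP; split.
  apply: (@measurable_fun_esups _ _ _ _ (fun m => D m n)) => m.
  rewrite /D; case: (N m <= n)%N => /=; last exact: measurable_cst.
  apply: measurable_fun_ifT => //; try exact: measurable_cst.
  apply: (measurable_fun_bool true); rewrite setTI (_ : _ @^-1` _ = E m n).
    by have [] := hE m.
  by apply/seteqP; split=> w /=; [move/set_mem|move/mem_set].
exists (fun n w => ereal_sup [set D m n w | m in setT]); split.
- exact: mDsup.
- move=> n w; apply: ge_ereal_sup => _ [m _ <-]; rewrite /D.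
  case: ifP => [/andP[Nn /set_mem Ew]|_]; last exact: leNye.
  by have [_ _] := hE m; apply.
(* The null sets hidden in [eventually_as], one for each level, are chosen simultaneously. *)
- have [A hA] := choice (fun m => let: And3 _ x _ := hE m in let: ex_intro2 A p q := x in
    ex_intro (fun A => [/\ measurable A, Pr A = 0 & forall w, ~ A w -> exists N, forall n, (N <= n)%N -> E m n w])
      A (And3 p.1 p.2 q)).
  set B := mkset _.
  have mU : measurable (\bigcup_m A m) by apply: bigcup_measurable => m _; have [] := hA m.
  have U0 : Pr (\bigcup_m A m) = 0.
    apply/eqP; rewrite eq_le measure_ge0 andbT.
    apply: le_trans (measure_sigma_subadditive _ _ mU (@subset_refl _ _)) _.
      by move=> m; have [] := hA m.
    by rewrite eseries0// => m _ _; have [] := hA m.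
  have sub : ~` (\bigcup_m A m) `<=` B.
    move=> w hw; rewrite /B/=; apply/lee_addgt0Pr => e e0.
    have [m hm] : exists m, (c - e <= r m)%R.
      exists (Num.truncn e^-1); rewrite lerD2l lerN2.
      rewrite invf_ple ?posrE//; exact/ltW/truncnS_gt.
    have [_ _ /(_ w)[|n0 hn0]] := hA m; first by move=> Am; apply: hw; exists m.
    rewrite -leeBlDr// -EFinB; apply: (@le_trans _ _ (r m)%:E); first by rewrite lee_fin.
    rewrite limn_einf_lim; apply: lime_ge; first exact: is_cvg_einfs.
    near=> n; apply: le_ereal_inf_tmp => _ [j /= nj <-].
    have jn0 : (n0 <= j)%N by apply: leq_trans nj; near: n; exists n0.
    have jN : (N m <= j)%N by apply: leq_trans nj; near: n; exists (N m).
    apply: ereal_sup_ubound; exists m => //; rewrite /D jN mem_set//=.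
    exact: hn0.
  have mB : measurable B.
    have mD n : measurable_fun setT (fun w => - ereal_sup [set D m n w | m in setT]).
      apply: measurableT_comp => //; exact: mDsup.
    (* The lower limit is minus the upper limit of the opposites, a measurable function of [w]. *)
    have -> : B = (fun w => limn_esup (fun n => - ereal_sup [set D m n w | m in setT]))
        @^-1` [set x | x <= - c%:E].
      apply/seteqP; split=> w; rewrite /B /=;
        rewrite (limn_esupN (fun n => ereal_sup [set D m n w | m in setT]));
        by rewrite EFinN leeN2.
    rewrite -[X in measurable X]setTI; apply: measurable_fun_limn_esup => //.
    rewrite (_ : mkset _ = `]-oo, - c%:E]%classic); first exact: emeasurable_itv.
    by apply/seteqP; split=> x; rewrite /= in_itv.
  apply/eqP; rewrite eq_le probability_le1//=.
  have mUC : measurable (~` \bigcup_m A m) by exact: measurableC.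
  have h1 : 1 <= Pr (~` \bigcup_m A m) + Pr (\bigcup_m A m).
    by rewrite -(probability_setT Pr) -(setvU (\bigcup_m A m)); exact: measureU2.
  apply: (le_trans h1); rewrite U0 adde0.
  by apply: le_measure sub; rewrite inE.
Unshelve. all: by end_near.
Qed.
End almost_sure_liminf.

(** * Typical samples *)

Lemma probability_setU_le {d} {T : measurableType d} {R : realType} (Pr : probability T R)
  (A B : set T) : measurable A -> measurable B -> (Pr (A `|` B) <= Pr A + Pr B)%E.
Proof. by move=> mA mB; exact: measureU2. Qed.

Section coarse_cells.
Context {R : realType}.
Variables (lo1 len1 lo2 len2 : R) (j : nat).

(** A cell records on which side of every grid line a point lies. Points outside the box have cells
    too, so the cells partition the plane, and each [quad] with corners on the grid is a union of
    cells; many patterns are empty. *)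
Definition coarse_cell (z : R * R) : {ffun 'I_(2 ^ j).+1 * bool -> bool} :=
  [ffun x : 'I_(2 ^ j).+1 * bool => if x.2 then z.1 <= grid lo1 len1 j x.1 else z.2 <= grid lo2 len2 j x.1].

Lemma measurable_coarse_cell c : measurable (coarse_cell @^-1` [set c]).
Proof.
rewrite (_ : _ @^-1` _ = \bigcap_(x in setT) [set z | coarse_cell z x = c x]); last first.
  apply/seteqP; split=> [z <- x _//|z h]; first by apply/ffunP => x; exact: h.
apply: fin_bigcap_measurable => [|[i b] _]; first exact: finite_finset.
have mE (f : R * R -> R) (y : R) : measurable_fun setT f -> measurable [set z | f z <= y].
  move=> mf; rewrite -[X in measurable X]setTI.
  have := mf measurableT `]-oo, y]%classic (measurable_itv _).
  by congr measurable; apply/seteqP; split=> z /=; rewrite in_itv.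
have mm : measurable [set z | coarse_cell z (i, b) = true].
  case: b => /=.
    rewrite (_ : mkset _ = [set z | z.1 <= grid lo1 len1 j i]); first exact: mE.
    by apply/seteqP; split=> z /=; rewrite ffunE.
  rewrite (_ : mkset _ = [set z | z.2 <= grid lo2 len2 j i]); first exact: mE.
  by apply/seteqP; split=> z /=; rewrite ffunE.
case: (c _) => //; rewrite (_ : mkset _ = ~` [set z | coarse_cell z (i, b) = true]).
  exact: measurableC.
by apply/seteqP; split=> z /=; [move=> ->|move/negP/negbTE].
Qed.

Lemma quad_coarse_cells md i l : (i <= 2 ^ j)%N -> (l <= 2 ^ j)%N ->
  exists E : pred {ffun 'I_(2 ^ j).+1 * bool -> bool},
    quad md (grid lo1 len1 j i) (grid lo2 len2 j l) = coarse_cell @^-1` [set` E].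
Proof.
move=> hi hl; pose i' := Ordinal (hi : (i < (2 ^ j).+1)%N).
pose l' := Ordinal (hl : (l < (2 ^ j).+1)%N).
exists (fun c => match md with None => c (i', true) && c (l', false)
  | Some true => c (i', true) | Some false => c (l', false) end).
case: md => [[]|]; apply/seteqP; split=> z; rewrite /= ?in_itv/= unfold_in/= !ffunE//=.
- by case.
- by case.
- by move=> [-> ->].
- by move=> /andP.
Qed.

End coarse_cells.

Section null_cells.
Context {d} {T : measurableType d} {R : realType}.
Variables (Pr : probability T R) (Dm : set nat) (Z : nat -> T -> R * R).
Variables (mu : set (R * R) -> \bar R) (k : nat).
Hypothesis hZ : iid_with_law Pr Dm Z mu.
Hypothesis hk : `I_k `<=` Dm.

(** Transfers null cells of the law to the frequencies exactly, not just approximately: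
    [coarse_density] asks for increments that vanish there. *)
Lemma null_event A : measurable A -> mu A = 0%E ->
  exists bad : set T, [/\ measurable bad, Pr bad = 0%E
    & forall w, ~ bad w -> emp k (Z ^~ w) A = 0 :> R].
Proof.
move=> mA A0; have [mZ lZ _] := hZ.
have DI (i : 'I_k) : Dm i by apply: hk => /=.
have mi (i : 'I_k) : measurable (Z i @^-1` A) by rewrite -[X in measurable X]setTI; exact: mZ.
exists (\bigcup_(i : 'I_k) Z i @^-1` A); split.
- by apply: fin_bigcup_measurable; [exact: finite_finset|move=> i _; exact: mi].
- apply/eqP; rewrite eq_le measure_ge0 andbT.
  apply: le_trans (measure_finType_bigcup_le _ mi) _.
  by rewrite big1// => i _; exact: etrans (lZ _ (DI i) _ mA) A0.
- move=> w hw; rewrite /emp big1 ?mulr0// => i _.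
  by rewrite memNset// => h; apply: hw; exists i.
Qed.

End null_cells.

Section data_event.
Context {d} {T : measurableType d} {R : realType}.

Lemma expRN_le (x : R) n : 0 < x -> expR (- x) <= (n`!)%:R / x ^+ n.
Proof.
move=> x0; rewrite expRN -[leRHS]invrK lef_pV2 ?posrE ?expR_gt0//; last first.
  by rewrite invr_gt0 divr_gt0 ?exprn_gt0// ltr0n fact_gt0.
rewrite invf_div; case: n => [|n]; first by rewrite expr0 fact0 divr1 -expR0 ler_expR ltW.
by apply: le_trans (expR_ge1Dxn n (ltW x0)); rewrite lerDr.
Qed.

Variables (Pr : probability T R) (Z : nat -> T -> R * R) (P : probability (R * R)%type R).
Hypothesis hZ : iid_with_law Pr setT Z P.
Variables (lo1 len1 lo2 len2 C : R).
Hypotheses (len1_ge0 : 0 <= len1) (len2_ge0 : 0 <= len2) (C_gt0 : 0 < C).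
Local Notation p := (grid lo1 len1).
Local Notation q := (grid lo2 len2).
Local Notation m md s t := (fine (P (quad md s t))).
Hypothesis steps1 : forall j md i l, (i < 2 ^ j)%N -> (l <= 2 ^ j)%N ->
  m md (p j i.+1) (q j l) - m md (p j i) (q j l) <= C / 2 ^+ j.
Hypothesis steps2 : forall j md i l, (i <= 2 ^ j)%N -> (l < 2 ^ j)%N ->
  m md (p j i) (q j l.+1) - m md (p j i) (q j l) <= C / 2 ^+ j.

Lemma probability_setD A B : measurable A -> measurable B -> A `<=` B ->
  fine (P (B `\` A)) = fine (P B) - fine (P A).
Proof.
move=> mA mB AB; rewrite measureD//; last by rewrite ltey_eq fin_num_measure.
rewrite (setIidr AB) fineB ?fin_num_measure//.
Qed.

(** The fine accuracy [eps] is asked of increments at the single level [j], whereas the cell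
    frequencies have a fixed accuracy [kap]. The last clause keeps the sample off null cells. *)
Definition typical {I : finType} (cell : R * R -> I) (j n : nat) (eps kap : R)
    (z : nat -> R * R) : Prop :=
  [/\ forall md, grid_steps_le lo1 len1 lo2 len2
        (fun s t => emp n z (quad md s t) - m md s t) j eps,
     forall c, `|emp n z (cell @^-1` [set c]) - cell_mass P cell c| <= kap
   & forall c, cell_mass P cell c = 0 -> emp n z (cell @^-1` [set c]) = 0 :> R].

Lemma typical_event {I : finType} (cell : R * R -> I) (j n : nat) (eps kap : R) :
  (forall c, measurable (cell @^-1` [set c])) -> (0 < n)%N ->
  0 <= eps <= C / 2 ^+ j -> 0 <= kap <= 1 ->
  exists bad : set T, [/\ measurable bad,
    (Pr bad <= (48 * 4 ^+ j * expR (- (n%:R * eps ^+ 2 / (4 * (C / 2 ^+ j)))) +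
       #|I|%:R * (2 * expR (- (n%:R * kap ^+ 2 / (4 * 1)))))%:E)%E
    & forall w, ~ bad w -> typical cell j n eps kap (Z ^~ w)].
Proof.
move=> mc n0 he hkap.
have hk : `I_n `<=` @setT nat by [].
have [b1 [m1 p1 g1]] := level_event hZ hk n0 probability_setD len1_ge0 len2_ge0 he
  (fun md i l => steps1 md (j := j) (i := i) (l := l)) (fun md i l => steps2 md (j := j) (i := i) (l := l)).
have le1 c : fine (P (cell @^-1` [set c])) <= 1.
  by rewrite -lee_fin fineK ?fin_num_measure// probability_le1.
have h2 c := iid_bernstein hZ hk n0 (mc c) (le1 c) hkap.
pose b2 c := [set w | kap <= `|emp n (Z ^~ w) (cell @^-1` [set c]) - fine (P (cell @^-1` [set c]))|].
have h3 c : exists bad : set T, [/\ measurable bad, Pr bad = 0%E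
    & forall w, ~ bad w -> cell_mass P cell c = 0 -> emp n (Z ^~ w) (cell @^-1` [set c]) = 0 :> R].
  have [c0|c0] := eqVneq (cell_mass P cell c) 0; last first.
    by exists set0; split=> // w _ h; rewrite h eqxx in c0.
  have Pc0 : P (cell @^-1` [set c]) = 0%E.
    by rewrite -[LHS]fineK ?fin_num_measure// -/(cell_mass P cell c) c0.
  have [bad [? ? h]] := null_event hZ hk (mc c) Pc0.
  by exists bad; split=> // w /h.
have [b3 hb3] := choice h3.
have mb2 : measurable (\bigcup_c b2 c).
  by apply: fin_bigcup_measurable; [exact: finite_finset|move=> c _; have [] := h2 c].
have mb3 : measurable (\bigcup_c b3 c).
  by apply: fin_bigcup_measurable; [exact: finite_finset|move=> c _; have [] := hb3 c].
exists (b1 `|` (\bigcup_c b2 c) `|` (\bigcup_c b3 c)); split.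
- by do 2?[apply: measurableU => //].
- apply: le_trans (probability_setU_le _ (measurableU _ _ m1 mb2) mb3) _.
  have -> : Pr (\bigcup_c b3 c) = 0%E.
    apply/eqP; rewrite eq_le measure_ge0 andbT.
    apply: le_trans (measure_finType_bigcup_le _ _) _; first by move=> c; have [] := hb3 c.
    by rewrite big1// => c _; have [] := hb3 c.
  rewrite adde0; apply: le_trans (probability_setU_le _ m1 mb2) _.
  rewrite EFinD; apply: leeD => //.
  apply: le_trans (measure_finType_bigcup_le _ _) _; first by move=> c; have [] := h2 c.
  apply: (@le_trans _ _ (\sum_(c : I) (2 * expR (- (n%:R * kap ^+ 2 / (4 * 1))))%:E)%E).
    by apply: lee_sum => c _; have [] := h2 c.
  by rewrite sumEFin lee_fin sumr_const -[leLHS]mulr_natl.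
- move=> w hw; split.
  + by apply: g1 => h; apply: hw; left; left.
  + move=> c; rewrite leNgt; apply/negP => h; apply: hw; left; right; exists c => //.
    exact: ltW h.
  + move=> c; have [_ _] := hb3 c; apply=> h; apply: hw; right; by exists c.
Qed.

End data_event.

(** Here [y = 2 ^ J] is of order [1 / (kp a)] and the exponent is at least [c n a]. The sixth power
    is chosen to turn [a ^ -2 * (n a) ^ -6] into [n ^ -2 * (n a ^ 2) ^ -4], with [n a ^ 2 >= 1]. *)
Lemma cell_count_expR_le {R : realType} (C kp th a y n F : R) : 0 < C -> 0 < kp -> 0 < th ->
  0 < a -> 0 < n -> 0 < y -> 1 <= n * a ^+ 2 -> kp * a / 2 <= y^-1 -> y^-1 <= kp * a ->
  0 <= F -> (forall x : R, 0 < x -> expR (- x) <= F / x ^+ 6) ->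
  y ^+ 2 * expR (- (n * (th * a) ^+ 2 / (4 * (C / y)))) <=
    4 * F / (kp ^+ 2 * (th ^+ 2 / (4 * C * kp)) ^+ 6) / n ^+ 2.
Proof.
move=> C0 kp0 th0 a0 n0 y0 na y1 y2 F0 hF.
set c := th ^+ 2 / (4 * C * kp).
have c0 : 0 < c by rewrite /c divr_gt0 ?exprn_gt0 ?mulr_gt0.
have cna : 0 < c * n * a by exact: mulr_gt0 (mulr_gt0 c0 n0) a0.
have kpa : 0 < kp * a by rewrite mulr_gt0.
have yl : 1 <= y * (kp * a) by rewrite mulrC -ler_pdivrMr// div1r.
have yu : y <= 2 / (kp * a).
  rewrite ler_pdivlMr// mulrC -ler_pdivlMr//; move: y1; set iy := y^-1; lra.
have h1 : c * n * a <= n * (th * a) ^+ 2 / (4 * (C / y)).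
  have -> : n * (th * a) ^+ 2 / (4 * (C / y)) = c * n * a * (y * (kp * a)).
    by rewrite /c; field; rewrite !gt_eqF.
  by rewrite ler_peMr// ltW.
have h2 : expR (- (n * (th * a) ^+ 2 / (4 * (C / y)))) <= F / (c * n * a) ^+ 6.
  by apply: le_trans (hF _ cna); rewrite ler_expR lerN2.
apply: (@le_trans _ _ ((2 / (kp * a)) ^+ 2 * (F / (c * n * a) ^+ 6))).
  by apply: ler_pM; rewrite ?expR_ge0 ?sqr_ge0// lerXn2r ?nnegrE ?(ltW y0)// divr_ge0 ?(ltW kpa).
have -> : (2 / (kp * a)) ^+ 2 * (F / (c * n * a) ^+ 6) =
   4 * F / (kp ^+ 2 * c ^+ 6) / n ^+ 2 / (n * a ^+ 2) ^+ 4.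
  by field; rewrite !gt_eqF.
rewrite ler_pdivrMr ?exprn_gt0 ?(lt_le_trans ltr01 na)//.
rewrite ler_peMr ?exprn_ege1//.
have c60 : 0 < kp ^+ 2 * c ^+ 6 by rewrite mulr_gt0 ?exprn_gt0.
by rewrite divr_ge0 ?sqr_ge0// divr_ge0 ?(ltW c60)// mulr_ge0.
Qed.

Section typical_eventually.
Context {d} {T : measurableType d} {R : realType}.
Variables (Pr : probability T R) (Z : nat -> T -> R * R) (P : probability (R * R)%type R).
Hypothesis hZ : iid_with_law Pr setT Z P.
Variables (lo1 len1 lo2 len2 C : R).
Hypotheses (len1_ge0 : 0 <= len1) (len2_ge0 : 0 <= len2) (C_gt0 : 0 < C).
Local Notation p := (grid lo1 len1).
Local Notation q := (grid lo2 len2).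
Local Notation m md s t := (fine (P (quad md s t))).
Hypothesis steps1 : forall j md i l, (i < 2 ^ j)%N -> (l <= 2 ^ j)%N ->
  m md (p j i.+1) (q j l) - m md (p j i) (q j l) <= C / 2 ^+ j.
Hypothesis steps2 : forall j md i l, (i <= 2 ^ j)%N -> (l < 2 ^ j)%N ->
  m md (p j i) (q j l.+1) - m md (p j i) (q j l) <= C / 2 ^+ j.

(** Both terms of the bound in [typical_event] are at most a constant over [n ^ 2]: the first by
    [cell_count_expR_le], the second because [expR (- x) <= 2 / x ^ 2]. Then Borel-Cantelli
    applies. *)
Lemma typical_eventually {I : finType} (cell : R * R -> I) (a_ : nat -> R) (J : nat -> nat)
    (kp th kap : R) (N1 : nat) :
  (forall c, measurable (cell @^-1` [set c])) ->
  0 < kp -> 0 < th -> th <= C * kp / 2 -> 0 < kap -> kap <= 1 ->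
  (forall n, (N1 <= n)%N -> [/\ (0 < n)%N, 0 < a_ n, 1 <= n%:R * a_ n ^+ 2
     & kp * a_ n / 2 <= (2 ^+ J n)^-1 <= kp * a_ n]) ->
  exists E : nat -> set T, [/\ forall n, measurable (E n), eventually_as Pr E
    & forall n w, (N1 <= n)%N -> E n w ->
        typical P lo1 len1 lo2 len2 cell (J n) n (th * a_ n) kap (Z ^~ w)].
Proof.
move=> mc kp0 th0 hth kap0 kap1 hN.
pose F (n : nat) : R := (n`!)%:R.
pose c := th ^+ 2 / (4 * C * kp).
have c0 : 0 < c by rewrite /c divr_gt0 ?exprn_gt0 ?mulr_gt0.
pose K1 : R := 48 * (4 * F 6%N / (kp ^+ 2 * c ^+ 6)).
pose K2 : R := #|I|%:R * (2 * (F 2%N * 16 / kap ^+ 4)).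
have F0 n : 0 <= F n by rewrite /F.
have hF n (x : R) : 0 < x -> expR (- x) <= F n / x ^+ n by exact: expRN_le.
clearbody F.
have K10 : 0 <= K1.
  rewrite /K1 mulr_ge0// divr_ge0//; first by rewrite mulr_ge0.
  by rewrite mulr_ge0 ?exprn_ge0 ?(ltW kp0) ?(ltW c0).
have K20 : 0 <= K2.
  by rewrite /K2 mulr_ge0// mulr_ge0// divr_ge0 ?mulr_ge0 ?exprn_ge0 ?(ltW kap0).
have ev n : exists bad : set T, [/\ measurable bad,
    (0 < n)%N -> (Pr bad <= ((K1 + K2) / n%:R ^+ 2)%:E)%E
    & (N1 <= n)%N -> forall w, ~ bad w ->
        typical P lo1 len1 lo2 len2 cell (J n) n (th * a_ n) kap (Z ^~ w)].
  have [Nn|Nn] := leqP N1 n; last first.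
    exists set0; split=> // n0; rewrite measure0 lee_fin divr_ge0 ?addr_ge0//.
  have [n0 a0 na /andP[y1 y2]] := hN _ Nn.
  have y0 : 0 < (2 ^+ J n)^-1 :> R by rewrite invr_gt0 exprn_gt0.
  have he : 0 <= th * a_ n <= C / 2 ^+ J n.
    rewrite mulr_ge0 ?(ltW th0) ?(ltW a0)//=.
    apply: (@le_trans _ _ (C * (kp * a_ n / 2))); last by rewrite ler_wpM2l// ltW.
    have := ler_wpM2r (ltW a0) hth; lra.
  have hkap : 0 <= kap <= 1 by rewrite (ltW kap0).
  have [bad [b1 b2 b3]] := typical_event hZ len1_ge0 len2_ge0 steps1 steps2 mc n0 he hkap.
  exists bad; split=> // _; apply: (le_trans b2); rewrite lee_fin [leRHS]mulrDl.
  have nR : 0 < n%:R :> R by rewrite ltr0n.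
  apply: lerD.
    rewrite -[leLHS]mulrA -[leRHS]mulrA ler_wpM2l//.
    rewrite (_ : 4 ^+ J n = (2 ^+ J n) ^+ 2); last first.
      by rewrite -exprM mulnC exprM; congr (_ ^+ _); rewrite expr2 -natrM.
    by apply: cell_count_expR_le => //; exact: hF.
  rewrite /K2 -[leRHS]mulrA ler_wpM2l// -[leRHS]mulrA ler_wpM2l// mulr1.
  apply: le_trans (hF 2%N _ _) _; first by rewrite divr_gt0 ?mulr_gt0 ?exprn_gt0.
  rewrite le_eqVlt; apply/orP; left; apply/eqP.
  by field; rewrite !gt_eqF.
have [bad hbad] := choice ev.
exists (fun n => ~` bad n); split.
- by move=> n; apply: measurableC; have [] := hbad n.
- apply: (@borel_cantelli _ _ _ _ _ (K1 + K2)) => n; first by have [] := hbad n.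
  by have [_ + _] := hbad n.
- by move=> n w Nn nb; have [_ _] := hbad n; apply.
Qed.
End typical_eventually.

(** * Expansion of the bootstrap copula *)

Section box_estimates.
Context {R : realType} (P : probability (R * R)%type R).
Local Notation mass md s t := (fine (P (quad md s t))).

Lemma probability_quad_le md (s s' t t' : R) : s <= s' -> t <= t' -> mass md s t <= mass md s' t'.
Proof.
move=> ss tt; apply: fine_le; rewrite ?fin_num_measure//; do ?exact: measurable_quad.
by apply: le_measure; rewrite ?inE; do ?exact: measurable_quad; exact: quad_sub.
Qed.

Lemma fine_le_measure A B : measurable A -> measurable B -> A `<=` B -> fine (P A) <= fine (P B).
Proof.
by move=> mA mB AB; apply: fine_le; rewrite ?fin_num_measure//; apply: le_measure; rewrite ?inE.
Qed.

(** The common part of [A] and [B] cancels, so only the two set differences count. *)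
Lemma energy_le_sqrB r q A B : energy_le P r q -> measurable A -> measurable B ->
  (q A - q B) ^+ 2 <= 4 * r * (fine (P (A `\` B)) + fine (P (B `\` A))).
Proof.
move=> hq mA mB; have mAB : measurable (A `\` B) by exact: measurableD.
have mBA : measurable (B `\` A) by exact: measurableD.
have mI : measurable (A `&` B) by exact: measurableI.
have h1 := energy_le_sqr hq mAB; have h2 := energy_le_sqr hq mBA.
have -> : q A - q B = q (A `\` B) - q (B `\` A).
  case: hq => hadd _ _.
  have split A' B' : measurable A' -> measurable B' -> q A' = q (A' `&` B') + q (A' `\` B').
    move=> mA' mB'; rewrite -hadd; first by rewrite setUIDK.
    - exact: measurableI.
    - exact: measurableD.
    - by apply/seteqP; split=> z // [[_ Bz] [_ /(_ Bz)]].
  rewrite (split A B)// (split B A)// (setIC B).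
  ring.
move: h1 h2; set x := q _; set y := q _; set s := fine _; set t := fine _.
clearbody x y s t; move: (sqr_ge0 (x + y)); clear; rewrite !expr2; lra.
Qed.

(** The bound [sqrt (2 r) <= 2 r + 1] keeps square roots out of the constants. *)
Lemma energy_norm_le r q A : energy_le P r q -> measurable A -> `|q A| <= 2 * r + 1.
Proof.
move=> hq mA; have r0 := energy_ge0 hq.
have PA1 : fine (P A) <= 1 by rewrite -lee_fin fineK ?fin_num_measure// probability_le1.
have h1 : q A ^+ 2 <= 2 * r.
  by apply: (le_trans (energy_le_sqr hq mA)); rewrite ler_piMr// mulr_ge0.
rewrite -ler_sqr ?nnegrE ?addr_ge0 ?mulr_ge0// real_normK ?num_real//.
apply: (le_trans h1); rewrite -subr_ge0.
by rewrite (_ : _ - _ = 4 * r * r + 2 * r + 1) ?addr_ge0 ?mulr_ge0//; ring.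
Qed.

Variables (lo1 len1 lo2 len2 L : R).
Hypotheses (len1_ge0 : 0 <= len1) (len2_ge0 : 0 <= len2) (L_gt0 : 0 < L).
Hypothesis lip1 : forall s s', lo1 <= s -> s <= s' -> s' <= lo1 + len1 ->
  left_df P s' - left_df P s <= L * (s' - s).
Hypothesis lip2 : forall t t', lo2 <= t -> t <= t' -> t' <= lo2 + len2 ->
  right_df P t' - right_df P t <= L * (t' - t).
Local Notation p := (grid lo1 len1).
Local Notation q := (grid lo2 len2).
Local Notation C := (L * (len1 + len2)).

Lemma mass_lipl md s s' t : lo1 <= s -> s <= s' -> s' <= lo1 + len1 ->
  mass md s' t - mass md s t <= L * (s' - s).
Proof.
move=> s1 ss s2; apply: le_trans (lip1 s1 ss s2).
have mq md0 x y := @measurable_quad R md0 x y.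
have mD md0 x y x' y' := measurableD (mq md0 x y) (mq md0 x' y').
have -> : left_df P s' - left_df P s = mass (Some true) s' t - mass (Some true) s t by [].
rewrite -!probability_setD//; do ?exact: quad_sub.
by apply: fine_le_measure => //; exact: quad_stripl.
Qed.

Lemma mass_lipr md s t t' : lo2 <= t -> t <= t' -> t' <= lo2 + len2 ->
  mass md s t' - mass md s t <= L * (t' - t).
Proof.
move=> t1 tt t2; apply: le_trans (lip2 t1 tt t2).
have mq md0 x y := @measurable_quad R md0 x y.
have mD md0 x y x' y' := measurableD (mq md0 x y) (mq md0 x' y').
have -> : right_df P t' - right_df P t = mass (Some false) s t' - mass (Some false) s t by [].
rewrite -!probability_setD//; do ?exact: quad_sub.
by apply: fine_le_measure => //; exact: quad_stripr.
Qed.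

Lemma grid_in (lo len : R) j i : 0 <= len -> (i <= 2 ^ j)%N -> lo <= grid lo len j i <= lo + len.
Proof.
move=> l0 ij; rewrite -{1}(grid0 lo len j) -(grid_last lo len j).
by rewrite !grid_le.
Qed.

Lemma grid_next (lo len : R) j i : grid lo len j i.+1 - grid lo len j i = len / 2 ^+ j :> R.
Proof. by rewrite gridB -natr1; ring. Qed.

Lemma mass_steps j md i l :
  ((i < 2 ^ j)%N -> mass md (p j i.+1) (q j l) - mass md (p j i) (q j l) <= L * len1 / 2 ^+ j) /\
  ((l < 2 ^ j)%N -> mass md (p j i) (q j l.+1) - mass md (p j i) (q j l) <= L * len2 / 2 ^+ j).
Proof.
split=> h.
  have /andP[a1 _] := grid_in lo1 len1_ge0 (ltnW h); have /andP[_ a2] := grid_in lo1 len1_ge0 h.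
  by rewrite (le_trans (mass_lipl _ _ _ _ _))// ?grid_le// grid_next mulrA.
have /andP[a1 _] := grid_in lo2 len2_ge0 (ltnW h); have /andP[_ a2] := grid_in lo2 len2_ge0 h.
by rewrite (le_trans (mass_lipr _ _ _ _ _))// ?grid_le// grid_next mulrA.
Qed.

Lemma mass_diagonal j md i l : (i < 2 ^ j)%N -> (l < 2 ^ j)%N ->
  mass md (p j i.+1) (q j l.+1) - mass md (p j i) (q j l) <= C / 2 ^+ j.
Proof.
move=> hi hl; have := (mass_steps j md i l.+1).1 hi; have := (mass_steps j md i l).2 hl.
by rewrite mulrDr mulrDl; lra.
Qed.

Lemma mass_steps1 j md i l : (i < 2 ^ j)%N -> (l <= 2 ^ j)%N ->
  mass md (p j i.+1) (q j l) - mass md (p j i) (q j l) <= C / 2 ^+ j.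
Proof.
move=> hi _; apply: le_trans ((mass_steps j md i l).1 hi) _.
by rewrite ler_wpM2r ?invr_ge0 ?exprn_ge0// ler_wpM2l ?(ltW L_gt0)// lerDl.
Qed.

Lemma mass_steps2 j md i l : (i <= 2 ^ j)%N -> (l < 2 ^ j)%N ->
  mass md (p j i) (q j l.+1) - mass md (p j i) (q j l) <= C / 2 ^+ j.
Proof.
move=> _ hl; apply: le_trans ((mass_steps j md i l).2 hl) _.
by rewrite ler_wpM2r ?invr_ge0 ?exprn_ge0// ler_wpM2l ?(ltW L_gt0)// lerDr.
Qed.

Lemma mass_setD_le md (s t x y : R) : in_box lo1 len1 lo2 len2 s t ->
  in_box lo1 len1 lo2 len2 x y ->
  fine (P (quad md s t `\` quad md x y)) <= L * (`|s - x| + `|t - y|).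
Proof.
move=> [/andP[s1 s2] /andP[t1 t2]] [/andP[x1 x2] /andP[y1 y2]].
have mq md0 u v := @measurable_quad R md0 u v.
pose s' := Num.max s x; pose t' := Num.max t y.
have ss : s <= s' by rewrite le_max lexx.
have xs : x <= s' by rewrite le_max lexx orbT.
have tt : t <= t' by rewrite le_max lexx.
have yt : y <= t' by rewrite le_max lexx orbT.
have s'2 : s' <= lo1 + len1 by rewrite ge_max s2.
have t'2 : t' <= lo2 + len2 by rewrite ge_max t2.
have sx : s' - x <= `|s - x|.
  by rewrite lerBlDr ge_max lerDr normr_ge0 andbT -lerBlDr ler_norm.
have ty : t' - y <= `|t - y|.
  by rewrite lerBlDr ge_max lerDr normr_ge0 andbT -lerBlDr ler_norm.
have h1 := mass_lipl md t' x1 xs s'2; have h2 := mass_lipr md x y1 yt t'2.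
apply: (@le_trans _ _ (fine (P (quad md s' t' `\` quad md x y)))).
  apply: fine_le_measure; do ?[exact: measurableD]; by apply: setSD; exact: quad_sub.
rewrite probability_setD//; last exact: quad_sub.
have := ler_wpM2l (ltW L_gt0) sx; have := ler_wpM2l (ltW L_gt0) ty; rewrite mulrDr; lra.
Qed.

(** Cauchy-Schwarz on the symmetric difference of the two sets, whose mass is Lipschitz in the
    corners. All set functions of energy at most [r] share this modulus; this equicontinuity serves
    the delta method and the compactness argument. *)
Lemma energy_modulus r (e : set (R * R) -> R) md (s t x y : R) : energy_le P r e ->
  in_box lo1 len1 lo2 len2 s t -> in_box lo1 len1 lo2 len2 x y ->
  (e (quad md s t) - e (quad md x y)) ^+ 2 <= 8 * r * L * (`|s - x| + `|t - y|).
Proof.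
move=> he hs hx; have r0 := energy_ge0 he.
apply: le_trans (energy_le_sqrB he (measurable_quad _ _ _) (measurable_quad _ _ _)) _.
have := mass_setD_le md hs hx; have := mass_setD_le md hx hs.
rewrite (distrC x) (distrC y); set a := fine _; set b := fine _; set w := L * _.
have -> : 8 * r * L * (`|s - x| + `|t - y|) = 4 * r * (w + w) by rewrite /w; ring.
clearbody a b w => h1 h2.
by rewrite ler_wpM2l ?mulr_ge0// lerD.
Qed.

Lemma probability_cells {I : finType} (cell : R * R -> I) (E : pred I) :
  (forall c, measurable (cell @^-1` [set c])) ->
  fine (P (cell @^-1` [set` E])) = \sum_(c | E c) cell_mass P cell c.
Proof.
move=> mc; rewrite (_ : _ @^-1` _ = \bigcup_(c in [set` E]) cell @^-1` [set c]); last first.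
  by apply/seteqP; split=> [z' h|z' [c Ec /= ->]//]; exists (cell z').
rewrite measure_finType_bigcup//; last by move=> i j t /= -> ->.
apply: EFin_inj; rewrite fineK; last by apply/sum_fin_numP => c _ _; exact: fin_num_measure.
by rewrite -sumEFin; apply: eq_bigr => c _; rewrite /cell_mass fineK ?fin_num_measure.
Qed.

End box_estimates.

Section typical_data.
Context {R : realType} (P : probability (R * R)%type R).
Variables (lo1 len1 lo2 len2 L : R).
Hypotheses (len1_gt0 : 0 < len1) (len2_gt0 : 0 < len2) (L_gt0 : 0 < L).
Hypothesis lip1 : forall s s', lo1 <= s -> s <= s' -> s' <= lo1 + len1 ->
  left_df P s' - left_df P s <= L * (s' - s).
Hypothesis lip2 : forall t t', lo2 <= t -> t <= t' -> t' <= lo2 + len2 ->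
  right_df P t' - right_df P t <= L * (t' - t).
Variables (J0 J n : nat) (eps kap : R) (z : nat -> R * R).
Local Notation mass md s t := (fine (P (quad md s t))).
Local Notation p := (grid lo1 len1).
Local Notation q := (grid lo2 len2).
Local Notation C := (L * (len1 + len2)).
Local Notation cell := (coarse_cell lo1 len1 lo2 len2 J0).
Local Notation nc := (#|{ffun 'I_(2 ^ J0).+1 * bool -> bool}|%:R : R).
Hypothesis hz : typical P lo1 len1 lo2 len2 cell J n eps kap z.
Let len1_ge0 := ltW len1_gt0.
Let len2_ge0 := ltW len2_gt0.

Lemma quad_monotone2 md : monotone2 (fun s t => mass md s t).
Proof. by move=> s s' t t' ss tt; exact: probability_quad_le. Qed.

Lemma coarse_point_diff (nu nu' : set (R * R) -> R) (del : R) md i l :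
  (forall E : pred {ffun 'I_(2 ^ J0).+1 * bool -> bool},
     nu (cell @^-1` [set` E]) = \sum_(c | E c) nu (cell @^-1` [set c])) ->
  (forall E : pred {ffun 'I_(2 ^ J0).+1 * bool -> bool},
     nu' (cell @^-1` [set` E]) = \sum_(c | E c) nu' (cell @^-1` [set c])) ->
  0 <= del -> (forall c, `|nu (cell @^-1` [set c]) - nu' (cell @^-1` [set c])| <= del) ->
  (i <= 2 ^ J0)%N -> (l <= 2 ^ J0)%N ->
  `|nu (quad md (p J0 i) (q J0 l)) - nu' (quad md (p J0 i) (q J0 l))| <= nc * del.
Proof.
move=> h1 h2 del0 h hi hl.
have [E ->] := quad_coarse_cells lo1 len1 lo2 len2 md hi hl.
rewrite h1 h2 -sumrB (le_trans (ler_norm_sum _ _ _))//.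
apply: (@le_trans _ _ (\sum_(c : {ffun 'I_(2 ^ J0).+1 * bool -> bool}) del)).
  rewrite [leRHS](bigID E)/=; apply: (@le_trans _ _ (\sum_(c | E c) del)).
    by apply: ler_sum.
  by rewrite lerDl sumr_ge0.
by rewrite sumr_const -[leLHS]mulr_natl.
Qed.

(** At coarse grid points the error is at most one [kap] per cell; between them monotonicity adds an
    increment of the law over one mesh. *)
Lemma typical_consistency md s t : 0 <= kap -> in_box lo1 len1 lo2 len2 s t ->
  `|emp n z (quad md s t) - mass md s t| <= 3 * (nc * kap) + C / 2 ^+ J0.
Proof.
move=> kap0 [hs ht]; have [_ hc _] := hz.
have [i iJ si] := grid_locate J0 len1_gt0 hs.
have [l lJ tl] := grid_locate J0 len2_gt0 ht.
have mc := @measurable_coarse_cell R lo1 len1 lo2 len2 J0.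
have cd i' l' : (i' <= 2 ^ J0)%N -> (l' <= 2 ^ J0)%N ->
    `|emp n z (quad md (p J0 i') (q J0 l')) - mass md (p J0 i') (q J0 l')| <= nc * kap.
  apply: (@coarse_point_diff (emp n z) (fun A => fine (P A))) => //.
  - by move=> E; exact: emp_cells.
  - by move=> E; exact: probability_cells.
have := monotone_residual (@quad_monotone2 md) (@emp_monotone2 R n z md) si tl.
have := cd i l (ltnW iJ) (ltnW lJ); have := cd i.+1 l.+1 iJ lJ.
have := mass_diagonal len1_ge0 len2_ge0 lip1 lip2 md iJ lJ.
cbv beta.
set a3 := emp _ _ (quad _ s t) - _; set a1 := emp _ _ _ - _; set a2 := emp _ _ _ - _.
set mm := fine _ - fine _; set N := nc * kap; set CC := C / _.
clearbody a1 a2 a3 mm N CC; rewrite !ler_norml => h1 /andP[h2 h3] /andP[h4 h5].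
have h6 : `|a2 - a1| <= 2 * N by rewrite ler_norml; apply/andP; split; lra.
by move=> /andP[h7 h8]; apply/andP; split; lra.
Qed.

(** [typical] speaks of level [J] only, but a step of a coarser level [j] consists of [2 ^ (J - j)]
    steps of level [J]. This supplies the mass bounds for Bernstein's inequality when the sample is
    the law of the bootstrap. *)
Lemma typical_steps md j i l : (j <= J)%N ->
  ((i < 2 ^ j)%N -> (l <= 2 ^ j)%N ->
    emp n z (quad md (p j i.+1) (q j l)) - emp n z (quad md (p j i) (q j l)) <=
      L * len1 / 2 ^+ j + 2 ^+ (J - j) * eps) /\
  ((i <= 2 ^ j)%N -> (l < 2 ^ j)%N ->
    emp n z (quad md (p j i) (q j l.+1)) - emp n z (quad md (p j i) (q j l)) <=
      L * len2 / 2 ^+ j + 2 ^+ (J - j) * eps).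
Proof.
move=> jJ; have [hst _ _] := hz; have [st1 st2] := hst md.
have pE lo len k : grid lo len j k = grid lo len J (k * 2 ^ (J - j)) :> R.
  by rewrite -(grid_coarsen lo len j (J - j) k) subnKC.
have kJ k : (k <= 2 ^ j)%N -> (k * 2 ^ (J - j) <= 2 ^ J)%N.
  by move=> k2; rewrite -[X in (_ <= 2 ^ X)%N](subnKC jJ) expnD leq_mul2r k2 orbT.
have wid k : ((k.+1 * 2 ^ (J - j))%:R - (k * 2 ^ (J - j))%:R : R) = 2 ^+ (J - j).
  by rewrite mulSn natrD addrK natrX.
split=> hi hl.
  have := @step_sum R (fun i => emp n z (quad md (p J i) (q j l)) - mass md (p J i) (q j l))
    eps (2 ^ J) _ (i * 2 ^ (J - j)) (i.+1 * 2 ^ (J - j)).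
  rewrite -!pE leq_mul2r leqnSn orbT wid (kJ i.+1)// => h.
  have {}h := h _ isT isT.
  have := (mass_steps len1_ge0 len2_ge0 lip1 lip2 j md i l).1 hi.
  have {}h := le_trans (ler_norm _) (h _).
  have /h : forall k, (k < 2 ^ J)%N ->
      `|(emp n z (quad md (p J k.+1) (q j l)) - mass md (p J k.+1) (q j l)) -
        (emp n z (quad md (p J k) (q j l)) - mass md (p J k) (q j l))| <= eps.
    by move=> k hk; rewrite (pE lo2); exact: st1 _ _ hk (kJ l hl).
  lra.
have := @step_sum R (fun l => emp n z (quad md (p j i) (q J l)) - mass md (p j i) (q J l))
    eps (2 ^ J) _ (l * 2 ^ (J - j)) (l.+1 * 2 ^ (J - j)).
rewrite -!pE leq_mul2r leqnSn orbT wid (kJ l.+1)// => h.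
have {}h := h _ isT isT.
have := (mass_steps len1_ge0 len2_ge0 lip1 lip2 j md i l).2 hl.
have {}h := le_trans (ler_norm _) (h _).
have /h : forall k, (k < 2 ^ J)%N ->
    `|(emp n z (quad md (p j i) (q J k.+1)) - mass md (p j i) (q J k.+1)) -
      (emp n z (quad md (p j i) (q J k)) - mass md (p j i) (q J k))| <= eps.
  by move=> k hk; rewrite (pE lo1); exact: st2 _ _ (kJ i hi) hk.
lra.
Qed.

End typical_data.

Lemma geometric_sum_le {R : realType} (J0 N : nat) :
  \sum_(k < N) (3 / 4) ^+ (J0 + k).+1 <= 3 :> R.
Proof.
suff h : \sum_(k < N) (3 / 4) ^+ (J0 + k).+1 <= 3 * (1 - (3 / 4) ^+ N) :> R.
  by apply: (le_trans h); rewrite ler_piMr// lerBlDr lerDl exprn_ge0//; lra.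
elim: N => [|N IH]; first by rewrite big_ord0 expr0 subrr mulr0.
rewrite big_ord_recr/=.
have h : (3 / 4) ^+ (J0 + N).+1 <= (3 / 4) ^+ N * (3 / 4) :> R.
  by rewrite -exprSr ler_wiXn2l ?ltnS ?leq_addl//; lra.
rewrite [in leRHS]exprSr; lra.
Qed.

Section bootstrap_closeness.
Context {R : realType} (P : probability (R * R)%type R).
Variables (lo1 len1 lo2 len2 L : R).
Hypotheses (len1_gt0 : 0 < len1) (len2_gt0 : 0 < len2) (L_gt0 : 0 < L).
Hypothesis lip1 : forall s s', lo1 <= s -> s <= s' -> s' <= lo1 + len1 ->
  left_df P s' - left_df P s <= L * (s' - s).
Hypothesis lip2 : forall t t', lo2 <= t -> t <= t' -> t' <= lo2 + len2 ->
  right_df P t' - right_df P t <= L * (t' - t).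
Variables (J0 J n k : nat) (a d0 del' D eps kap r : R) (z zb : nat -> R * R).
Variable e : set (R * R) -> R.
Local Notation mass md s t := (fine (P (quad md s t))).
Local Notation p := (grid lo1 len1).
Local Notation q := (grid lo2 len2).
Local Notation C := (L * (len1 + len2)).
Local Notation cell := (coarse_cell lo1 len1 lo2 len2 J0).
Local Notation nc := (#|{ffun 'I_(2 ^ J0).+1 * bool -> bool}|%:R : R).
Hypothesis hz : typical P lo1 len1 lo2 len2 cell J n eps kap z.
Hypothesis J0J : (J0 < J)%N.
Hypotheses (a_gt0 : 0 < a) (d0_gt0 : 0 < d0) (del'_ge0 : 0 <= del') (D_ge0 : 0 <= D).
Hypothesis steps : forall md j, (J0 < j <= J)%N -> grid_steps_le lo1 len1 lo2 len2
  (fun s t => emp k zb (quad md s t) - emp n z (quad md s t)) j (a * d0 * (3 / 4) ^+ j).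
Hypothesis he : energy_le P r e.
Hypothesis hcells : forall c, `|emp k zb (cell @^-1` [set c]) - emp n z (cell @^-1` [set c])
  - a * e (cell @^-1` [set c])| <= a * del'.
Hypothesis hD : 8 * r * L * ((len1 + len2) / 2 ^+ J0) <= D ^+ 2.

(** The terms are the residual below the finest level, the chaining errors ([6 * (a * d0)] from the
    geometric sum and [2 * (a * d0)] from the last level), the error on the coarse cells, and the
    variation of [e] within a coarse mesh. *)
Lemma bootstrap_closeness md s t : in_box lo1 len1 lo2 len2 s t ->
  `|emp k zb (quad md s t) - emp n z (quad md s t) - a * e (quad md s t)| <=
  (C / 2 ^+ J + 2 * eps) + 8 * (a * d0) + nc * (a * del') + a * D.
Proof.
move=> hs; have r0 := energy_ge0 he.
have mc := @measurable_coarse_cell R lo1 len1 lo2 len2 J0.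
have JE : J = (J0 + (J - J0))%N by rewrite subnKC// ltnW.
have hw i l : (i < 2 ^ (J0 + (J - J0)))%N -> (l < 2 ^ (J0 + (J - J0)))%N ->
    emp n z (quad md (p (J0 + (J - J0)) i.+1) (q (J0 + (J - J0)) l.+1)) -
    emp n z (quad md (p (J0 + (J - J0)) i) (q (J0 + (J - J0)) l)) <= C / 2 ^+ J + 2 * eps.
  rewrite -JE => hi hl.
  have [h1 _] := typical_steps len1_gt0 len2_gt0 lip1 lip2 hz md i l.+1 (leqnn J).
  have [_ h2] := typical_steps len1_gt0 len2_gt0 lip1 lip2 hz md i l (leqnn J).
  have := h1 hi hl; have := h2 (ltnW hi) hl; rewrite subnn expr0 mul1r.
  rewrite mulrDr mulrDl; lra.
have J00 : (0 < J - J0)%N by rewrite subn_gt0.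
have [] := grid_uniform_control len1_gt0 len2_gt0 (@emp_monotone2 R n z md)
  (@emp_monotone2 R k zb md) J00 _ hw hs (dl := fun j => a * d0 * (3 / 4) ^+ j).
  by move=> j; rewrite -JE; exact: steps.
move=> i [l [iJ lJ si tl hc]].
have s1 : 2 * \sum_(k0 < J - J0) a * d0 * (3 / 4) ^+ (J0 + k0).+1 <= 6 * (a * d0).
  have ad0 : 0 <= a * d0 by rewrite mulr_ge0// ltW.
  rewrite -mulr_sumr; have := ler_wpM2l ad0 (@geometric_sum_le R J0 (J - J0)); lra.
have s2 : 2 * (a * d0 * (3 / 4) ^+ (J0 + (J - J0))) <= 2 * (a * d0).
  rewrite ler_pM2l// ler_piMr ?mulr_ge0 ?(ltW a_gt0) ?(ltW d0_gt0)//.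
  by rewrite exprn_ile1//; lra.
have s3 : `|emp k zb (quad md (p J0 i) (q J0 l)) -
    (emp n z (quad md (p J0 i) (q J0 l)) + a * e (quad md (p J0 i) (q J0 l)))| <= nc * (a * del').
  apply: (@coarse_point_diff _ lo1 len1 lo2 len2 J0 (emp k zb) (fun A => emp n z A + a * e A)).
  - by move=> E; exact: emp_cells.
  - by move=> E; rewrite emp_cells (energy_cells E he mc) mulr_sumr -big_split.
  - by rewrite mulr_ge0// ltW.
  - by move=> c; have := hcells c; rewrite opprD addrA.
  - exact: ltnW.
  - exact: ltnW.
have hbox : in_box lo1 len1 lo2 len2 (p J0 i) (q J0 l).
  by split; apply: grid_in; rewrite ?ltW// ltnW.
have s4 : `|e (quad md s t) - e (quad md (p J0 i) (q J0 l))| <= D.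
  have := energy_modulus L_gt0 lip1 lip2 md he hs hbox => h.
  rewrite -ler_sqr ?nnegrE// real_normK ?num_real//; apply: (le_trans h).
  apply: le_trans hD; rewrite ler_wpM2l ?mulr_ge0 ?(ltW L_gt0)//.
  rewrite mulrDl; apply: lerD.
    move/andP: si => [? s5]; rewrite ger0_norm ?subr_ge0//.
    by rewrite -(grid_next lo1 len1 J0 i) lerD2r.
  move/andP: tl => [? s5]; rewrite ger0_norm ?subr_ge0//.
  by rewrite -(grid_next lo2 len2 J0 l) lerD2r.
have s5 : `|a * (e (quad md s t) - e (quad md (p J0 i) (q J0 l)))| <= a * D.
  by rewrite normrM gtr0_norm// ler_pM2l.
move: hc s1 s2 s3 s5.
set b1 := emp k zb (quad md s t); set b2 := emp n z (quad md s t).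
set b3 := emp k zb _; set b4 := emp n z (quad md (p _ _) _).
set e1 := e (quad md s t); set e2 := e _; set S := \sum_(_ < _) _; set w := C / _ + _.
set D' := a * D; set N := nc * _; set ad := a * d0; set y := ad * _ ^+ _.
clearbody b1 b2 b3 b4 e1 e2 S w D' N ad y.
rewrite !ler_norml => /andP[? ?] ? ? /andP[? ?] /andP[? ?].
by apply/andP; split; lra.
Qed.

End bootstrap_closeness.

Lemma between_margin {R : realType} (A B x rho : R) : 0 < rho -> A <= x - rho -> x + rho <= B -> A <= x <= B.
Proof. by move=> rho0 h1 h2; apply/andP; split; move: rho0 h1 h2; clear; lra. Qed.

Lemma exists_dyadic_le {R : realType} (x y : R) : 0 <= x -> 0 < y ->
  exists J : nat, forall j, (J <= j)%N -> x / 2 ^+ j <= y.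
Proof.
move=> x0 y0; exists (Num.truncn (x / y)).+1 => j Jj.
rewrite ler_pdivrMr ?exprn_gt0// -ler_pdivrMl// mulrC.
apply: (le_trans (ltW (truncnS_gt _))); rewrite -natrX ler_nat.
exact: leq_trans Jj (ltnW (ltn_expl _ _)).
Qed.

Section copula_derivative.
Context {R : realType}.
Variables (f g : R -> R) (Hx Hy : R -> R -> R).

(** The formula of [dPhi] with values of the set function [e] in place of integrals of a density.
    The coordinate [0] in the half planes is a placeholder without effect. *)
Definition copula_derivative (e : set (R * R) -> R) (x y : R) : R :=
  e (quad None x y) - Hx x y * (e (quad (Some true) x 0) / f x)
  - Hy x y * (e (quad (Some false) 0 y) / g y).

Lemma empirical_dfE k zb :
  [/\ left_df (empirical k zb) = (fun s : R => emp k zb (quad (Some true) s 0)),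
      right_df (empirical k zb) = (fun t : R => emp k zb (quad (Some false) 0 t))
    & joint_df (empirical k zb) = (fun s t : R => emp k zb (quad None s t))].
Proof.
split.
- by apply/funext => s; rewrite /left_df empiricalE.
- by apply/funext => s; rewrite /right_df empiricalE.
- by apply/funext => s; apply/funext => t; rewrite /joint_df empiricalE.
Qed.

End copula_derivative.

(* The constants depend on the accuracy [eta] and on the levels [r] and [Lb]
   only, and neither on the sample nor on its size. *)
Lemma copula_expansion (R : realType) (P : probability (R * R)%type R)
    (lo1 len1 lo2 len2 m L rho0 : R) (f g : R -> R) (Hx Hy : R -> R -> R) :
  0 < len1 -> 0 < len2 -> 0 < L -> 0 < m -> m <= 1 -> 0 < rho0 ->
  smooth_df (left_df P) f lo1 (lo1 + len1) m L ->
  smooth_df (right_df P) g lo2 (lo2 + len2) m L ->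
  smooth_df2 (joint_df P) Hx Hy lo1 (lo1 + len1) lo2 (lo2 + len2) L ->
  forall r eta Lb : R, 0 <= r -> 0 < eta ->
  exists kp th d0 kap del' a0 : R, exists J0 : nat,
  let cell := coarse_cell lo1 len1 lo2 len2 J0 in
  [/\ [/\ 0 < kp, 0 < th, th <= (L * (len1 + len2)) * kp / 2 & 0 < d0],
      [/\ 0 < kap, kap <= 1, 0 < del' & 0 < a0],
      forall j, (J0 <= j)%N -> Lb + 1 + j%:R <= d0 ^+ 2 / (8 * (L * (len1 + len2))) * (9 / 8) ^+ j
    & forall (a : R) (J n : nat) (z : nat -> R * R), 0 < a -> a <= a0 ->
      kp * a / 2 <= (2 ^+ J)^-1 <= kp * a ->
      typical P lo1 len1 lo2 len2 cell J n (th * a) kap z ->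
      [/\ (J0 < J)%N,
          forall j, (J0 < j <= J)%N -> [/\
            forall md i l, (i < 2 ^ j)%N -> (l <= 2 ^ j)%N ->
              emp n z (quad md (grid lo1 len1 j i.+1) (grid lo2 len2 j l)) -
              emp n z (quad md (grid lo1 len1 j i) (grid lo2 len2 j l)) <=
                2 * (L * (len1 + len2)) / 2 ^+ j,
            forall md i l, (i <= 2 ^ j)%N -> (l < 2 ^ j)%N ->
              emp n z (quad md (grid lo1 len1 j i) (grid lo2 len2 j l.+1)) -
              emp n z (quad md (grid lo1 len1 j i) (grid lo2 len2 j l)) <=
                2 * (L * (len1 + len2)) / 2 ^+ j
            & a * d0 * (3 / 4) ^+ j <= 2 * (L * (len1 + len2)) / 2 ^+ j]
        & forall (k : nat) (zb : nat -> R * R) (e : set (R * R) -> R),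
          (forall md j, (J0 < j <= J)%N -> grid_steps_le lo1 len1 lo2 len2
            (fun s t => emp k zb (quad md s t) - emp n z (quad md s t)) j (a * d0 * (3 / 4) ^+ j)) ->
          energy_le P r e ->
          (forall c, `|emp k zb (cell @^-1` [set c]) - emp n z (cell @^-1` [set c])
             - a * e (cell @^-1` [set c])| <= a * del') ->
          forall u v x y, lo1 <= x - rho0 -> x + rho0 <= lo1 + len1 -> left_df P x = u ->
            lo2 <= y - rho0 -> y + rho0 <= lo2 + len2 -> right_df P y = v ->
            `|copula (empirical k zb) (u, v) - copula (empirical n z) (u, v)
              - a * copula_derivative f g Hx Hy e x y| <= eta * a]].
Proof.
move=> len1_gt0 len2_gt0 L_gt0 m_gt0 m_le1 rho0_gt0 hF hG hH r eta Lb r0 eta0.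
have lip1 s s' : lo1 <= s -> s <= s' -> s' <= lo1 + len1 ->
    left_df P s' - left_df P s <= L * (s' - s).
  by move=> h1 h2 h3; have [/(_ _ _ h1 h2 h3)/andP[]] := hF.
have lip2 s s' : lo2 <= s -> s <= s' -> s' <= lo2 + len2 ->
    right_df P s' - right_df P s <= L * (s' - s).
  by move=> h1 h2 h3; have [/(_ _ _ h1 h2 h3)/andP[]] := hG.
have C0 : 0 < (L * (len1 + len2)) by rewrite mulr_gt0// addr_gt0.
(* [B] dominates both the bound [2 r + 1] and the modulus constant [8 r L] of every [e] of energy at
   most [r]. *)
pose B := 8 * r * L + 2 * r + 1.
have rL : 0 <= r * L by rewrite mulr_ge0// ltW.
have B0 : 0 <= B by rewrite /B -mulrA; move: rL r0; clear; lra.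
have [del del0 hdel] := copula_delta m_gt0 m_le1 L_gt0 rho0_gt0 hF hG hH eta0 B0.
pose M := (B + 3) / m; have M0 : 0 < M by rewrite divr_gt0//; move: B0; clear; lra.
pose nmin := Num.min len1 len2; have nmin0 : 0 < nmin by rewrite lt_min len1_gt0.
(* The mesh [2 ^ -J] is of order [kp * a], so that the mass bound of the finest mesh is at most
   [del / 16 * a]. *)
pose kp := del / (16 * (L * (len1 + len2))); have kp0 : 0 < kp by rewrite divr_gt0// mulr_gt0.
have Ckp : L * (len1 + len2) * kp = del / 16.
  by rewrite /kp; move: (L * (len1 + len2)) C0 => c c0; field; rewrite gt_eqF.
have l1 : nmin <= len1 by rewrite ge_min lexx.
have l2 : nmin <= len2 by rewrite ge_min lexx orbT.
clearbody kp nmin.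
(* A distance [M * a] is at most [N] mesh widths, because [2 ^ -J >= kp * a / 2]. *)
pose N := 2 * M / (kp * nmin); have N0 : 0 < N by apply: divr_gt0; exact: mulr_gt0.
have NE : N * (nmin * kp) = 2 * M by rewrite /N (mulrC nmin) divfK// mulf_neq0 ?gt_eqF.
clearbody N.
(* In this order: the condition [eps <= pb] of Bernstein's inequality for the sample, the residual
   below the finest level, and the oscillation over [N] mesh widths. *)
have [|th th0 /and4P[th1 th2 th3 _]] := @exists_lower_bound R
  [:: (L * (len1 + len2)) * kp / 2; del / 32; del / (8 * (N + 3))].
  by rewrite /= Ckp !divr_gt0// mulr_gt0// addr_gt0.
have [d0 d00 d0E] : exists2 d0 : R, 0 < d0 & d0 = del / 32.
  by exists (del / 32); first rewrite divr_gt0.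
have A0 : 0 < d0 ^+ 2 / (8 * (L * (len1 + len2))) by apply: divr_gt0; [exact: exprn_gt0|exact: mulr_gt0].
have [Ja hJa] := geometric_beats_linear Lb A0.
have [||Jb hJb] := @exists_dyadic_le R (8 * r * L * (len1 + len2)) ((del / 8) ^+ 2).
- by rewrite mulr_ge0 ?addr_ge0 ?(ltW len1_gt0) ?(ltW len2_gt0)// -mulrA mulr_ge0.
- by rewrite exprn_gt0// divr_gt0.
have [|Jc hJc] := @exists_dyadic_le R (L * (len1 + len2)) (del / 4) (ltW C0); first by rewrite divr_gt0.
(* The coarse level ensures that the chaining exponents exceed [Lb], that [e] varies by at most
   [del / 8] within a coarse mesh, and that the law has increments at most [del / 4] there. *)
pose J0 := maxn Ja (maxn Jb Jc).
have {}hJa j : (J0 <= j)%N -> Lb + 1 + j%:R <= d0 ^+ 2 / (8 * (L * (len1 + len2))) * (9 / 8) ^+ j.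
  by move=> h; apply: hJa; apply: leq_trans h; rewrite leq_maxl.
have {}hJb : 8 * r * L * ((len1 + len2) / 2 ^+ J0) <= (del / 8) ^+ 2.
  by rewrite mulrA hJb// !leq_max leqnn orbT.
have {}hJc : (L * (len1 + len2)) / 2 ^+ J0 <= del / 4 by rewrite hJc// !leq_max leqnn !orbT.
clearbody J0.
(* The number of cells depends on [J0], so the accuracies [kap] and [del'] on the cells are fixed
   only now. *)
pose nc : R := #|{ffun 'I_(2 ^ J0).+1 * bool -> bool}|%:R.
have nc0 : 0 <= nc by [].
have [|kap kap0 /and3P[kap1 kap2 _]] := @exists_lower_bound R [:: 1; del / (12 * (nc + 1))].
  by rewrite /= ltr01 divr_gt0// mulr_gt0// ltr_wpDl.
pose del' := del / (8 * (nc + 1)).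
have del'0 : 0 < del' by rewrite divr_gt0// mulr_gt0// ltr_wpDl.
have [|a0 a00 /and3P[a01 a02 _]] := @exists_lower_bound R [:: del; (2 ^+ J0)^-1 / (2 * kp)].
  by rewrite /= del0 divr_gt0 ?invr_gt0 ?exprn_gt0// mulr_gt0.
have nckap : 3 * (nc * kap) <= del / 4.
  have : kap * (12 * (nc + 1)) <= del by rewrite -ler_pdivlMr// mulr_gt0// ltr_wpDl.
  move: kap0; clear; lra.
have ncdel : nc * del' <= del / 8.
  have : del' * (8 * (nc + 1)) = del by rewrite /del' divfK// gt_eqF// mulr_gt0// ltr_wpDl.
  move: del'0; clear; lra.
clearbody del'.
exists kp, th, d0, kap, del', a0, J0 => /=; split=> //.
move=> a J n z a_gt0 aa0 /andP[J1 J2] hz.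
have hz' := hz.
have y0 : 0 < 2 ^+ J :> R by rewrite exprn_gt0.
have ykp : 2 ^+ J * (kp * a) <= 2.
  by rewrite mulrC -ler_pdivlMr//; move: J1; set y := (2 ^+ J)^-1; set w := kp * a; clear; lra.
(* For [a <= a0] the mesh [2 ^ -J <= kp * a] is finer than that of level [J0]. *)
have J0J : (J0 < J)%N.
  rewrite ltnNge; apply/negP => JJ0.
  have h1 : (2 ^+ J0)^-1 <= (2 ^+ J)^-1 :> R.
    by rewrite lef_pV2 ?posrE ?exprn_gt0// ler_weXn2l// ler1n.
  have h2 : a * (2 * kp) <= (2 ^+ J0)^-1.
    by rewrite -ler_pdivlMr ?mulr_gt0// (le_trans aa0).
  have h3 : 0 < (2 ^+ J0)^-1 :> R by rewrite invr_gt0 exprn_gt0.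
  move: h1 h2 h3 J2; set y1 := (2 ^+ J0)^-1; set y2 := (2 ^+ J)^-1; clear; lra.
split=> //.
- move=> j /andP[j1 j2].
  have yj : 0 < 2 ^+ j :> R by rewrite exprn_gt0.
  have yE : 2 ^+ (J - j) * (th * a) <= (L * (len1 + len2)) / 2 ^+ j.
    rewrite ler_pdivlMr// mulrAC -exprD subnK//.
    have : 2 ^+ J * a * th <= 2 ^+ J * a * ((L * (len1 + len2)) * kp / 2) by rewrite ler_wpM2l// ltW// mulr_gt0.
    have := ler_wpM2l (ltW C0) ykp; set y := 2 ^+ J; clear; lra.
  have c1 : L * len1 / 2 ^+ j <= (L * (len1 + len2)) / 2 ^+ j.
    by rewrite ler_wpM2r ?invr_ge0 ?(ltW yj)// ler_wpM2l ?(ltW L_gt0)// lerDl ltW.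
  have c2 : L * len2 / 2 ^+ j <= (L * (len1 + len2)) / 2 ^+ j.
    by rewrite ler_wpM2r ?invr_ge0 ?(ltW yj)// ler_wpM2l ?(ltW L_gt0)// lerDr ltW.
  have cc : 2 * (L * (len1 + len2)) / 2 ^+ j = (L * (len1 + len2)) / 2 ^+ j + (L * (len1 + len2)) / 2 ^+ j by ring.
  have st md i l := typical_steps len1_gt0 len2_gt0 lip1 lip2 hz md i l j2.
  split.
  + move=> md i l hi hl; rewrite cc (le_trans ((st md i l).1 hi hl))// lerD//.
  + move=> md i l hi hl; rewrite cc (le_trans ((st md i l).2 hi hl))// lerD//.
  + rewrite ler_pdivlMr// -[leLHS]mulrA -exprMn.
    have h1 : (3 / 4 * 2) ^+ j <= 2 ^+ J :> R.
      apply: (@le_trans _ _ (2 ^+ j)); last by rewrite ler_weXn2l// ler1n.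
      by rewrite lerXn2r ?nnegrE//; clear; lra.
    apply: (@le_trans _ _ (a * d0 * 2 ^+ J)); first by rewrite ler_wpM2l// mulr_ge0// ltW.
    have h2 : d0 <= (L * (len1 + len2)) * kp by rewrite Ckp d0E; move: del0; clear; lra.
    have : 2 ^+ J * a * d0 <= 2 ^+ J * a * ((L * (len1 + len2)) * kp) by rewrite ler_wpM2l// ltW// mulr_gt0.
    have := ler_wpM2l (ltW C0) ykp; set y := 2 ^+ J; clear; lra.
move=> k zb e hst he hcell u v x y x1 x2 xu y1 y2 yv.
have ta : 2 * (th * a) <= del / 16 * a.
  by rewrite mulrA ler_wpM2r ?(ltW a_gt0)//; move: th2; clear; lra.
have CJ : (L * (len1 + len2)) / 2 ^+ J <= del / 16 * a.
  by rewrite -Ckp -[leRHS]mulrA ler_wpM2l// ltW.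
have close md s t : in_box lo1 len1 lo2 len2 s t ->
    `|emp k zb (quad md s t) - emp n z (quad md s t) - a * e (quad md s t)| <= del * a.
  move=> hs; have del80 : 0 <= del / 8 by rewrite divr_ge0// ltW.
  apply: le_trans (bootstrap_closeness len1_gt0 len2_gt0 L_gt0 lip1 lip2 hz' J0J a_gt0 d00
    (ltW del'0) del80 hst he hcell hJb md hs) _.
  have h1 := ler_wpM2r (ltW a_gt0) ncdel.
  have h2 : 8 * (a * d0) = del / 4 * a by rewrite d0E; field.
  have dela : 0 < del * a by rewrite mulr_gt0.
  rewrite -/nc h2; move: ta CJ h1 dela; set t1 := th * a; set t2 := (L * (len1 + len2)) / _; clear; lra.
have cons md s t : in_box lo1 len1 lo2 len2 s t ->
    `|emp n z (quad md s t) - fine (P (quad md s t))| <= del.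
  move=> hs; apply: le_trans (typical_consistency len1_gt0 len2_gt0 lip1 lip2 hz' md (ltW kap0) hs) _.
  by rewrite -/nc; move: nckap hJc del0; clear; lra.
have Nlen len : nmin <= len -> M * a <= N * (len / 2 ^+ J).
  move=> hl; apply: (@le_trans _ _ (N * (nmin * (kp * a / 2)))).
    have -> : N * (nmin * (kp * a / 2)) = N * (nmin * kp) * a / 2 by ring.
    by rewrite NE (_ : 2 * M * a / 2 = M * a)//; field.
  rewrite ler_wpM2l ?(ltW N0)// ler_pM// ?(ltW nmin0)// divr_ge0// mulr_ge0// ltW//.
have osc md s s' t t' : in_box lo1 len1 lo2 len2 s t -> in_box lo1 len1 lo2 len2 s' t' ->
    `|s - s'| <= M * a -> `|t - t'| <= M * a ->
    `|(emp n z (quad md s' t') - fine (P (quad md s' t'))) -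
      (emp n z (quad md s t) - fine (P (quad md s t)))| <= del * a.
  move=> hs hs' hss htt; have [hgr _ _] := hz'.
  have := @grid_oscillation R lo1 len1 lo2 len2 len1_gt0 len2_gt0
     (fun s t => fine (P (quad md s t))) (fun s t => emp n z (quad md s t)) (L * (len1 + len2)) (th * a) N J
     (@quad_monotone2 R P md) (@emp_monotone2 R n z md)
     (fun i l hi hl => mass_diagonal (ltW len1_gt0) (ltW len2_gt0) lip1 lip2 md hi hl) (hgr md)
     s s' t t' hs hs' (le_trans hss (Nlen _ l1)) (le_trans htt (Nlen _ l2)).
  move/le_trans; apply.
  have h1 : th * (8 * (N + 3)) <= del by rewrite -ler_pdivlMr// mulr_gt0// addr_gt0.
  have := ler_wpM2r (ltW a_gt0) h1; move: CJ; set t2 := (L * (len1 + len2)) / _.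
  have : 0 < del * a by rewrite mulr_gt0.
  clear; lra.
have e2 A : measurable A -> `|e A| <= B.
  move=> mA; apply: le_trans (energy_norm_le he mA) _.
  by rewrite /B; move: rL; clear; lra.
have mod md s t x' y' : in_box lo1 len1 lo2 len2 s t -> in_box lo1 len1 lo2 len2 x' y' ->
    (e (quad md s t) - e (quad md x' y')) ^+ 2 <= B * (`|s - x'| + `|t - y'|).
  move=> h1 h2; apply: le_trans (energy_modulus L_gt0 lip1 lip2 md he h1 h2) _.
  by rewrite ler_wpM2r ?addr_ge0// /B -addrA lerDl; move: r0; clear; lra.
have b1 s : lo1 <= s <= lo1 + len1 -> in_box lo1 len1 lo2 len2 s lo2.
  by split=> //; rewrite lexx lerDl ltW.
have b2 t : lo2 <= t <= lo2 + len2 -> in_box lo1 len1 lo2 len2 lo1 t.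
  by split=> //; rewrite lexx lerDl ltW.
have xI : lo1 <= x <= lo1 + len1 by exact: between_margin rho0_gt0 x1 x2.
have yI : lo2 <= y <= lo2 + len2 by exact: between_margin rho0_gt0 y1 y2.
have [E1 E2 E3] := empirical_dfE k zb; have [E4 E5 E6] := empirical_dfE n z.
rewrite /copula E1 E2 E3 E4 E5 E6.
have Ma : 0 <= M * a by rewrite mulr_ge0 ?ltW.
apply: (hdel a (fun s t => emp n z (quad None s t)) (fun s t => emp k zb (quad None s t))
  (fun s => emp n z (quad (Some true) s 0)) (fun s => emp k zb (quad (Some true) s 0))
  (fun t => emp n z (quad (Some false) 0 t)) (fun t => emp k zb (quad (Some false) 0 t))
  (fun s t => e (quad None s t)) (fun s => e (quad (Some true) s 0))
  (fun t => e (quad (Some false) 0 t)) u v x y) => //.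
- exact: le_trans aa0 a01.
- by move=> s s' ss; exact: (@emp_monotone2 R n z (Some true) s s' 0 0 ss).
- by move=> s s' ss; exact: (@emp_monotone2 R k zb (Some true) s s' 0 0 ss).
- by move=> s s' ss; exact: (@emp_monotone2 R n z (Some false) 0 0 s s' (lexx _) ss).
- by move=> s s' ss; exact: (@emp_monotone2 R k zb (Some false) 0 0 s s' (lexx _) ss).
- by move=> s hs; exact: (cons (Some true) s lo2 (b1 _ hs)).
- by move=> s hs; exact: (cons (Some false) lo1 s (b2 _ hs)).
- move=> s s' hs hs' ss; apply: (osc (Some true) s s' lo2 lo2 (b1 _ hs) (b1 _ hs')) => //.
  by rewrite subrr normr0.
- move=> s s' hs hs' ss; apply: (osc (Some false) lo1 lo1 s s' (b2 _ hs) (b2 _ hs')) => //.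
  by rewrite subrr normr0.
- by move=> s s' t t' hs hs' ht ht' ss tt; apply: (osc None s s' t t').
- by move=> s hs; exact: (close (Some true) s lo2 (b1 _ hs)).
- by move=> s hs; exact: (close (Some false) lo1 s (b2 _ hs)).
- by move=> s t hs ht; apply: (close None s t).
- by apply: e2; exact: (@measurable_quad R (Some true) x 0).
- by apply: e2; exact: (@measurable_quad R (Some false) 0 y).
- move=> s hs; have := mod (Some true) s lo2 x lo2 (b1 _ hs) (b1 _ xI).
  by rewrite subrr normr0 addr0.
- move=> s hs; have := mod (Some false) lo1 s lo1 y (b2 _ hs) (b2 _ yI).
  by rewrite subrr normr0 add0r.
- by move=> s t hs ht; apply: (mod None s t x y).
Qed.

(** * Smoothness and quantiles of the marginals *)

Section uniform_continuity.
Context {R : realType} {T : pseudoMetricType R}.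

(** Pairs violating uniformity at distance [1 / (n + 1)] would cluster at a point of [K], against
    continuity within [K] there. *)
Lemma compact_uniformly_continuous (K : set T) (f : T -> R) : compact K ->
  {within K, continuous f} -> forall e : R, 0 < e ->
  exists2 rho : R, 0 < rho & forall x y, K x -> K y -> ball x rho y -> `|f x - f y| <= e.
Proof.
move=> cK cf e e0; apply: contrapT => hno.
have {hno}bad (n : nat) : exists xy : T * T, [/\ K xy.1, K xy.2, ball xy.1 n.+1%:R^-1 xy.2
    & e < `|f xy.1 - f xy.2|].
  apply: contrapT => h; apply: hno; exists n.+1%:R^-1; first by rewrite invr_gt0.
  move=> x y Kx Ky bxy; rewrite leNgt; apply/negP => h1; apply: h.
  by exists (x, y).
have [xy hxy] := choice bad.
have [x [Kx clx]] := cK ((fun n => (xy n).1) @ \oo) _ (filterS (fun n _ => let: And4 h _ _ _ := hxy n in h) filterT).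
have e20 : 0 < e / 2 by rewrite divr_gt0.
have /subspace_continuousP/(_ x Kx)/cvgrPdist_lt/(_ _ e20) := cf.
rewrite near_withinE near_simpl => /nbhs_ballP[rho /= rho0 hrho].
have [N hN] : exists N : nat, N.+1%:R^-1 <= rho / 2.
  exists (Num.truncn (rho / 2)^-1); rewrite invf_ple ?posrE ?divr_gt0//.
  exact/ltW/truncnS_gt.
have F1 : ((fun n => (xy n).1) @ \oo) [set (xy n).1 | n in [set n | (N <= n)%N]].
  by exists N => // n /= Nn; exists n.
have r20 : 0 < rho / 2 by rewrite divr_gt0.
have [_ [[n /= Nn <-] bx]] := clx _ _ F1 (nbhsx_ballx x _ r20).
have [K1 K2 b12 h12] := hxy n.
have b1 : ball x rho (xy n).1 by apply: le_ball bx; rewrite ler_piMr ?(ltW rho0)//; lra.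
have b2 : ball x rho (xy n).2.
  rewrite [in ball _ _](_ : rho = rho / 2 + rho / 2); last by field.
  apply: ball_triangle bx _; apply: le_ball b12.
  by apply: le_trans hN; rewrite lef_pV2 ?posrE// ler_nat.
have := hrho _ b1 K1; have := hrho _ b2 K2; move: h12; rewrite /from_subspace.
rewrite -(subrKA (f x)) => h12 h1 h2; have := lt_le_trans h12 (ler_normD _ _).
by rewrite (distrC (f (xy n).1)); lra.
Qed.

Lemma compact_bounded_above (K : set T) (f : T -> R) : compact K ->
  {within K, continuous f} -> exists M : R, forall x, K x -> `|f x| <= M.
Proof.
move=> cK cf; have /compact_bounded[M [_ hM]] := continuous_compact cf cK.
exists (M + 1) => x Kx; apply: (hM (M + 1)); first by rewrite ltrDl.
by exists x.
Qed.

End uniform_continuity.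

Section smoothness.
Context {R : realType}.

(** Both orders of [s] and [s'] are covered, so the position of the intermediate point is expressed
    by distances. *)
Lemma segment_mvt (F : R -> R) (A B s s' : R) :
  (forall x, A <= x <= B -> derivable F x 1) -> A <= s <= B -> A <= s' <= B ->
  exists2 c : R, [/\ `|c - s| <= `|s' - s|, `|c - s'| <= `|s' - s| & A <= c <= B]
    & F s' - F s = derive1 F c * (s' - s).
Proof.
move=> dF; wlog ss : s s' / s <= s'.
  move=> h hs hs'; have /orP[ss|ss] := le_total s s'; first exact: (h s s' ss hs hs').
  have [c [c1 c2 c3] c4] := h s' s ss hs' hs; exists c.
    by rewrite (distrC s').
  by rewrite -opprB c4; ring.
move=> /andP[s1 s2] /andP[s3 s4].
have inn x : s <= x <= s' -> A <= x <= B.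
  by move=> /andP[x1 x2]; rewrite (le_trans s1 x1) (le_trans x2 s4).
have [||c] := @MVT_segment R F (derive1 F) s s' ss.
- move=> x; rewrite in_itv/= => /andP[x1 x2]; rewrite derive1E; apply: DeriveDef => //.
  by apply: dF; apply: inn; rewrite !ltW.
- apply: derivable_within_continuous => x; rewrite in_itv/= => /andP[x1 x2].
  by apply: dF; apply: inn; rewrite x1.
rewrite in_itv/= => /andP[c1 c2] ->; exists c => //; split; last by apply: inn; rewrite c1.
  by rewrite !ger0_norm ?subr_ge0// lerD2r.
by rewrite distrC !ger0_norm ?subr_ge0// lerD2l lerN2.
Qed.

(** The conclusion allows any smaller [m] and larger [L], so that both marginals and the joint
    distribution function can share constants. *)
Lemma smooth_df_derive (F : R -> R) (A B : R) : A <= B ->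
  (forall x, A <= x <= B -> derivable F x 1) ->
  {within `[A, B], continuous derive1 F} -> (forall x, A <= x <= B -> 0 < derive1 F x) ->
  exists m0 L0 : R, [/\ 0 < m0, 0 < L0
    & forall m L, m <= m0 -> L0 <= L -> smooth_df F (derive1 F) A B m L].
Proof.
move=> AB dF cF pF.
have [c cI hc] := EVT_min AB cF; have [c' cI' hc'] := EVT_max AB cF.
rewrite !in_itv/= in cI cI'.
exists (derive1 F c), (derive1 F c'); split; [exact: pF|exact: pF|].
have hmin x : A <= x <= B -> derive1 F c <= derive1 F x by move=> h; apply: hc; rewrite in_itv.
have hmax x : A <= x <= B -> derive1 F x <= derive1 F c' by move=> h; apply: hc'; rewrite in_itv.
move=> m L hm hL; split.
- move=> s s' s1 ss s2.
  have sI : A <= s <= B by rewrite s1 (le_trans ss).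
  have sI' : A <= s' <= B by rewrite s2 (le_trans s1).
  have [x [_ _ xI] ->] := segment_mvt dF sI sI'.
  rewrite !ler_wpM2r ?subr_ge0//; first exact: le_trans (hmax _ xI) hL.
  exact: le_trans hm (hmin _ xI).
- by move=> x xI; exact: le_trans hm (hmin _ xI).
- move=> eta eta0.
  have [rho rho0 hrho] := compact_uniformly_continuous (@segment_compact R A B) cF eta0.
  exists (rho / 4); first by rewrite divr_gt0.
  move=> x s s' xI sI sI' sx s'x.
  have [y [y1 y2 yI] ->] := segment_mvt dF sI sI'.
  rewrite -mulrBl normrM ler_wpM2r// distrC; apply: hrho; rewrite /= ?in_itv//=.
  rewrite /ball/= distrC.
  have := ler_distD s y x; have := ler_distD x s' s; rewrite (distrC x s).
  move: y1 sx s'x rho0; lra.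
Qed.

(** The path runs along the second coordinate at abscissa [s] and then along the first at height
    [t']; the mean value theorem applies on each leg. *)
Lemma smooth_df2_derive (H : R -> R -> R) (A1 B1 A2 B2 : R)
    (Hx := fun x y => derive1 (H ^~ y) x) (Hy := fun x y => derive1 (H x) y) :
  (forall x y, A1 <= x <= B1 -> A2 <= y <= B2 -> derivable (H ^~ y) x 1) ->
  (forall x y, A1 <= x <= B1 -> A2 <= y <= B2 -> derivable (H x) y 1) ->
  {within `[A1, B1] `*` `[A2, B2], continuous (fun z : R * R => Hx z.1 z.2)} ->
  {within `[A1, B1] `*` `[A2, B2], continuous (fun z : R * R => Hy z.1 z.2)} ->
  exists2 L0 : R, 0 < L0 & forall L, L0 <= L -> smooth_df2 H Hx Hy A1 B1 A2 B2 L.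
Proof.
move=> dx dy cx cy.
have cK := compact_setX (@segment_compact R A1 B1) (@segment_compact R A2 B2).
have inK x y : A1 <= x <= B1 -> A2 <= y <= B2 -> (`[A1, B1] `*` `[A2, B2])%classic (x, y).
  by move=> ? ?; rewrite /= !in_itv.
have [M1 h1] := compact_bounded_above cK cx; have [M2 h2] := compact_bounded_above cK cy.
exists (1 + `|M1| + `|M2|); first by rewrite -addrA ltr_wpDr// addr_ge0.
move=> L hL; split.
- move=> x y xI yI; have := h1 _ (inK _ _ xI yI) => /= h; have := ler_norm M1.
  have := normr_ge0 M2; lra.
- move=> x y xI yI; have := h2 _ (inK _ _ xI yI) => /= h; have := ler_norm M2.
  have := normr_ge0 M1; lra.
- move=> eta eta0.
  have [r1 r10 u1] := compact_uniformly_continuous cK cx eta0.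
  have [r2 r20 u2] := compact_uniformly_continuous cK cy eta0.
  have [|rho rho0 /and3P[rr1 rr2 _]] := @exists_lower_bound R [:: r1; r2].
    by rewrite /= r10 r20.
  exists (rho / 4); first by rewrite divr_gt0.
  move=> x y s s' t t' xI sI sI' yI tI tI' sx s'x ty t'y.
  have [c [c1 c2 cI] cE] := segment_mvt (fun x xI => dx x t' xI tI') sI sI'.
  have [d [d1 d2 dI] dE] := segment_mvt (fun y yI => dy s y sI yI) tI tI'.
  have near w w' z v : `|v - w| <= `|w' - w| -> `|w - z| <= rho / 4 -> `|w' - z| <= rho / 4 ->
      `|v - z| < rho.
    move=> k1 k2 k3; have := ler_distD z w' w; have := ler_distD w v z.
    rewrite (distrC z w); move: k1 k2 k3 rho0; lra.
  have e1 : `|Hx c t' - Hx x y| <= eta.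
    apply: (u1 (c, t') (x, y)); [exact: inK|exact: inK|split; rewrite /ball/=].
      by apply: lt_le_trans rr1; exact: near c1 sx s'x.
    by apply: lt_le_trans rr1; apply: le_lt_trans t'y _; rewrite ltr_pdivrMr// ltr_pMr// ltr1n.
  have e2 : `|Hy s d - Hy x y| <= eta.
    apply: (u2 (s, d) (x, y)); [exact: inK|exact: inK|split; rewrite /ball/=].
      by apply: lt_le_trans rr2; apply: le_lt_trans sx _; rewrite ltr_pdivrMr// ltr_pMr// ltr1n.
    by apply: lt_le_trans rr2; exact: near d1 ty t'y.
  have -> : H s' t' - H s t - Hx x y * (s' - s) - Hy x y * (t' - t) =
      (Hx c t' - Hx x y) * (s' - s) + (Hy s d - Hy x y) * (t' - t).
    by rewrite -[H s' t'](subrK (H s t')) cE -[H s t' in LHS](subrK (H s t)) dE /Hx /Hy; ring.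
  by rewrite (le_trans (ler_normD _ _))// !normrM mulrDr lerD// ler_wpM2r.
Qed.

End smoothness.

Section df_quantiles.
Context {R : realType} (P : probability (R * R)%type R).

Lemma cdf_bounds (X : R * R -> R) (u : R) : measurable_fun setT X -> 0 < u -> u < 1 ->
  exists l r : R, fine (P (X @^-1` `]-oo, l])) < u /\ u <= fine (P (X @^-1` `]-oo, r])).
Proof.
move=> mX u0 u1.
pose X' : {mfun _ >-> _} := HB.pack X (isMeasurableFun.Build _ _ _ _ X mX).
have /fine_cvgP[_ /cvgrPdist_lt/(_ (1 - u))] := @cvg_cdfy1 _ _ R P X'.
rewrite subr_gt0 => /(_ u1)/filter_ex[r hr].
have /fine_cvgP[_ /cvgrPdist_lt/(_ u u0)] := @cvg_cdfNy0 _ _ R P X'.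
move=> /filter_ex[l hl]; exists l, r; split.
  by apply: le_lt_trans (ler_norm _) _; move: hl; rewrite sub0r normrN.
have := le_lt_trans (ler_norm _) hr.
rewrite -[(fine \o cdf X') r]/(fine (P (X @^-1` `]-oo, r]))); lra.
Qed.

(** The Lipschitz bound on a neighbourhood of the quantile excludes a jump there. *)
Lemma quantile_value (F : R -> R) (A B u l r L : R) : {homo F : x y / x <= y} ->
  F l < u -> u <= F r -> 0 < L -> A < quantile F u < B ->
  (forall s s', A <= s -> s <= s' -> s' <= B -> F s' - F s <= L * (s' - s)) ->
  F (quantile F u) = u.
Proof.
move=> hF Fl Fr L0 /andP[]; set x := quantile F u => Ax xB lip.
apply/eqP; rewrite eq_le; apply/andP; split; apply/ler_addgt0Pr => e e0.
- have [|h h0 /and3P[h1 h2 _]] := @exists_lower_bound R [:: x - A; e / L].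
    by rewrite /= subr_gt0 Ax divr_gt0.
  have := lip (x - h) x; rewrite lerBlDr lerDl (ltW h0) (ltW xB) => /(_ _ isT isT) h3.
  have {}h3 := h3 _; rewrite lerBrDr -lerBrDl in h3; have {}h3 := h3 h1.
  have := @quantile_lt R F u l (x - h) hF Fl; rewrite -/x gtrBl => /(_ h0) h4.
  have : L * h <= e by rewrite mulrC -ler_pdivlMr.
  move: h3 h4; rewrite (_ : x - (x - h) = h); last by ring.
  by lra.
- have [|h h0 /and3P[h1 h2 _]] := @exists_lower_bound R [:: B - x; e / L].
    by rewrite /= subr_gt0 xB divr_gt0.
  have := lip x (x + h) (ltW Ax); rewrite lerDl (ltW h0) => /(_ isT).
  rewrite -lerBrDl => /(_ h1) h3.
  have := @quantile_gt R F u l r (x + h) hF Fl Fr; rewrite -/x ltrDl => /(_ h0) h4.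
  have : L * h <= e by rewrite mulrC -ler_pdivlMr.
  move: h3 h4; rewrite (_ : x + h - x = h); last by ring.
  by lra.
Qed.

Lemma quantile_le (F : R -> R) (u u' l r : R) : {homo F : x y / x <= y} ->
  F l < u -> u <= u' -> u' <= F r -> quantile F u <= quantile F u'.
Proof.
move=> hF Fl uu Fr.
apply: lb_le_inf; first by exists r.
move=> y /= uy; have Fl' : F l < u' by exact: lt_le_trans Fl uu.
apply: ge_inf => /=; last exact: le_trans uu uy.
exists l => z /= uz; rewrite leNgt; apply/negP => zl.
by have := lt_le_trans Fl uz; rewrite ltNge (hF _ _ (ltW zl)).
Qed.

Lemma left_df_homo : {homo left_df P : x y / x <= y}.
Proof. by move=> x y xy; exact: (@probability_quad_le R P (Some true) x y 0 0 xy). Qed.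

Lemma right_df_homo : {homo right_df P : x y / x <= y}.
Proof. by move=> x y xy; exact: (@probability_quad_le R P (Some false) 0 0 x y (lexx _) xy). Qed.

Lemma left_df_bounds (u : R) : 0 < u -> u < 1 -> exists l r, left_df P l < u /\ u <= left_df P r.
Proof.
move=> u0 u1; have [l [r h]] := cdf_bounds measurable_fst u0 u1; exists l, r.
have E (x : R) : `]-oo, x]%classic `*` setT = fst @^-1` `]-oo, x] :> set (R * R).
  by apply/seteqP; split=> [z []|z].
by rewrite /left_df !E.
Qed.

Lemma right_df_bounds (u : R) : 0 < u -> u < 1 -> exists l r, right_df P l < u /\ u <= right_df P r.
Proof.
move=> u0 u1; have [l [r h]] := cdf_bounds measurable_snd u0 u1; exists l, r.
have E (x : R) : setT `*` `]-oo, x]%classic = snd @^-1` `]-oo, x] :> set (R * R).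
  by apply/seteqP; split=> [z []|z].
by rewrite /right_df !E.
Qed.

Lemma quantile_domain (F : R -> R) (f : R -> R) (p1 q1 eps m L : R) :
  {homo F : x y / x <= y} -> (exists l r, F l < p1 /\ q1 <= F r) -> p1 <= q1 -> 0 < eps -> 0 < L ->
  smooth_df F f (quantile F p1 - eps) (quantile F q1 + eps) m L ->
  quantile F p1 <= quantile F q1 /\
  forall u, p1 <= u <= q1 -> [/\ quantile F p1 <= quantile F u,
    quantile F u <= quantile F q1 & F (quantile F u) = u].
Proof.
move=> hF [l [r [Fl Fr]]] pq eps0 L0 [hL _ _].
split; first exact: quantile_le hF Fl pq Fr.
move=> u /andP[pu uq].
have q1' : quantile F p1 <= quantile F u := quantile_le hF Fl pu (le_trans uq Fr).
have q2' : quantile F u <= quantile F q1 := quantile_le hF (lt_le_trans Fl pu) uq Fr.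
split=> //; apply: (@quantile_value F (quantile F p1 - eps) (quantile F q1 + eps) u l r L) => //.
- exact: lt_le_trans Fl pu.
- exact: le_trans uq Fr.
- by rewrite ltrBlDr (le_lt_trans q1')// ?ltrDl// (le_lt_trans q2')// ltrDl.
- by move=> s s' h1 h2 h3; have /andP[] := hL _ _ h1 h2 h3.
Qed.

End df_quantiles.

(** * Rate function and energy *)

Section rate_and_energy.
Context {R : realType} (P : probability (R * R)%type R).
Variables (p1 q1 p2 q2 lo1 len1 lo2 len2 m L : R).
Hypotheses (len1_gt0 : 0 < len1) (len2_gt0 : 0 < len2) (m_gt0 : 0 < m) (L_gt0 : 0 < L).
Hypotheses (pq1 : p1 <= q1) (pq2 : p2 <= q2).
Local Notation F := (left_df P).
Local Notation G := (right_df P).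
Hypothesis hF : smooth_df F (derive1 F) lo1 (lo1 + len1) m L.
Hypothesis hG : smooth_df G (derive1 G) lo2 (lo2 + len2) m L.
Hypothesis hH : smooth_df2 (joint_df P) (dHdx P) (dHdy P) lo1 (lo1 + len1) lo2 (lo2 + len2) L.
Hypothesis dom1 : forall u, p1 <= u <= q1 -> lo1 <= quantile F u <= lo1 + len1.
Hypothesis dom2 : forall u, p2 <= u <= q2 -> lo2 <= quantile G u <= lo2 + len2.
Local Notation rect := (rect p1 q1 p2 q2).
Local Notation signed_measure := ({charge set (R * R)%type -> \bar R})%R.

Definition phi_of (e : set (R * R) -> R) (s : rect) : R :=
  copula_derivative (derive1 F) (derive1 G) (dHdx P) (dHdy P) e
    (quantile F (val s).1) (quantile G (val s).2).

Lemma alphaE (Q : signed_measure) (x y : R) : Q `<< P ->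
  [/\ alpha P Q x%:E y%:E = fine (Q (quad None x y)),
      alpha P Q x%:E +oo%E = fine (Q (quad (Some true) x 0))
    & alpha P Q +oo%E y%:E = fine (Q (quad (Some false) 0 y))].
Proof.
move=> QP; have mq md := @measurable_quad R md.
rewrite /alpha !(Radon_Nikodym_integral QP)//.
split; congr (fine (integral _ _ _)); apply/seteqP; split=> -[u v];
  by rewrite /= ?in_itv/= ?lee_fin => -[? ?]; split; rewrite ?leey.
Qed.

Lemma dPhi_phi_of (Q : signed_measure) : Q `<< P ->
  (fun s : rect => dPhi P (alpha P Q) (val s)) = phi_of (fun A => fine (Q A)).
Proof.
move=> QP; apply/funext => s; rewrite /dPhi /phi_of /copula_derivative.
by have [-> -> ->] := alphaE (quantile F (val s).1) (quantile G (val s).2) QP.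
Qed.

(** With the next lemma, this replaces the signed measures in [I_C] by set functions of bounded
    energy: the charge built from [e] is admissible and [phi_of e] is its derivative. *)
Lemma I_C_le_energy r e (Psi : set (rect -> R)) : energy_le P r e -> Psi (phi_of e) ->
  (I_C P Psi <= r%:E)%E.
Proof.
move=> he hPsi; apply: ge_ereal_inf.
pose Q : signed_measure := energy_charge he.
have QP : Q `<< P by exact: energy_charge_dominates.
exists (rho02 P Q); last by rewrite /rho02 asboolT//; exact: energy_charge_density_sqr.
exists Q => //; split=> //.
- split; first by rewrite /Q /= /energy_charge; have [_ -> _] := he.
  move=> w [mw w2] A N QAN; exact: energy_charge_integral_lty.
- by exists (phi_of e); split=> //; rewrite dPhi_phi_of.
Qed.

(** The strict inequality provides a charge even when the infimum is not attained. *)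
Lemma energy_of_I_C_lt r (Psi : set (rect -> R)) : (I_C P Psi < r%:E)%E ->
  exists e, energy_le P r e /\ Psi (phi_of e).
Proof.
move=> /ereal_inf_lt[_ [Q [[QT _] QP [phi [<- hPsi]]] <-]].
rewrite /rho02 asboolT// => /ltW h; exists (fun A => fine (Q A)); split.
  exact: charge_energy_le.
by rewrite -dPhi_phi_of.
Qed.

Let boxed (s : rect) : in_box lo1 len1 lo2 len2 (quantile F (val s).1) (quantile G (val s).2).
Proof.
case: s => -[u v] /= h; have /set_mem[/= h1 h2] := h.
by move: h1 h2; rewrite !in_itv/= => h1 h2; split; [exact: dom1|exact: dom2].
Qed.

Lemma phi_of_diff e e' (D : R) : 0 <= D ->
  (forall md s t, in_box lo1 len1 lo2 len2 s t -> `|e (quad md s t) - e' (quad md s t)| <= D) ->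
  forall s, `|phi_of e s - phi_of e' s| <= D * (1 + 2 * L / m).
Proof.
move=> D0 hD s; have hs := boxed s; rewrite /phi_of /copula_derivative.
set x := quantile F _ in hs *; set y := quantile G _ in hs *.
have [xI yI] := hs; have [hx hy _] := hH.
have [_ fm _] := hF; have [_ gm _] := hG.
have b1 := hD (Some true) x y hs; have b2 := hD (Some false) x y hs.
have term a b c : `|a| <= L -> m <= c -> `|b| <= D -> `|a * (b / c)| <= D * (L / m).
  move=> aL mc bD; have c0 : 0 < c by exact: lt_le_trans mc.
  rewrite !normrM normfV (gtr0_norm c0) mulrCA ler_pM//.
    by rewrite mulr_ge0// invr_ge0 ltW.
  by rewrite ler_pM// ?invr_ge0 ?(ltW c0)// lef_pV2.
have t1 := term _ _ _ (hx x y xI yI) (fm x xI) b1.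
have t2 := term _ _ _ (hy x y xI yI) (gm y yI) b2.
have b0 := hD None x y hs.
have -> : D * (1 + 2 * L / m) = D + D * (L / m) + D * (L / m) by ring.
rewrite (_ : _ - _ = (e (quad None x y) - e' (quad None x y))
   - dHdx P x y * ((e (quad (Some true) x y) - e' (quad (Some true) x y)) / derive1 F x)
   - dHdy P x y * ((e (quad (Some false) x y) - e' (quad (Some false) x y)) / derive1 G y)).
  by rewrite (le_trans (ler_normB _ _))// lerD// (le_trans (ler_normB _ _))// lerD.
rewrite -[e (quad (Some true) x 0)]/(e (quad (Some true) x y)).
rewrite -[e' (quad (Some true) x 0)]/(e' (quad (Some true) x y)).
rewrite -[e (quad (Some false) 0 y)]/(e (quad (Some false) x y)).
rewrite -[e' (quad (Some false) 0 y)]/(e' (quad (Some false) x y)).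
by ring.
Qed.

(** Closeness on the finitely many sets [quad] of one grid becomes uniform through the common
    modulus [energy_modulus]. *)
Lemma energy_uniform_closeness r e e_ (D : R) (N : nat) : 0 < D -> energy_le P r e ->
  (forall n, energy_le P r (e_ n)) ->
  (forall (I : finType) (A : I -> set (R * R)) (d : R) (N : nat), 0 < d ->
      (forall i, measurable (A i)) ->
      exists2 n, (N <= n)%N & forall i, `|e_ n (A i) - e (A i)| <= d) ->
  exists2 n, (N <= n)%N & forall md s t, in_box lo1 len1 lo2 len2 s t ->
    `|e_ n (quad md s t) - e (quad md s t)| <= D.
Proof.
move=> D0 he he_ hcvg; have r0 := energy_ge0 he.
have lip1 s s' : lo1 <= s -> s <= s' -> s' <= lo1 + len1 -> F s' - F s <= L * (s' - s).
  by move=> h1 h2 h3; have [/(_ _ _ h1 h2 h3)/andP[]] := hF.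
have lip2 s s' : lo2 <= s -> s <= s' -> s' <= lo2 + len2 -> G s' - G s <= L * (s' - s).
  by move=> h1 h2 h3; have [/(_ _ _ h1 h2 h3)/andP[]] := hG.
have D30 : 0 < D / 3 by rewrite divr_gt0.
have [||J hJ] := @exists_dyadic_le R (8 * r * L * (len1 + len2)) ((D / 3) ^+ 2).
- by rewrite !mulr_ge0 ?addr_ge0 ?(ltW len1_gt0) ?(ltW len2_gt0) ?(ltW L_gt0).
- by rewrite exprn_gt0.
have {}hJ := hJ J (leqnn J); rewrite -mulrA in hJ.
pose I : finType := (option bool * 'I_(2 ^ J) * 'I_(2 ^ J))%type.
have [i|n Nn hn] := hcvg I (fun i => quad i.1.1 (grid lo1 len1 J i.1.2) (grid lo2 len2 J i.2)) (D / 3) N D30.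
  exact: measurable_quad.
exists n => // md s t hs; have [hs1 hs2] := hs.
have [i iJ si] := grid_locate J len1_gt0 hs1.
have [l lJ tl] := grid_locate J len2_gt0 hs2.
have hbox : in_box lo1 len1 lo2 len2 (grid lo1 len1 J i) (grid lo2 len2 J l).
  by split; apply: grid_in; rewrite ?ltW// ltnW.
have near e' : energy_le P r e' ->
    `|e' (quad md s t) - e' (quad md (grid lo1 len1 J i) (grid lo2 len2 J l))| <= D / 3.
  move=> he'; have := energy_modulus L_gt0 lip1 lip2 md he' hs hbox => h.
  rewrite -ler_sqr ?nnegrE ?(ltW D30)// real_normK ?num_real//; apply: (le_trans h).
  apply: le_trans hJ; rewrite ler_wpM2l ?mulr_ge0 ?(ltW L_gt0)//.
  rewrite mulrDl; apply: lerD.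
    move/andP: si => [? s5]; rewrite ger0_norm ?subr_ge0//.
    by rewrite -(grid_next lo1 len1 J i) lerD2r.
  move/andP: tl => [? s5]; rewrite ger0_norm ?subr_ge0//.
  by rewrite -(grid_next lo2 len2 J l) lerD2r.
have := hn (md, Ordinal iJ, Ordinal lJ) => /=; have := near _ he; have := near _ (he_ n).
set a := e_ n _; set b := e_ n _; set c := e _; set d := e _.
clearbody a b c d; clear hJ hcvg near; rewrite !ler_norml => /andP[? ?] /andP[? ?] /andP[? ?].
apply/andP; split; lra.
Qed.

Lemma rect_point : rect.
Proof.
have h : (p1, p2) \in Defs.rect p1 q1 p2 q2.
  by apply/mem_set; split; rewrite /= in_itv/= lexx.
exact: (SigSub h).
Qed.

Lemma sup_norm_le (z : rect -> R) (M : R) : (forall s, `|z s| <= M) -> sup_norm z <= M.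
Proof.
move=> h; apply: ge_sup; first by exists `|z rect_point|; exists rect_point.
by move=> _ [s _ <-].
Qed.

Lemma phi_of_bounded r e : energy_le P r e -> ell_infty (phi_of e).
Proof.
move=> he; have r0 := energy_ge0 he.
exists ((2 * r + 1) * (1 + 2 * L / m)) => s.
have -> : phi_of e s = phi_of e s - phi_of (fun=> 0) s.
  by rewrite /phi_of /copula_derivative !mul0r !mulr0 !subr0.
apply: phi_of_diff; first by rewrite addr_ge0// mulr_ge0.
move=> md x y _; rewrite subr0.
exact: energy_norm_le he (measurable_quad _ _ _).
Qed.

(* By weak compactness of the energy balls, the level sets of the rate function
   stay at a positive distance from a set on whose closure it is larger. *)
Lemma closure_separation r (Om : set (rect -> R)) : Om `<=` ell_infty ->
  (r%:E < I_C P (linf_closure Om))%E ->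
  exists2 eta : R, 0 < eta & forall e w, energy_le P r e -> Om w ->
    ~ (forall s, `|w s - phi_of e s| <= eta).
Proof.
move=> hOm hr; apply: contrapT => hno.
have bad n : exists ew : (set (R * R) -> R) * (rect -> R), [/\ energy_le P r ew.1, Om ew.2
    & forall s, `|ew.2 s - phi_of ew.1 s| <= n.+1%:R^-1].
  apply: contrapT => h; apply: hno; exists n.+1%:R^-1; first by rewrite invr_gt0.
  by move=> e w he Ow hs; apply: h; exists (e, w).
have [ew hew] := choice bad.
have he_ n : energy_le P r (ew n).1 by have [] := hew n.
have [e he hcvg] := energy_sequential_compactness he_.
(* The limit has energy at most [r]; once its derivative is in the closure, the strict inequality
   [hr] is contradicted. *)
suff /(I_C_le_energy he) : linf_closure Om (phi_of e) by rewrite leNgt hr.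
split; first exact: phi_of_bounded he.
move=> d d0; pose K := 1 + 2 * L / m.
have K0 : 0 < K by rewrite /K ltr_wpDr// divr_ge0 ?mulr_ge0 ?(ltW m_gt0) ?(ltW L_gt0).
have D0 : 0 < d / (4 * K) by rewrite divr_gt0// mulr_gt0.
have [n Nn hn] := energy_uniform_closeness (Num.truncn (d / 4)^-1) D0 he he_ hcvg.
have [_ Ow hw] := hew n.
exists (ew n).2; split=> //; first exact: hOm.
apply: (@le_lt_trans _ _ (d / 2)); last by rewrite ltr_pdivrMr//; move: d0; lra.
apply: sup_norm_le => s; rewrite -(subrKA (phi_of (ew n).1 s)).
apply: le_trans (ler_normD _ _) _.
have h1 := phi_of_diff (ltW D0) hn s.
have h2 : n.+1%:R^-1 <= d / 4.
  rewrite invf_ple ?posrE ?divr_gt0//.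
  by rewrite (le_trans (ltW (truncnS_gt _)))// ler_nat.
have h3 : d / (4 * K) * K = d / 4 by field; rewrite gt_eqF.
by have := le_trans (hw s) h2; move: h1; rewrite -/K h3; lra.
Qed.

End rate_and_energy.

(** * Upper and lower bounds along typical samples *)

Section scales.
Context {R : realType}.

Lemma dyadic_scale (x : R) : 0 < x -> x <= 1 ->
  exists J : nat, x / 2 <= (2 ^+ J)^-1 <= x.
Proof.
move=> x0 x1.
have [J0 hJ0] := exists_dyadic_le (@ler01 R) x0.
have ex : exists J, (2 ^+ J)^-1 <= x by exists J0; have := hJ0 J0 (leqnn _); rewrite mul1r.
have [J hJ Jmin] := ex_minnP ex; exists J; rewrite hJ andbT.
case: J hJ Jmin => [|J] hJ Jmin.
  by rewrite expr0 invr1; apply: le_trans x1; rewrite ler_piMr ?(ltW x0)//; lra.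
rewrite exprS invfM mulrC ler_pM2l ?invr_gt0// leNgt; apply/negP => h.
by have := Jmin J (ltW h); rewrite ltnn.
Qed.

Lemma scale_eventually (a_ : nat -> R) (k : nat -> nat) (c0 kp a0 X : R) :
  0 < kp -> 0 < a0 -> (forall n, (0 < n)%N -> 0 < a_ n) -> (forall n, (0 < n)%N -> (0 < k n)%N) ->
  (forall n, (0 < n)%N -> (k n)%:R / n%:R < c0) ->
  a_ n @[n --> \oo] --> 0 -> (k n)%:R * a_ n ^+ 2 @[n --> \oo] --> +oo ->
  exists (J : nat -> nat) (N1 : nat), forall n, (N1 <= n)%N ->
    [/\ (0 < n)%N, 0 < a_ n, a_ n <= a0 & X <= (k n)%:R * a_ n ^+ 2] /\
    1 <= n%:R * a_ n ^+ 2 /\ kp * a_ n / 2 <= (2 ^+ J n)^-1 <= kp * a_ n.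
Proof.
move=> kp0 a00 apos kpos hc ha hka.
have c00 : 0 < c0.
  by apply: lt_trans (hc 1%N isT); rewrite divr_gt0 ?ltr0n ?kpos.
have d0 : 0 < Num.min a0 kp^-1 by rewrite lt_min a00 invr_gt0.
have /cvgrPdist_lt/(_ _ d0)[N2 _ hN2] := ha.
have /cvgryPge/(_ (Num.max X c0))[N3 _ hN3] := hka.
(* Where no such level exists, which can happen only before the index chosen below, [J n] is 0 by
   default. *)
pose J n := if pselect (exists J : nat, kp * a_ n / 2 <= (2 ^+ J)^-1 <= kp * a_ n) is left h
  then xchoose h else 0%N.
exists J, (maxn 1 (maxn N2 N3)) => n; rewrite !geq_max => /and3P[n0 n2 n3].
have a1 := apos n n0.
have := hN2 n n2; rewrite /= sub0r normrN (gtr0_norm a1) lt_min => /andP[aa0 akp].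
have := hN3 n n3; rewrite /= ge_max => /andP[h1 h2].
split; first by split=> //; exact: ltW.
split.
  have n1 : 0 < n%:R :> R by rewrite ltr0n.
  (* Through [k n <= c0 * n], the lower bound [c0] on [k n * a_n ^ 2] becomes [n * a_n ^ 2 >= 1]. *)
  have h3 : (k n)%:R * a_ n ^+ 2 <= c0 * (n%:R * a_ n ^+ 2).
    rewrite mulrA ler_wpM2r ?sqr_ge0//.
    by have := hc n n0; rewrite ltr_pdivrMr// => /ltW.
  by have := le_trans h2 h3; rewrite ler_pMr.
rewrite /J; case: pselect => [h|[]]; first exact: (xchooseP h).
apply: dyadic_scale; first exact: mulr_gt0.
by rewrite mulrC -ler_pdivlMr// div1r ltW.
Qed.

End scales.

Section energy_rate.
Context {R : realType} (P : probability (R * R)%type R) {C : finType} (cell : R * R -> C).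
Hypothesis mc : forall c, measurable (cell @^-1` [set c]).
Variables (r : R) (e : set (R * R) -> R).
Hypothesis he : energy_le P r e.
Local Notation D := (fun c => e (cell @^-1` [set c])).

(** The test coefficients [D c / P c] turn the variational expression into the rate. *)
Lemma rate_le_energy : rate (cell_mass P cell) D <= r.
Proof.
have [_ _ /(_ C cell (fun c => D c / cell_mass P cell c) mc)] := he.
apply: le_trans; rewrite le_eqVlt; apply/orP; left; apply/eqP.
rewrite /rate !mulr_sumr -sumrB; apply: eq_bigr => c _.
rewrite -/(cell_mass P cell c); have [->|p0] := eqVneq (cell_mass P cell c) 0.
  by rewrite invr0 !(mulr0, mul0r) subr0.
by field.
Qed.

Lemma energy_cells_sum0 : \sum_c D c = 0.
Proof.
have := energy_cells xpredT he mc; rewrite (_ : _ @^-1` _ = setT) => [<-|]; first by have [] := he.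
by apply/seteqP; split.
Qed.

Lemma energy_null_cell c : cell_mass P cell c = 0 -> D c = 0.
Proof.
move=> p0; have := energy_le_sqr he (mc c); rewrite -/(cell_mass P cell c) p0 mulr0 => h.
by apply/eqP; rewrite -sqrf_eq0 eq_le h sqr_ge0.
Qed.

End energy_rate.

Lemma energy_le_trans {R : realType} (P : probability (R * R)%type R) r r' e :
  r <= r' -> energy_le P r e -> energy_le P r' e.
Proof.
move=> rr [h1 h2 h3]; split=> // I cell c mc; exact: le_trans (h3 _ _ _ mc) rr.
Qed.

Section typical_mono.
Context {R : realType} (P : probability (R * R)%type R).

Lemma typical_le (lo1 len1 lo2 len2 : R) {I : finType} (cell : R * R -> I) j n eps kap kap' z :
  kap <= kap' -> typical P lo1 len1 lo2 len2 cell j n eps kap z ->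
  typical P lo1 len1 lo2 len2 cell j n eps kap' z.
Proof. by move=> kk [h1 h2 h3]; split=> // c; exact: le_trans (h2 c) kk. Qed.

End typical_mono.

Section outer_inner_bounds.
Context {d} {T : measurableType d} {R : realType} (Pr : probability T R).

Lemma outer_prob_le (B A : set T) : measurable A -> B `<=` A -> (outer_prob Pr B <= Pr A)%E.
Proof. by move=> mA BA; apply: ereal_inf_lbound; exists A. Qed.

Lemma inner_prob_ge (B A : set T) : measurable A -> A `<=` B -> (Pr A <= inner_prob Pr B)%E.
Proof.
move=> mA AB; rewrite /inner_prob.
have h : (outer_prob Pr (~` B) <= Pr (~` A))%E.
  by apply: outer_prob_le; [exact: measurableC|exact: subsetC].
rewrite probability_setC// in h.
have o0 : (0 <= outer_prob Pr (~` B))%E.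
  by apply: le_ereal_inf_tmp => _ [A' _ <-]; exact: measure_ge0.
have PA : Pr A \is a fin_num by exact: fin_num_measure.
have of' : outer_prob Pr (~` B) \is a fin_num.
  rewrite ge0_fin_numE//; apply: le_lt_trans h _.
  by rewrite ltey_eq fin_numB PA.
by rewrite leeBrDr// -leeBrDl.
Qed.

Lemma outer_prob_ge0 (B : set T) : (0 <= outer_prob Pr B)%E.
Proof. by apply: le_ereal_inf_tmp => _ [A' _ <-]; exact: measure_ge0. Qed.

End outer_inner_bounds.

Section bootstrap_events.
Context {d} {B : measurableType d} {R : realType} (Pb : probability B R).
Variables (Zb : nat -> B -> R * R) (n k : nat) (z : nat -> R * R).
Hypothesis hb : iid_with_law Pb `I_k Zb (empirical n z).
Hypotheses (k0 : (0 < k)%N).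

Lemma bootstrap_chaining (lo1 len1 lo2 len2 a d0 C Lb : R) (J0 J : nat) :
  0 <= len1 -> 0 <= len2 -> 0 < a -> 0 < d0 -> 0 < C -> (J0 <= J)%N ->
  (forall j, (J0 < j <= J)%N -> [/\
     forall md i l, (i < 2 ^ j)%N -> (l <= 2 ^ j)%N ->
       emp n z (quad md (grid lo1 len1 j i.+1) (grid lo2 len2 j l)) -
       emp n z (quad md (grid lo1 len1 j i) (grid lo2 len2 j l)) <= 2 * C / 2 ^+ j,
     forall md i l, (i <= 2 ^ j)%N -> (l < 2 ^ j)%N ->
       emp n z (quad md (grid lo1 len1 j i) (grid lo2 len2 j l.+1)) -
       emp n z (quad md (grid lo1 len1 j i) (grid lo2 len2 j l)) <= 2 * C / 2 ^+ j
     & a * d0 * (3 / 4) ^+ j <= 2 * C / 2 ^+ j]) ->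
  (forall j, (J0 <= j)%N -> Lb + 1 + j%:R <= d0 ^+ 2 / (8 * C) * (9 / 8) ^+ j) ->
  47 <= k%:R * a ^+ 2 ->
  exists bad : set B, [/\ measurable bad,
    (Pb bad <= (expR (- (k%:R * a ^+ 2 * Lb)))%:E)%E
    & forall v, ~ bad v -> forall md j, (J0 < j <= J)%N ->
        grid_steps_le lo1 len1 lo2 len2
          (fun s t => emp k (Zb ^~ v) (quad md s t) - emp n z (quad md s t)) j
          (a * d0 * (3 / 4) ^+ j)].
Proof.
move=> l1 l2 a0 d00 C0 J0J hm hA hka.
have muE A : fine (empirical n z A) = emp n z A :> R by rewrite empiricalE.
have muD A A' : measurable A -> measurable A' -> A `<=` A' ->
    fine (empirical n z (A' `\` A)) = fine (empirical n z A') - fine (empirical n z A) :> R.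
  by move=> _ _ AA; rewrite !muE emp_setD.
have JE : (J0 + (J - J0))%N = J by rewrite subnKC.
pose mm md s t : R := fine (empirical n z (quad md s t)).
have g1 j : (J0 < j <= J0 + (J - J0))%N ->
    (forall md i l, (i < 2 ^ j)%N -> (l <= 2 ^ j)%N ->
       mm md (grid lo1 len1 j i.+1) (grid lo2 len2 j l) -
       mm md (grid lo1 len1 j i) (grid lo2 len2 j l) <= 2 * C / 2 ^+ j) /\
    (forall md i l, (i <= 2 ^ j)%N -> (l < 2 ^ j)%N ->
       mm md (grid lo1 len1 j i) (grid lo2 len2 j l.+1) -
       mm md (grid lo1 len1 j i) (grid lo2 len2 j l) <= 2 * C / 2 ^+ j).
  rewrite JE => hj; have [h1 h2 _] := hm j hj.
  by split=> md i l hi hl; rewrite /mm !muE; [exact: h1|exact: h2].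
have g2 j : (J0 < j <= J0 + (J - J0))%N -> a * d0 * (3 / 4) ^+ j <= 2 * C / 2 ^+ j.
  by rewrite JE => hj; have [] := hm j hj.
have [bad [b1 b2 b3]] := chaining_event hb (@subset_refl _ _) k0 muD l1 l2 a0 d00 C0 g1 g2 hA hka.
exists bad; split=> // v hv md j hj; have := b3 v hv md j; rewrite JE => /(_ hj).
rewrite (_ : discrepancy _ _ _ _ _ = fun s t => emp k (Zb ^~ v) (quad md s t) - emp n z (quad md s t))//.
by apply/funext => s; apply/funext => t; rewrite /discrepancy muE.
Qed.

Lemma bootstrap_null {I : finType} (cell : R * R -> I) :
  (forall c, measurable (cell @^-1` [set c])) ->
  exists bad : set B, [/\ measurable bad, Pb bad = 0%E
    & forall v, ~ bad v -> forall c, emp n z (cell @^-1` [set c]) = 0 :> R ->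
        emp k (Zb ^~ v) (cell @^-1` [set c]) = 0 :> R].
Proof.
move=> mc.
have h c : exists bad : set B, [/\ measurable bad, Pb bad = 0%E
    & forall v, ~ bad v -> emp n z (cell @^-1` [set c]) = 0 :> R ->
        emp k (Zb ^~ v) (cell @^-1` [set c]) = 0 :> R].
  have [c0|c0] := eqVneq (emp n z (cell @^-1` [set c])) (0 : R); last first.
    by exists set0; split=> // v _ h; rewrite h eqxx in c0.
  have [|bad [? ? hv]] := null_event hb (@subset_refl _ _) (mc c).
    by rewrite empiricalE c0.
  by exists bad; split=> // v /hv.
have [bad hbad] := choice h; exists (\bigcup_c bad c); split.
- by apply: fin_bigcup_measurable; [exact: finite_finset|move=> c _; have [] := hbad c].
- apply/eqP; rewrite eq_le measure_ge0 andbT.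
  apply: le_trans (measure_finType_bigcup_le _ _) _; first by move=> c; have [] := hbad c.
  by rewrite big1// => c _; have [] := hbad c.
- by move=> v hv c; have [_ _] := hbad c; apply=> hb'; apply: hv; exists c.
Qed.

End bootstrap_events.

Section exponential_combination.
Context {R : realType}.

Lemma expRN_le_half (x : R) : 1 <= x -> expR (- x) <= 2^-1.
Proof.
by move=> x1; rewrite expRN lef_pV2 ?posrE ?expR_gt0//; have := expR_ge1Dx x; lra.
Qed.

(** As [s * (eps / 2) >= 1], a change of [eps / 2] in the exponent is worth a factor 2, so each
    summand is at most half of the right-hand side. *)
Lemma add_expR_le (s r eps : R) : 0 < s -> 0 < eps -> 2 / eps <= s ->
  expR (- (s * r)) + expR (- (s * (r - eps / 2))) <= expR (- (s * (r - eps))).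
Proof.
move=> s0 eps0 hs.
have h : expR (- (s * (eps / 2))) <= 2^-1.
  by apply: expRN_le_half; rewrite mulrA ler_pdivlMr// mul1r -ler_pdivrMr.
have -> : - (s * r) = - (s * (r - eps / 2)) + - (s * (eps / 2)) by ring.
have -> : - (s * (r - eps / 2)) = - (s * (r - eps)) + - (s * (eps / 2)) by field.
rewrite !expRD; have := expR_ge0 (- (s * (r - eps))); have := expR_ge0 (- (s * (eps / 2))).
move: h; set x := expR _; set y := expR _; clearbody x y; clear => h x0 y0.
have := ler_wpM2l y0 h; have := ler_wpM2l (mulr_ge0 y0 x0) h; lra.
Qed.

(** The term with the additional unit is at most half of the left-hand side of the hypothesis,
    because [s >= 1]; the factor 1/2 that remains is absorbed by [eps / 2]. *)
Lemma expR_le_sub (s r eps t : R) : 1 <= s -> 0 < eps -> 2 / eps <= s ->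
  expR (- (s * (r + eps / 2))) <= t + expR (- (s * (r + eps / 2 + 1))) ->
  expR (- (s * (r + eps))) <= t.
Proof.
move=> s1 eps0 hs.
have q1 := expRN_le_half s1.
have q2 : expR (- (s * (eps / 2))) <= 2^-1.
  by apply: expRN_le_half; rewrite mulrA ler_pdivlMr// mul1r -ler_pdivrMr.
have -> : - (s * (r + eps / 2 + 1)) = - (s * (r + eps / 2)) + - s by ring.
have -> : - (s * (r + eps)) = - (s * (r + eps / 2)) + - (s * (eps / 2)) by field.
rewrite !expRD; have := expR_ge0 (- (s * (r + eps / 2))).
move: q1 q2; set x := expR _; set y := expR _; set z := expR _.
clearbody x y z; clear => h1 h2 z0.
have := ler_wpM2l z0 h1; have := ler_wpM2l z0 h2; lra.
Qed.

End exponential_combination.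

Lemma exists2_choice {S U : Type} (A Q : S -> U -> Prop) :
  (forall x, exists2 y, A x y & Q x y) -> exists f : S -> U, forall x, A x (f x) /\ Q x (f x).
Proof.
move=> h; have {}h x : exists y, A x y /\ Q x y by have [y] := h x; exists y.
by have [f hf] := choice h; exists f.
Qed.

Section bootstrap_deviations.
Context {R : realType} {d : measure_display} {T : measurableType d}.
Variables (Pr : probability T R) (P : probability (R * R)%type R) (Z : nat -> T -> R * R).
Hypothesis hZ : iid_with_law Pr setT Z P.
Variable k : nat -> nat.
Hypothesis hk0 : forall n, (0 < n)%N -> (0 < k n)%N.
Variable c0 : R.
Hypothesis hc0 : forall n, (0 < n)%N -> (k n)%:R / n%:R < c0.
Variables (dB : nat -> T -> measure_display).
Variable B : forall (n : nat) (w : T), measurableType (dB n w).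
Variable PB : forall (n : nat) (w : T), probability (B n w) R.
Variable Zb : forall (n : nat) (w : T), nat -> B n w -> R * R.
Hypothesis hZb : forall (n : nat) (w : T), (0 < n)%N ->
  iid_with_law (PB n w) `I_(k n) (@Zb n w) (empirical n (Z ^~ w)).
Variable an : nat -> R.
Hypothesis han0 : forall n, (0 < n)%N -> 0 < an n.
Hypothesis han_cvg0 : an n @[n --> \oo] --> 0.
Hypothesis hkan : (k n)%:R * an n ^+ 2 @[n --> \oo] --> +oo.
Variables (p1 q1 p2 q2 lo1 len1 lo2 len2 m L rho0 : R).
Hypotheses (len1_gt0 : 0 < len1) (len2_gt0 : 0 < len2) (L_gt0 : 0 < L).
Hypotheses (m_gt0 : 0 < m) (m_le1 : m <= 1) (rho0_gt0 : 0 < rho0).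
Hypotheses (pq1 : p1 <= q1) (pq2 : p2 <= q2).
Local Notation F := (left_df P).
Local Notation G := (right_df P).
Hypothesis hF : smooth_df F (derive1 F) lo1 (lo1 + len1) m L.
Hypothesis hG : smooth_df G (derive1 G) lo2 (lo2 + len2) m L.
Hypothesis hH : smooth_df2 (joint_df P) (dHdx P) (dHdy P) lo1 (lo1 + len1) lo2 (lo2 + len2) L.
Hypothesis dom1 : forall u, p1 <= u <= q1 -> [/\ lo1 <= quantile F u - rho0,
  quantile F u + rho0 <= lo1 + len1 & F (quantile F u) = u].
Hypothesis dom2 : forall u, p2 <= u <= q2 -> [/\ lo2 <= quantile G u - rho0,
  quantile G u + rho0 <= lo2 + len2 & G (quantile G u) = u].
Local Notation rect := (rect p1 q1 p2 q2).
Local Notation cell J0 := (coarse_cell lo1 len1 lo2 len2 J0).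
Local Notation scale n := ((k n)%:R * an n ^+ 2).

Let copula_gap n w (v : B n w) (s : rect) : R :=
  copula (empirical (k n) (fun i => Zb i v)) (val s) - copula (empirical n (fun i => Z i w)) (val s).

(** The thresholds of the coarse bounds depend on [J0] and [del], which are found only here, so they
    enter as a function [kapf]. The exceptional bootstrap event comes from chaining alone and has
    any prescribed rate [Lb]; outside it the expansion holds for all [e] at once. *)
Lemma bootstrap_expansion (r eta Lb X : R) (kapf : nat -> R -> R) : 0 <= r -> 0 < eta ->
  (forall J del, 0 < del -> 0 < kapf J del) ->
  exists (J0 : nat) (del : R) (E : nat -> set T) (N : nat), [/\ 0 < del,
    forall n, measurable (E n), eventually_as Pr E
  & forall n w, (N <= n)%N -> E n w ->
    [/\ [/\ (0 < n)%N, 0 < an n, an n <= kapf J0 del, (kapf J0 del)^-1 <= scale n & X <= scale n],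
        forall c, `|emp n (Z ^~ w) (cell J0 @^-1` [set c]) - cell_mass P (cell J0) c| <= kapf J0 del,
        forall c, cell_mass P (cell J0) c = 0 -> emp n (Z ^~ w) (cell J0 @^-1` [set c]) = 0 :> R
      & exists bad : set (B n w), [/\ measurable bad,
        (PB n w bad <= (expR (- (scale n * Lb)))%:E)%E
        & forall v, ~ bad v -> forall e, energy_le P r e ->
          (forall c, `|emp (k n) (fun i => Zb i v) (cell J0 @^-1` [set c])
             - emp n (Z ^~ w) (cell J0 @^-1` [set c])
             - an n * e (cell J0 @^-1` [set c])| <= an n * del) ->
          forall s, `|copula_gap v s - an n * phi_of P e s| <= eta * an n]]].
Proof.
move=> r0 eta0 kapf0.
have lip1 s s' : lo1 <= s -> s <= s' -> s' <= lo1 + len1 -> F s' - F s <= L * (s' - s).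
  by move=> h1 h2 h3; have [/(_ _ _ h1 h2 h3)/andP[]] := hF.
have lip2 s s' : lo2 <= s -> s <= s' -> s' <= lo2 + len2 -> G s' - G s <= L * (s' - s).
  by move=> h1 h2 h3; have [/(_ _ _ h1 h2 h3)/andP[]] := hG.
have l10 := ltW len1_gt0; have l20 := ltW len2_gt0.
have C0 : 0 < L * (len1 + len2) by rewrite mulr_gt0// addr_gt0.
have [kp [th [d0 [kap [del [a0 [J0 /= [[kp0 th0 th1 d00] [kap0 kap1 del0 a00] hA hexp]]]]]]]] :=
  copula_expansion len1_gt0 len2_gt0 L_gt0 m_gt0 m_le1 rho0_gt0 hF hG hH Lb r0 eta0.
have kf0 := kapf0 J0 _ del0.
pose a1 := Num.min a0 (kapf J0 del); have a10 : 0 < a1 by rewrite lt_min a00.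
pose kap' := Num.min kap (kapf J0 del); have kap'0 : 0 < kap' by rewrite lt_min kap0.
(* The number 47 is what [chaining_event] requires. *)
pose Y := Num.max 47 (Num.max (kapf J0 del)^-1 (X)).
have [J [N hN]] := scale_eventually Y kp0 a10 han0 hk0 hc0 han_cvg0 hkan.
have mc := @measurable_coarse_cell R lo1 len1 lo2 len2 J0.
have kap'1 : kap' <= 1 by rewrite ge_min kap1.
have hN' n : (N <= n)%N -> [/\ (0 < n)%N, 0 < an n, 1 <= n%:R * an n ^+ 2
     & kp * an n / 2 <= (2 ^+ J n)^-1 <= kp * an n].
  by move=> /hN[[? ? _ _] [? ?]].
have [E [mE asE hE]] := typical_eventually hZ l10 l20 C0
  (fun j md i l => mass_steps1 l10 l20 L_gt0 lip1 lip2 md (j := j) (i := i) (l := l))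
  (fun j md i l => mass_steps2 l10 l20 L_gt0 lip1 lip2 md (j := j) (i := i) (l := l))
  mc kp0 th0 th1 kap'0 kap'1 hN'.
exists J0, del, E, N; split=> // n w Nn Ew.
have [[n0 an_gt0 ana hY] [_ hJ]] := hN n Nn.
have ty := hE n w Nn Ew.
move: hY; rewrite /Y !ge_max => /and3P[Y1 Y2 Y3].
move: ana; rewrite le_min => /andP[ana0 anak].
have kk0 := hk0 n0.
have kapk : kap' <= kap by rewrite ge_min lexx.
have kapk' : kap' <= kapf J0 del by rewrite ge_min lexx orbT.
split=> //.
- by move=> c; have [_ h _] := ty; exact: le_trans (h c) kapk'.
- by have [_ _ h] := ty.
have [J0J hmass hcl] := hexp (an n) (J n) n (Z ^~ w) an_gt0 ana0 hJ (typical_le kapk ty).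
have [bad [mbad pbad hbad]] := bootstrap_chaining (hZb w n0) kk0 l10 l20 an_gt0 d00 C0
  (ltnW J0J) hmass hA Y1.
exists bad; split=> // v hv e he hcells s.
have [/= hu hv'] : p1 <= (val s).1 <= q1 /\ p2 <= (val s).2 <= q2.
  by case: s => uv /= h; have /set_mem[/=] := h; rewrite !in_itv.
have [x1 x2 x3] := dom1 hu; have [y1 y2 y3] := dom2 hv'.
exact: (hcl (k n) (fun i => Zb i v) e (hbad v hv) he hcells _ _ _ _ x1 x2 x3 y1 y2 y3).
Qed.

Let dom1' u : p1 <= u <= q1 -> lo1 <= quantile F u <= lo1 + len1.
Proof. by move=> /dom1[h1 h2 _]; exact: between_margin rho0_gt0 h1 h2. Qed.

Let dom2' u : p2 <= u <= q2 -> lo2 <= quantile G u <= lo2 + len2.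
Proof. by move=> /dom2[h1 h2 _]; exact: between_margin rho0_gt0 h1 h2. Qed.

Variable Om : set (rect -> R).
Hypothesis hOm : Om `<=` ell_infty.

Let event n w : set (B n w) := [set v | scale_set (an n) Om (copula_gap v)].

(** Outside an event of the right probability, the cell increments of the bootstrap have rate at
    most [r] and are therefore those of some [e] of energy at most [r]. The expansion then puts an
    element of [Om] within [eta] of [phi_of e], which [closure_separation] forbids. *)
Lemma outer_prob_upper (r eps : R) : 0 <= r -> 0 < eps -> (r%:E < I_C P (linf_closure Om))%E ->
  exists E : nat -> set T, [/\ forall n, measurable (E n), eventually_as Pr E
  & exists N, forall n w, (N <= n)%N -> E n w -> 0 < scale n /\
    (outer_prob (PB n w) (@event n w) <= (expR (- (scale n * (r - eps))))%:E)%E].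
Proof.
move=> r0 eps0 hr.
have [eta eta0 hsep] := closure_separation len1_gt0 len2_gt0 m_gt0 L_gt0 pq1 pq2 hF hG hH
  dom1' dom2' hOm hr.
have e20 : 0 < eps / 2 by rewrite divr_gt0.
have mc J0 := @measurable_coarse_cell R lo1 len1 lo2 len2 J0.
have cm0 J0 c : 0 <= cell_mass P (cell J0) c by rewrite fine_ge0.
have hcoarse J0 := coarse_upper (cm0 J0) e20 r0.
have [kapf hkapf] := exists2_choice hcoarse.
(* The chaining rate [Lb = r] matches the coarse bound, and [2 / eps] is the lower bound on the
   speed asked by [add_expR_le]. *)
have [J0 [del [E [N [del0 mE asE hE]]]]] := bootstrap_expansion r (2 / eps) r0 eta0
  (kapf := fun J _ => kapf J) (fun J _ _ => (hkapf J).1).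
exists E; split=> //; exists N => n w Nn Ew.
have [[n0 a0 a1 ka1 ka2] hcm hnull [bad1 [mb1 pb1 hb1]]] := hE n w Nn Ew.
have kk0 := hk0 n0; have hb := hZb w n0.
have s0 : 0 < scale n by rewrite mulr_gt0 ?ltr0n ?exprn_gt0.
split=> //.
have muE A : fine (empirical n (Z ^~ w) A) = emp n (Z ^~ w) A :> R by rewrite empiricalE.
pose p := cell_mass (empirical n (Z ^~ w)) (cell J0).
have pE c : p c = emp n (Z ^~ w) (cell J0 @^-1` [set c]) by rewrite /p /cell_mass muE.
have p0 c : 0 <= p c by rewrite pE emp_ge0.
have psum : \sum_c p c = 1 by exact: (sum_cell_mass hb (@subset_refl _ _) (mc J0) kk0).
have hp c : `|p c - cell_mass P (cell J0) c| <= kapf J0 by rewrite pE.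
have hco := (hkapf J0).2 p (k n) (an n) p0 psum hp a0 a1 kk0 ka1.
have [mb2 pb2] := iid_product_law hb (@subset_refl _ _) (mc J0)
  (fun x => r < rate (cell_mass P (cell J0)) (fun c => (freq x (pred1 c) - p c) / an n)).
set bad2 := [set v | _] in mb2 pb2.
have [bad3 [mb3 pb3 hb3]] := bootstrap_null hb (mc J0).
have mU := measurableU _ _ (measurableU _ _ mb1 mb2) mb3.
apply: (@le_trans _ _ (PB n w (bad1 `|` bad2 `|` bad3))).
  apply: outer_prob_le => // v [w0 Ow0 hgap].
  apply: contrapT => hv.
  have nb1 : ~ bad1 v by move=> h; apply: hv; left; left.
  have nb2 : ~ bad2 v by move=> h; apply: hv; left; right.
  have nb3 : ~ bad3 v by move=> h; apply: hv; right.
  pose D c := (emp (k n) (fun i => Zb i v) (cell J0 @^-1` [set c]) - p c) / an n.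
  have hrate : rate (cell_mass P (cell J0)) D <= r.
    rewrite leNgt; apply/negP => h; apply: nb2; rewrite /bad2 /=; move: h.
    by congr (_ < rate _ _); apply/funext => c; rewrite /D emp_freq.
  have Dsum : \sum_c D c = 0.
    rewrite -mulr_suml sumrB psum; apply/eqP; rewrite mulf_eq0; apply/orP; left.
    rewrite subr_eq0 -emp_cells (_ : _ @^-1` _ = setT); first by rewrite emp_setT.
    by apply/seteqP; split.
  (* The sample and the bootstrap sample both avoid null cells, so the increments vanish there. *)
  have D0 c : cell_mass P (cell J0) c = 0 -> D c = 0.
    by move=> /hnull h; rewrite /D pE (hb3 v nb3 c h) h subrr mul0r.
  have [e he hec] := coarse_density (mc J0) Dsum D0.
  have hcl c : `|emp (k n) (fun i => Zb i v) (cell J0 @^-1` [set c])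
      - emp n (Z ^~ w) (cell J0 @^-1` [set c]) - an n * e (cell J0 @^-1` [set c])| <= an n * del.
    rewrite hec /D pE mulrC divfK ?gt_eqF// subrr normr0 mulr_ge0// ltW//.
  apply: (hsep e w0 (energy_le_trans hrate he) Ow0) => s.
  have := hb1 v nb1 e (energy_le_trans hrate he) hcl s.
  have hgs : copula_gap v s = an n * w0 s by rewrite -hgap.
  by rewrite hgs -mulrBr normrM (gtr0_norm a0) mulrC ler_pM2r.
apply: le_trans (probability_setU_le _ (measurableU _ _ mb1 mb2) mb3) _.
rewrite pb3 adde0; apply: le_trans (probability_setU_le _ mb1 mb2) _.
apply: (@le_trans _ _ ((expR (- (scale n * r)))%:E + (expR (- (scale n * (r - eps / 2))))%:E)%E).
  by apply: leeD => //; rewrite pb2 lee_fin.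
by rewrite -EFinD lee_fin; exact: add_expR_le.
Qed.

(** Some [e] of energy at most [r] has [phi_of e] in the interior. When the cell frequencies follow
    [an n * e] within [an n * del], an event whose probability [coarse_lower] bounds from below, the
    rescaled gap lies in a ball around [phi_of e] contained in [Om]. *)
Lemma inner_prob_lower (r eps : R) : 0 <= r -> 0 < eps -> (I_C P (linf_interior Om) < r%:E)%E ->
  exists E : nat -> set T, [/\ forall n, measurable (E n), eventually_as Pr E
  & exists N, forall n w, (N <= n)%N -> E n w -> 0 < scale n /\
    ((expR (- (scale n * (r + eps))))%:E <= inner_prob (PB n w) (@event n w))%E].
Proof.
move=> r0 eps0 /energy_of_I_C_lt[e [he [phib [e1 e10 hball]]]].
have e20 : 0 < eps / 2 by rewrite divr_gt0.
have eta0 : 0 < e1 / 2 by rewrite divr_gt0.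
have mc J0 := @measurable_coarse_cell R lo1 len1 lo2 len2 J0.
have cm0 J0 c : 0 <= cell_mass P (cell J0) c by rewrite fine_ge0.
pose D J0 c : R := e (cell J0 @^-1` [set c]).
(* The thresholds are indexed by level and tolerance; for a tolerance that is not positive the value
   1 is a dummy. *)
have hcoarse (x : nat * R) : exists2 kap : R, 0 < kap & 0 < x.2 ->
    forall p k a, (forall c, 0 <= p c) -> \sum_c p c = 1 ->
    (forall c, `|p c - cell_mass P (cell x.1) c| <= kap) ->
    (forall c, cell_mass P (cell x.1) c = 0 -> p c = 0) ->
    0 < a -> a <= kap -> (0 < k)%N -> kap^-1 <= k%:R * a ^+ 2 ->
    expR (- (k%:R * a ^+ 2 * (rate (cell_mass P (cell x.1)) (D x.1) + eps / 2))) <=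
    \sum_(y : {ffun 'I_k -> _} |
       [forall c, `|freq y (pred1 c) - p c - a * D x.1 c| <= a * x.2]) prodw p y.
  have [x20|x20] := ltrP 0 x.2; last by exists 1.
  have [kap kap0 h] := coarse_lower (cm0 x.1) (energy_cells_sum0 (mc x.1) he)
    (energy_null_cell (mc x.1) he) e20 x20.
  by exists kap.
have [kapf hkapf] := exists2_choice hcoarse.
pose X := Num.max 1 (2 / eps).
(* The chaining rate exceeds [r + eps / 2] by one, so that the exceptional event can be subtracted
   from the lower bound. *)
have [J0 [del [E [N [del0 mE asE hE]]]]] := bootstrap_expansion (r + eps / 2 + 1) X r0 eta0
  (kapf := fun J del => kapf (J, del)) (fun J del _ => (hkapf (J, del)).1).
exists E; split=> //; exists N => n w Nn Ew.
have [[n0 a0 a1 ka1 ka2] hcm hnull [bad1 [mb1 pb1 hb1]]] := hE n w Nn Ew.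
have kk0 := hk0 n0; have hb := hZb w n0.
have s0 : 0 < scale n by rewrite mulr_gt0 ?ltr0n ?exprn_gt0.
split=> //.
have muE A : fine (empirical n (Z ^~ w) A) = emp n (Z ^~ w) A :> R by rewrite empiricalE.
pose p := cell_mass (empirical n (Z ^~ w)) (cell J0).
have pE c : p c = emp n (Z ^~ w) (cell J0 @^-1` [set c]) by rewrite /p /cell_mass muE.
have p0 c : 0 <= p c by rewrite pE emp_ge0.
have psum : \sum_c p c = 1 by exact: (sum_cell_mass hb (@subset_refl _ _) (mc J0) kk0).
have hp c : `|p c - cell_mass P (cell J0) c| <= kapf (J0, del) by rewrite pE.
have hp0 c : cell_mass P (cell J0) c = 0 -> p c = 0 by move=> /hnull; rewrite pE.
have hco := (hkapf (J0, del)).2 del0 p (k n) (an n) p0 psum hp hp0 a0 a1 kk0 ka1.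
have [mb2 pb2] := iid_product_law hb (@subset_refl _ _) (mc J0)
  (fun x => [forall c, `|freq x (pred1 c) - p c - an n * D J0 c| <= an n * del]).
set good := [set v | _] in mb2 pb2.
have mA : measurable (good `\` bad1) by exact: measurableD.
have sub : good `\` bad1 `<=` @event n w.
  move=> v [gv nb1].
  have hcl c : `|emp (k n) (fun i => Zb i v) (cell J0 @^-1` [set c])
      - emp n (Z ^~ w) (cell J0 @^-1` [set c]) - an n * e (cell J0 @^-1` [set c])| <= an n * del.
    by rewrite -pE emp_freq; exact: (forallP gv c).
  have hs s : `|(an n)^-1 * copula_gap v s - phi_of P e s| <= e1 / 2.
    rewrite -(ler_pM2l a0) -{1}(gtr0_norm a0) -normrM mulrBr mulrA mulfV ?gt_eqF// mul1r.
    by rewrite [leRHS]mulrC; exact: hb1 v nb1 e he hcl s.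
  exists (fun s => (an n)^-1 * copula_gap v s); last first.
    by apply/funext => s; rewrite mulrA mulfV ?gt_eqF// mul1r.
  have bnd : ell_infty (fun s => (an n)^-1 * copula_gap v s).
    have [M hM] := phib; exists (M + e1 / 2) => s.
    rewrite -[X in `|X|](subrK (phi_of P e s)) addrC (le_trans (ler_normD _ _))//.
    by rewrite lerD.
  apply: hball => //; apply: le_lt_trans (sup_norm_le pq1 pq2 hs) _.
  by rewrite ltr_pdivrMr// ltr_pMr// ltr1n.
apply: le_trans (inner_prob_ge _ mA sub).
have h1 : (PB n w good <= PB n w (good `\` bad1) + PB n w bad1)%E.
  apply: le_trans (probability_setU_le _ mA mb1).
  apply: le_measure; rewrite ?inE//; first exact: measurableU.
  by move=> v gv; have [hv|hv] := pselect (bad1 v); [right|left].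
have fA : PB n w (good `\` bad1) \is a fin_num by exact: fin_num_measure.
set pA := PB n w (good `\` bad1) in h1 fA *.
rewrite -(fineK fA) lee_fin.
have {h1} : (\sum_(x : {ffun 'I_(k n) -> _} |
      [forall c, `|freq x (pred1 c) - p c - an n * D J0 c| <= an n * del]) prodw p x)
    <= fine pA + expR (- (scale n * (r + eps / 2 + 1))).
  rewrite -lee_fin EFinD fineK// -pb2; apply: (le_trans h1).
  by apply: leeD.
have hrate := rate_le_energy (mc J0) he.
have h2 : expR (- (scale n * (r + eps / 2))) <=
    expR (- (scale n * (rate (cell_mass P (cell J0)) (D J0) + eps / 2))).
  by rewrite ler_expR lerN2 ler_wpM2l ?(ltW s0)// lerD2r.
move=> /(le_trans (le_trans h2 hco)).
by move: ka2; rewrite /X ge_max => /andP[k1 k2]; exact: expR_le_sub.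
Qed.

End bootstrap_deviations.

(** * Normalized logarithms and conclusion *)

Lemma lne_scale_le {R : realType} (s y : R) (x : \bar R) : 0 < s -> (0 <= x)%E ->
  (x <= (expR (- (s * y)))%:E)%E -> ((s^-1)%:E * lne x <= (- y)%:E)%E.
Proof.
move=> s0 x0 h; have {}h : (lne x <= (- (s * y))%:E)%E.
  rewrite -(expeRK (- (s * y))%:E) lee_lne// in_itv/= ?leey ?andbT//.
apply: (@le_trans _ _ ((s^-1)%:E * (- (s * y))%:E)%E).
  by rewrite lee_wpmul2l// lee_fin invr_ge0 ltW.
by rewrite -EFinM mulrN mulKf ?gt_eqF.
Qed.

Lemma lne_scale_ge {R : realType} (s y : R) (x : \bar R) : 0 < s ->
  ((expR (- (s * y)))%:E <= x)%E -> ((- y)%:E <= (s^-1)%:E * lne x)%E.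
Proof.
move=> s0 h; have x0 : (0 <= x)%E by apply: le_trans h; rewrite lee_fin expR_ge0.
have {}h : ((- (s * y))%:E <= lne x)%E.
  rewrite -(expeRK (- (s * y))%:E) lee_lne// in_itv/= ?leey ?andbT//.
apply: (@le_trans _ _ ((s^-1)%:E * (- (s * y))%:E)%E).
  by rewrite -EFinM mulrN mulKf ?gt_eqF.
by rewrite lee_wpmul2l// lee_fin invr_ge0 ltW.
Qed.

Lemma I_C_ge0 {R : realType} (P : probability (R * R)%type R) (p1 q1 p2 q2 : R)
  (Psi : set (rect p1 q1 p2 q2 -> R)) : (0 <= I_C P Psi)%E.
Proof.
apply: le_ereal_inf_tmp => _ [Q _ <-]; rewrite /rho02; case: ifP => // _.
by rewrite mule_ge0// ?lee_fin ?invr_ge0// integral_ge0// => z _; exact: sqre_ge0.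
Qed.

Lemma eventually_asT {d} {T : measurableType d} {R : realType} (Pr : probability T R) :
  eventually_as Pr (fun=> setT).
Proof. by exists set0 => [|w _]; [rewrite measure0|exists 0%N]. Qed.

(* [Z i] is the pair (X_(i+1), Y_(i+1)), so that the sample of size n is
   Z 0, ..., Z (n - 1). For a sample point w, the bootstrap sample of size k n
   lives on an arbitrary probability space (B n w, PB n w), whose probability
   is the conditional probability given Z 0 w, ..., Z (n - 1) w. *)
Theorem theorem4p4
  (R : realType) (d : measure_display) (T : measurableType d)
  (Pr : probability T R)
  (P : probability (R * R)%type R)
  (Z : nat -> T -> R * R)
  (hZ : iid_with_law Pr setT Z P)
  (a b c e : \bar R)
  (hsupp : P [set z : R * R | (a < z.1%:E < b)%E /\ (c < z.2%:E < e)%E] = 1%E)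
  (k : nat -> nat)
  (hk0 : forall n, (0 < n)%N -> (0 < k n)%N)
  (hk : k @ \oo --> \oo)
  (c0 : R)
  (hc0 : forall n, (0 < n)%N -> (k n)%:R / n%:R < c0)
  (dB : nat -> T -> measure_display)
  (B : forall (n : nat) (w : T), measurableType (dB n w))
  (PB : forall (n : nat) (w : T), probability (B n w) R)
  (Zb : forall (n : nat) (w : T), nat -> B n w -> R * R)
  (hZb : forall (n : nat) (w : T), (0 < n)%N ->
     iid_with_law (PB n w) `I_(k n) (Zb n w) (empirical n (Z ^~ w)))
  (an : nat -> R)
  (han0 : forall n, (0 < n)%N -> 0 < an n)
  (han_decr : forall m n, (0 < m)%N -> (m <= n)%N -> an n <= an m)
  (han_cvg0 : an n @[n --> \oo] --> 0)
  (han_ratio : an n.+1 / an n @[n --> \oo] --> (1 : R))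
  (hkan : (k n)%:R * an n ^+ 2 @[n --> \oo] --> +oo)
  (p1 q1 p2 q2 : R)
  (hp1 : 0 < p1) (hpq1 : p1 < q1) (hq1 : q1 < 1)
  (hp2 : 0 < p2) (hpq2 : p2 < q2) (hq2 : q2 < 1)
  (eps : R) (heps : 0 < eps) :
  let F := left_df P in
  let G := right_df P in
  let H := joint_df P in
  let I1 := `[quantile F p1 - eps, quantile F q1 + eps]%classic in
  let I2 := `[quantile G p2 - eps, quantile G q2 + eps]%classic in
  (forall x, I1 x -> derivable F x 1) ->
  {within I1, continuous derive1 F} ->
  (forall x, I1 x -> 0 < derive1 F x) ->
  (forall y, I2 y -> derivable G y 1) ->
  {within I2, continuous derive1 G} ->
  (forall y, I2 y -> 0 < derive1 G y) ->
  (forall x y, I1 x -> I2 y -> derivable (fun x' => H x' y) x 1) ->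
  {within I1 `*` I2, continuous (fun z : R * R => dHdx P z.1 z.2)} ->
  (forall x y, I1 x -> I2 y -> derivable (fun y' => H x y') y 1) ->
  {within I1 `*` I2, continuous (fun z : R * R => dHdy P z.1 z.2)} ->
  forall Om : set (rect p1 q1 p2 q2 -> R), Om `<=` ell_infty ->
  let event (n : nat) (w : T) : set (B n w) :=
    [set v : B n w |
       scale_set (an n) Om
         (fun s : rect p1 q1 p2 q2 =>
            copula (empirical (k n) (fun i => Zb n w i v)) (val s)
            - copula (empirical n (fun i => Z i w)) (val s))] in
  liminf_ge_as Pr
    (fun n w => ((((k n)%:R * an n ^+ 2)^-1)%:E
                 * lne (inner_prob (PB n w) (event n w)))%E)
    (- I_C P (linf_interior Om))%E
  /\
  limsup_le_as Pr
    (fun n w => ((((k n)%:R * an n ^+ 2)^-1)%:E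
                 * lne (outer_prob (PB n w) (event n w)))%E)
    (- I_C P (linf_closure Om))%E.
Proof.
have pq1 := ltW hpq1; have pq2 := ltW hpq2.
move=> F G H I1 I2 dF cF pF dG cG pG dHx cHx dHy cHy Om hOm event.
have b1 : exists l r, F l < p1 /\ q1 <= F r.
  have [l [_ [h1 _]]] := left_df_bounds P hp1 (lt_trans hpq1 hq1).
  by have [_ [r [_ h2]]] := left_df_bounds P (lt_trans hp1 hpq1) hq1; exists l, r.
have b2 : exists l r, G l < p2 /\ q2 <= G r.
  have [l [_ [h1 _]]] := right_df_bounds P hp2 (lt_trans hpq2 hq2).
  by have [_ [r [_ h2]]] := right_df_bounds P (lt_trans hp2 hpq2) hq2; exists l, r.
have hmF : {homo F : x y / x <= y} := @left_df_homo R P.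
have hmG : {homo G : x y / x <= y} := @right_df_homo R P.
have q1q : quantile F p1 <= quantile F q1.
  by have [l [r [h1 h2]]] := b1; exact: quantile_le hmF h1 pq1 h2.
have q2q : quantile G p2 <= quantile G q2.
  by have [l [r [h1 h2]]] := b2; exact: quantile_le hmG h1 pq2 h2.
pose lo1 := quantile F p1 - eps; pose len1 := quantile F q1 + eps - lo1.
pose lo2 := quantile G p2 - eps; pose len2 := quantile G q2 + eps - lo2.
have E1 : lo1 + len1 = quantile F q1 + eps by rewrite /len1; ring.
have E2 : lo2 + len2 = quantile G q2 + eps by rewrite /len2; ring.
have len10 : 0 < len1 by rewrite /len1 /lo1; move: q1q heps; clear; lra.
have len20 : 0 < len2 by rewrite /len2 /lo2; move: q2q heps; clear; lra.
have I1E x : lo1 <= x <= lo1 + len1 -> I1 x by rewrite E1 /I1/= in_itv.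
have I2E x : lo2 <= x <= lo2 + len2 -> I2 x by rewrite E2 /I2/= in_itv.
have I1F : I1 = `[lo1, lo1 + len1]%classic by rewrite E1.
have I2F : I2 = `[lo2, lo2 + len2]%classic by rewrite E2.
rewrite I1F in cF; rewrite I2F in cG; rewrite I1F I2F in cHx cHy.
have [|m1 [L1 [m10 L10 sF]]] := smooth_df_derive _ (fun x hx => dF x (I1E x hx)) cF
  (fun x hx => pF x (I1E x hx)); first by rewrite lerDl ltW.
have [|m2 [L2 [m20 L20 sG]]] := smooth_df_derive _ (fun x hx => dG x (I2E x hx)) cG
  (fun x hx => pG x (I2E x hx)); first by rewrite lerDl ltW.
have [L3 L30 sH] := smooth_df2_derive (fun x y hx hy => dHx x y (I1E x hx) (I2E y hy))
  (fun x y hx hy => dHy x y (I1E x hx) (I2E y hy)) cHx cHy.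
pose m := Num.min 1 (Num.min m1 m2); pose L := Num.max L1 (Num.max L2 L3).
have m0 : 0 < m by rewrite !lt_min ltr01 m10 m20.
have mle1 : m <= 1 by rewrite ge_min lexx.
have L0 : 0 < L by rewrite lt_max L10.
have hF : smooth_df F (derive1 F) lo1 (lo1 + len1) m L.
  by apply: sF; rewrite ?ge_min ?le_max lexx ?orbT.
have hG : smooth_df G (derive1 G) lo2 (lo2 + len2) m L.
  by apply: sG; rewrite ?ge_min ?le_max lexx ?orbT.
have hH : smooth_df2 H (dHdx P) (dHdy P) lo1 (lo1 + len1) lo2 (lo2 + len2) L.
  by apply: sH; rewrite ?le_max lexx ?orbT.
have dom1 u : p1 <= u <= q1 -> [/\ lo1 <= quantile F u - eps,
    quantile F u + eps <= lo1 + len1 & F (quantile F u) = u].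
  have := hF; rewrite E1 => hF' hu.
  have [_ /(_ u hu)[h1 h2 h3]] := quantile_domain hmF b1 pq1 heps L0 hF'.
  by rewrite /lo1 !lerD2r.
have dom2 u : p2 <= u <= q2 -> [/\ lo2 <= quantile G u - eps,
    quantile G u + eps <= lo2 + len2 & G (quantile G u) = u].
  have := hG; rewrite E2 => hG' hu.
  have [_ /(_ u hu)[h1 h2 h3]] := quantile_domain hmG b2 pq2 heps L0 hG'.
  by rewrite /lo2 !lerD2r.
have upper := outer_prob_upper hZ hk0 hc0 hZb han0 han_cvg0 hkan len10 len20 L0 m0 mle1 heps
  pq1 pq2 hF hG hH dom1 dom2 hOm.
have lower := inner_prob_lower hZ hk0 hc0 hZb han0 han_cvg0 hkan len10 len20 L0 m0 mle1 heps
  pq1 pq2 hF hG hH dom1 dom2 (Om := Om).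
have IC0 := I_C_ge0 P.
have upper_events (r : R) : (r%:E < I_C P (linf_closure Om))%E ->
    exists E : nat -> set T, [/\ forall n, measurable (E n), eventually_as Pr E
    & exists N, forall n w, (N <= n)%N -> E n w ->
      (r%:E <= - ((((k n)%:R * an n ^+ 2)^-1)%:E * lne (outer_prob (PB n w) (event n w))))%E].
  (* For a negative level the bound is immediate, the logarithm of a probability being at most 0. *)
  move=> hr; have [r0|r0] := ltrP r 0.
    exists (fun=> setT); split=> //; first exact: eventually_asT.
    exists 1%N => n w n0 _; rewrite leeNr -EFinN.
    have h0 : (lne (outer_prob (PB n w) (event n w)) <= 0)%E.
      by rewrite lne_le0 -(probability_setT (PB n w)) outer_prob_le.
    apply: (@le_trans _ _ 0%E); last by rewrite lee_fin oppr_ge0 ltW.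
    by rewrite mule_ge0_le0// lee_fin invr_ge0 mulr_ge0// sqr_ge0.
  (* A level strictly between [r] and the infimum leaves the room [r1 - r] for the accuracy. *)
  have [r1 rr1 hr1] : exists2 r1 : R, r < r1 & (r1%:E < I_C P (linf_closure Om))%E.
    case: (I_C P (linf_closure Om)) hr => [x| |//] hr.
      by exists ((r + x) / 2); rewrite ?lte_fin in hr *; move: hr; clear; lra.
    by exists (r + 1); rewrite ?ltry// ltrDl.
  have [E [mE asE [N hN]]] := upper r1 (r1 - r) (le_trans r0 (ltW rr1)) (etrans (subr_gt0 _ _) rr1) hr1.
  exists E; split=> //; exists N => n w Nn Ew; have [s0 h] := hN n w Nn Ew.
  rewrite leeNr -EFinN; apply: lne_scale_le => //; first exact: outer_prob_ge0.
  by move: h; rewrite (_ : r1 - (r1 - r) = r)//; ring.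
split.
  have := IC0 p1 q1 p2 q2 (linf_interior Om).
  (* An infinite infimum makes the lower bound trivial. *)
  case HI: (I_C P (linf_interior Om)) => [x| |//] x0; last exact: liminf_ge_asNy.
  rewrite -EFinN; apply: liminf_ge_as_events => r rx.
  rewrite lee_fin in x0.
  (* The level is the midpoint of [x] and [- r], and the accuracy is its distance to [- r]. *)
  have h1 : 0 <= (x - r) / 2 by move: x0 rx; clear; lra.
  have h2 : 0 < (- r - x) / 2 by move: rx; clear; lra.
  have [|E [mE asE [N hN]]] := lower _ _ h1 h2.
    by rewrite HI lte_fin; move: rx; clear; lra.
  exists E; split=> //; exists N => n w Nn Ew; have [s0 h] := hN n w Nn Ew.
  rewrite -[r]opprK; apply: lne_scale_ge => //.
  by move: h; rewrite (_ : (x - r) / 2 + (- r - x) / 2 = - r)//; field.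
rewrite /limsup_le_as.
have := IC0 p1 q1 p2 q2 (linf_closure Om).
case HI: (I_C P (linf_closure Om)) upper_events => [x| |//] upper_events _.
  rewrite (_ : (_ == _) = false)// oppeK; apply: liminf_ge_as_events => r rx.
  by apply: upper_events; rewrite lte_fin.
(* An infinite infimum is the case [-oo] of [limsup_le_as]: every level lies below it, so every [r]
   is reached. *)
rewrite eqxx => r r0; apply: liminf_ge_as_events => r' _.
by apply: upper_events; rewrite ltry.
Qed.
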